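(* Assume that $V \in L^\infty(\Omega)$ is real-valued, that $\sigma > 0$, and that the exact solution $\psi$ of the nonlinear Schrödinger equation (NLSE) given in the context satisfies $\psi \in C([0, T]; H^2_{\mathrm{per}}(\Omega)) \cap C^1([0, T]; L^2(\Omega))$. Let $\psi_N^n$ ($n\ge0$) be the fully discrete sEWI-FS approximations with time step $\tau$ and mesh size $h$ defined in the context. Then there exist $\tau_0>0$ and $h_0>0$ sufficiently small and a constant $C>0$ independent of $\tau$, $h$ and $n$ such that for all $0<\tau<\tau_0$, all $0<h<h_0$ and all integers $n$ with $0 \leq n \leq T/\tau$, $$\| \psi(\cdot, t_n) - \psi_N^n \|_{L^2} \leq C( \tau+h^2), \qquad \|\psi_N^n\|_{H^2}\le C,\qquad \| \psi(\cdot, t_n) - \psi_N^n \|_{H^1} \leq C( \tau^{1/2}+h).$$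
   Context: Let $\Omega=(a,b)\subset\mathbb{R}$ be a bounded interval. For integers $m\ge1$, $H^m_{\mathrm{per}}(\Omega)=\{\phi\in H^m(\Omega): \phi^{(k)}(a)=\phi^{(k)}(b),\ k=0,\dots,m-1\}$. All functions are complex-valued unless said otherwise. NLSE: with periodic boundary conditions on $\Omega$, $i\partial_t\psi = -\Delta\psi + V\psi + f(|\psi|^2)\psi$ for $x\in\Omega$, $t>0$, and $\psi(\cdot,0)=\psi_0$, where $\Delta=\partial_{xx}$, $V$ is a given real-valued potential, and $f(\rho)=\beta\rho^\sigma$ for $\rho\ge0$ with fixed $\beta\in\mathbb{R}$ and $\sigma>0$. Let $T_{\max}$ be the maximal existence time of the solution and fix $0<T<T_{\max}$. Define $B(v)=Vv+f(|v|^2)v$. Fourier coefficients: $\widehat u_l=\frac1{b-a}\int_a^b u(x)e^{-i\mu_l(x-a)}\,dx$, $\mu_l=\frac{2\pi l}{b-a}$, $l\in\mathbb{Z}$. Operators that are functions of $\Delta$ are Fourier multipliers obtained by replacing $\Delta$ by $-\mu_l^2$. Let $\varphi_{\mathrm s}(\theta)=\frac{\sin\theta}{\theta}$ (value $1$ at $0$) and $\varphi_1(z)=\frac{e^z-1}{z}$ (value $1$ at $0$). Mesh size: $h=(b-a)/N$ with $N$ a positive even integer; $\mathcal T_N=\{-N/2,\dots,N/2-1\}$; $X_N=\mathrm{span}\{e^{i\mu_l(x-a)}:l\in\mathcal T_N\}$; $P_N:L^2(\Omega)\to X_N$ is the $L^2$-projection $(P_Nu)(x)=\sum_{l\in\mathcal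 T_N}\widehat u_l e^{i\mu_l(x-a)}$. Fully discrete sEWI-FS: for a time step $\tau>0$ and $t_n=n\tau$, $\psi_N^0=P_N\psi_0$, $\ \psi_N^1=e^{i\tau\Delta}\psi_N^0-i\tau\varphi_1(i\tau\Delta)P_NB(\psi_N^0)$, and $\psi_N^{n+1}=e^{2i\tau\Delta}\psi_N^{n-1}-2i\tau e^{i\tau\Delta}\varphi_{\mathrm s}(\tau\Delta)P_NB(\psi_N^n)$ for $n\ge1$. *)

(* Defs.v *)
From HB Require Import structures.
From mathcomp Require Import all_boot all_order all_algebra.
From mathcomp Require Import all_classical all_reals all_analysis.
From mathcomp Require Import complex.

Set Implicit Arguments.
Unset Strict Implicit.
Unset Printing Implicit Defensive.

Import Order.TTheory GRing.Theory Num.Theory.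
Import numFieldNormedType.Exports.
Import Normc.

Local Open Scope classical_set_scope.
Local Open Scope complex_scope.
Local Open Scope ring_scope.

(* Elements of L^2(a, b) and H^m(a, b) are represented by functions R -> R[i];
   only their values almost everywhere on ]a, b[ are relevant. *)

Section FunctionSpaces.
Variables (R : realType) (a b : R).

Definition ae_eq_on (u v : R -> R[i]) : Prop :=
  {ae (@lebesgue_measure R), forall x : R, x \in `]a, b[ -> u x = v x}.

(* The integral of u over the interval: Rintegral is not complex-valued *)
Definition cintegral (u : R -> R[i]) : R[i] :=
  Rintegral lebesgue_measure `]a, b[ (fun x => complex.Re (u x)) +i*
  Rintegral lebesgue_measure `]a, b[ (fun x => complex.Im (u x)).

Definition L2norm (u : R -> R[i]) : \bar R :=
  ((\int[lebesgue_measure]_(x in `]a, b[) (normc (u x) ^+ 2)%:E) `^ 2^-1)%E.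

Definition L2 (u : R -> R[i]) : Prop :=
  [/\ measurable_fun `]a, b[ (fun x => complex.Re (u x)),
      measurable_fun `]a, b[ (fun x => complex.Im (u x)) &
      (L2norm u < +oo)%E].

Definition Linfty (V : R -> R) : Prop :=
  measurable_fun `]a, b[ V /\
  exists M : R,
    {ae (@lebesgue_measure R), forall x : R, x \in `]a, b[ -> `|V x| <= M}.

(* C_c^oo(]a, b[); real-valued test functions suffice for complex-valued u,
   by linearity *)
Definition test_function (phi : R -> R) : Prop :=
  (forall (n : nat) (x : R), derivable (derive1n n phi) x 1) /\
  exists c d : R, [/\ a < c, d < b & forall x, phi x != 0 -> c <= x <= d].

Definition weak_deriv (u g : R -> R[i]) : Prop :=
  forall phi, test_function phi ->
    cintegral (fun x => u x * (derive1 phi x)%:C) =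
    - cintegral (fun x => g x * (phi x)%:C).

(* g k is the k-th weak derivative of u, for k <= m, and all are in L^2 *)
Definition weak_jet (m : nat) (u : R -> R[i]) (g : nat -> R -> R[i]) : Prop :=
  [/\ g 0%N = u,
      forall k, (k <= m)%N -> L2 (g k) &
      forall k, (k < m)%N -> weak_deriv (g k) (g k.+1)].

(* The boundary values of u^(k), k < m, are those of its representative that
   is continuous on [a, b]. *)
Definition Hper (m : nat) (u : R -> R[i]) : Prop :=
  exists2 g, weak_jet m u g &
    forall k, (k < m)%N -> exists v : R -> R[i],
      [/\ {within `[a, b], continuous (fun x => complex.Re (v x))},
          {within `[a, b], continuous (fun x => complex.Im (v x))},
          ae_eq_on v (g k) & v a = v b].

(* Weak derivatives being unique almost everywhere, the set below has exactly
   one element if u is in H^m; otherwise it is empty and the norm is +oo. *)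
Definition Hnorm (m : nat) (u : R -> R[i]) : \bar R :=
  ereal_inf [set ((\sum_(k < m.+1) L2norm (g k) ^+ 2) `^ 2^-1)%E
            | g in weak_jet m u].

(* u in C([0, T]; Y), where nrm is the norm of Y *)
Definition time_continuous (nrm : (R -> R[i]) -> \bar R) (T : R)
    (u : R -> R -> R[i]) : Prop :=
  forall t : R, t \in `[0, T] ->
    nrm (u s \- u t) @[s --> within `[0, T] (nbhs t)] --> 0%E.

(* u in C^1([0, T]; L^2), with time derivative du (one-sided at 0 and T) *)
Definition time_C1_L2 (T : R) (u du : R -> R -> R[i]) : Prop :=
  [/\ forall t : R, t \in `[0, T] -> L2 (u t) /\ L2 (du t),
      time_continuous L2norm T du &
      forall t : R, t \in `[0, T] ->
        L2norm (fun x => ((s - t)^-1)%:C * (u s x - u t x) - du t x)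
          @[s --> within `[0, T] (t^')] --> 0%E].

End FunctionSpaces.

Section NLSE.
Variables (R : realType) (a b : R) (V : R -> R) (beta sigma : R).

Definition nonlin_f (rho : R) : R := beta * rho `^ sigma.

Definition opB (v : R -> R[i]) (x : R) : R[i] :=
  (V x)%:C * v x + (nonlin_f (normc (v x) ^+ 2))%:C * v x.

(* i d_t psi = - Delta psi + V psi + f(|psi|^2) psi in L^2(a, b) for 0 < t <= T,
   with g 2 the weak Laplacian of psi(t) *)
Definition solves_NLSE (T : R) (psi0 : R -> R[i]) (psi dpsi : R -> R -> R[i]) :
    Prop :=
  ae_eq_on a b (psi 0) psi0 /\
  forall t, 0 < t <= T ->
    exists2 g, weak_jet a b 2 (psi t) g &
      ae_eq_on a b (fun x => 'i%C * dpsi t x)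
                   (fun x => - g 2%N x + opB (psi t) x).

End NLSE.

Section SpectralScheme.
Variables (R : realType) (a b : R).

Definition cexp (z : R[i]) : R[i] :=
  (expR (complex.Re z))%:C * (cos (complex.Im z) +i* sin (complex.Im z)).

Definition phi_s (theta : R) : R := if theta == 0 then 1 else sin theta / theta.

Definition phi_1 (z : R[i]) : R[i] := if z == 0 then 1 else (cexp z - 1) / z.

Definition mu_ (l : int) : R := 2 * pi * l%:~R / (b - a).

Definition fourier_basis (l : int) (x : R) : R[i] :=
  cexp ('i%C * (mu_ l * (x - a))%:C).

Definition fourier_coef (u : R -> R[i]) (l : int) : R[i] :=
  ((b - a)^-1)%:C *
  cintegral a b (fun x => u x * cexp (- 'i%C * (mu_ l * (x - a))%:C)).

(* Enumerates T_N = {- N/2, ..., N/2 - 1}, for N even *)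
Definition freq (N : nat) (k : 'I_N) : int := (k : nat)%:Z - (N./2)%:Z.

Definition PN (N : nat) (u : R -> R[i]) (x : R) : R[i] :=
  \sum_(k < N) fourier_coef u (freq k) * fourier_basis (freq k) x.

(* m(Delta) has the symbol m(- mu_l^2).  The sum is cut off to T_N because the
   scheme applies m(Delta) only to u in X_N, the span of the modes l in T_N. *)
Definition multiplier (N : nat) (m : R -> R[i]) (u : R -> R[i]) (x : R) : R[i] :=
  \sum_(k < N) m (- mu_ (freq k) ^+ 2) * fourier_coef u (freq k) *
               fourier_basis (freq k) x.

Variables (V : R -> R) (beta sigma : R) (psi0 : R -> R[i]) (N : nat) (tau : R).

Definition exp_iDelta (t : R) : (R -> R[i]) -> R -> R[i] :=
  multiplier N (fun d => cexp ('i%C * (t * d)%:C)).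

Definition phi1_iDelta (t : R) : (R -> R[i]) -> R -> R[i] :=
  multiplier N (fun d => phi_1 ('i%C * (t * d)%:C)).

Definition phis_Delta (t : R) : (R -> R[i]) -> R -> R[i] :=
  multiplier N (fun d => (phi_s (t * d))%:C).

Fixpoint sEWI_FS (n : nat) : R -> R[i] :=
  match n with
  | 0%N => PN N psi0
  | 1%N => fun x =>
      exp_iDelta tau (PN N psi0) x -
      'i%C * tau%:C *
        phi1_iDelta tau (PN N (opB V beta sigma (PN N psi0))) x
  | (p.+1 as q).+1 => fun x =>
      exp_iDelta (2 * tau) (sEWI_FS p) x -
      2 * 'i%C * tau%:C *
        exp_iDelta tau
          (phis_Delta tau (PN N (opB V beta sigma (sEWI_FS q)))) x
  end.

End SpectralScheme.

(* Main.v *)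
Require Import Defs.
From HB Require Import structures.
From mathcomp Require Import all_boot all_order all_algebra.
From mathcomp Require Import all_classical all_reals all_analysis.
From mathcomp Require Import complex measurable_realfun ring lra zify.

Set Implicit Arguments.
Unset Strict Implicit.
Unset Printing Implicit Defensive.

Import Order.TTheory GRing.Theory Num.Theory.
Import numFieldNormedType.Exports.

Local Open Scope classical_set_scope.
Local Open Scope complex_scope.
Local Open Scope ring_scope.

(** Let [c_n] be the Fourier coefficients of [psi] at the time [t_n], let [z_n]
    and [b_n] be those of the numerical solution and of its nonlinearity [B], and
    let [theta = tau * mu_l ^ 2].  The scheme reads
      [z_(n+1) = exp(-2 i theta) z_(n-1) - 2 i tau exp(-i theta) phi_s(theta) b_n].
    Variation of constants over [[t_n - tau, t_n + tau]], with the forcing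
    [B(psi)] frozen at the middle time, shows that [c_n] satisfies the same
    recursion with the coefficients of [B(psi)], up to a truncation error. The
    frozen forcing is only off by its increments in time, and these are
    [O(tau)] in [L^2]: [psi] is Lipschitz in time with values in [L^2]
    ([psi_lipschitz]), and [B] is Lipschitz in [L^2] on functions bounded by a
    common constant ([opB_lipschitz]), for any bounded [V]. The truncation
    error is thus [O(tau ^ 2)] ([local_error], [truncationS]), with no
    regularity of [B(psi)] in space. As the linear part of the recursion is
    unitary, a two-step Gronwall argument bounds the error in [L^2] by
    [O(tau + h ^ 2)] ([error_bound]), [h ^ 2] being the [L^2] size of the high
    frequencies of a function in [H^2].

    This argument needs a bound on the numerical solution in the supremum norm,
    which comes from [H^2].  The identity
      [mu_l ^ 2 * 2 i tau exp(-i theta) phi_s(theta) = 1 - exp(-2 i theta)]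
    turns the recursion into one for [w_n = mu_l ^ 2 z_(n+1) + b_n],
      [w_(n+2) = exp(-2 i theta) (w_n + b_(n+2) - b_n)],
    so that the Laplacian of the numerical solution grows only through the
    increments [b_(n+2) - b_n].  They are [O(tau)], because
    [z_(n+1) - z_n] obeys the same recursion as the error and starts at [O(tau)]
    ([increment_bound], [laplacian_bound]).  Interpolating the error between
    [L^2] and [H^2] makes it small in the supremum norm when [tau] and [h] are
    small, and an induction on [n] closes the argument ([bootstrap]).  The [H^1]
    error is the same interpolation.

    What links the weak formulation to coefficients is that the weak derivatives
    of a periodic function have the expected coefficients ([coef_weak_deriv]) and
    that its partial Fourier sums approximate it together with its derivative
    ([Hper2_fourier]).  Pointwise convergence of Fourier series is proved
    by Chernoff's telescoping argument ([cvg_fourier_lipschitz]). *)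

(** * Smooth steps *)

Section SmoothStep.
Variable R : realType.
Implicit Types (f g : R -> R) (p : {poly R}).

(** The recursion on derivatives, unlike a statement about all iterated
    derivatives, lets sums, products and inverses be treated by induction. *)
Fixpoint Cdiff (n : nat) f : Prop :=
  if n is m.+1 then (forall x : R, derivable f x 1) /\ Cdiff m (derive1 f) else True.

Definition smooth f := forall n, Cdiff n f.

Lemma smooth_derive1n f : smooth f ->
  forall n (x : R), derivable (derive1n n f) x 1.
Proof.
move=> sf n; have : Cdiff n.+1 f by exact: sf.
elim: n f {sf} => [|n IH] f; first by case.
by rewrite derive1Sn => -[_ /IH].
Qed.

Lemma is_derive1P f (x d : R) : is_derive x 1 f d -> (derive1 f) x = d.
Proof. by move=> [_ <-]; rewrite derive1E. Qed.

Lemma is_derive1E f f' : (forall x : R, is_derive x 1 f (f' x)) -> (derive1 f) = f'.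
Proof. by move=> H; apply/funext => x; apply: is_derive1P. Qed.

Lemma CdiffW n f : Cdiff n.+1 f -> Cdiff n f.
Proof. by elim: n f => [//|n IH] f [df H]; split => //; apply: IH. Qed.

Lemma smooth_derivable f : smooth f -> forall x : R, derivable f x 1.
Proof. by move=> /(_ 1%N)[]. Qed.

Lemma smooth_is_derive f (x : R) : smooth f -> is_derive x 1 f ((derive1 f) x).
Proof. by move=> sf; rewrite derive1E; apply/derivableP/smooth_derivable. Qed.

Lemma smooth_derive1 f : smooth f -> smooth (derive1 f).
Proof. by move=> sf n; have [] := sf n.+1. Qed.

Lemma smooth_continuous f : smooth f -> continuous f.
Proof.
move=> sf x; apply: differentiable_continuous.
exact/derivable1_diffP/smooth_derivable.
Qed.

(** A family of differentiable functions stable under derivation consists of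
    smooth functions. *)
Lemma smooth_coind (P : (R -> R) -> Prop) :
  (forall f, P f -> (forall x : R, derivable f x 1) /\ P (derive1 f)) ->
  forall f, P f -> smooth f.
Proof.
move=> H f Pf n; elim: n f Pf => [//|n IH] f Pf.
by have [df Pf'] := H _ Pf; split => //; apply: IH.
Qed.

Lemma CdiffD n f g : Cdiff n f -> Cdiff n g -> Cdiff n (fun x => f x + g x).
Proof.
elim: n f g => [//|n IH] f g [df cf] [dg cg]; split.
  by move=> x; apply: derivableD.
rewrite (_ : derive1 (fun x => f x + g x) = fun x => derive1 f x + derive1 g x); first exact: IH.
apply/funext => x; rewrite !derive1E deriveD //.
Qed.

Lemma CdiffM n f g : Cdiff n f -> Cdiff n g -> Cdiff n (fun x => f x * g x).
Proof.
elim: n f g => [//|n IH] f g cf cg; have [df cf'] := cf; have [dg cg'] := cg.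
split; first by move=> x; apply: derivableM.
rewrite (_ : derive1 (fun x => f x * g x) = fun x => f x * (derive1 g) x + g x * (derive1 f) x).
  by apply: CdiffD; apply: IH => //; apply: CdiffW.
by apply/funext => x; rewrite !derive1E deriveM.
Qed.

Lemma smoothD f g : smooth f -> smooth g -> smooth (fun x => f x + g x).
Proof. by move=> sf sg n; apply: CdiffD. Qed.

Lemma smoothM f g : smooth f -> smooth g -> smooth (fun x => f x * g x).
Proof. by move=> sf sg n; apply: CdiffM. Qed.

Lemma smooth_cst c : smooth (fun=> c).
Proof.
apply: (@smooth_coind (fun f => exists c, f = fun=> c)); last by exists c.
move=> _ [{}c ->]; split; first by move=> x; apply: derivable_cst.
by exists 0; apply: is_derive1E => x; apply: is_derive_cst.
Qed.

Lemma smoothN f : smooth f -> smooth (fun x => - f x).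
Proof.
move=> sf; rewrite (_ : (fun x => - f x) = fun x => -1 * f x).
  by apply: smoothM => //; apply: smooth_cst.
by apply/funext => x; rewrite mulN1r.
Qed.

Lemma CdiffV n f : (forall x, f x != 0) -> Cdiff n f ->
  Cdiff n (fun x => (f x)^-1).
Proof.
move=> f0; elim: n => [//|n IH] cf; have [df cf'] := cf.
split; first by move=> x; apply: derivableV.
rewrite (_ : derive1 (fun x => (f x)^-1) =
    fun x => - 1 * ((f x)^-1 * ((f x)^-1 * (derive1 f) x))).
  by apply: CdiffM; [exact: smooth_cst|]; do 2?apply: CdiffM => //; apply/IH/CdiffW.
apply/funext => x; rewrite !derive1E deriveV// mulN1r scaleNr /GRing.scale/=.
by rewrite expr2 invfM mulrA.
Qed.

Lemma smoothV f : (forall x, f x != 0) -> smooth f -> smooth (fun x => (f x)^-1).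
Proof. by move=> f0 sf n; apply: CdiffV. Qed.

Lemma is_derive_affine f (k c x d : R) : is_derive (k * x + c) 1 f d ->
  is_derive x 1 (fun y => f (k * y + c)) (k * d).
Proof.
move=> df.
have da : is_derive x 1 (fun y => k * y + c) k.
  apply/is_derive1_caratheodory; exists (cst k); split => //.
    by move=> z; rewrite opprD addrACA subrr addr0 -mulrBr.
  exact: cst_continuous.
by have := @is_derive1_comp _ f (fun y => k * y + c) x _ _ df da; rewrite mulrC.
Qed.

Lemma smooth_affine f (k c : R) : smooth f -> smooth (fun x => f (k * x + c)).
Proof.
move=> sf.
apply: (@smooth_coind
  (fun g => exists m h, smooth h /\ g = fun x => m * h (k * x + c))); last first.
  by exists 1, f; split => //; apply/funext => x; rewrite mul1r.
move=> _ [m [h [sh ->]]].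
have D (x : R) : is_derive x 1 (fun x => m * h (k * x + c)) (m * k * (derive1 h) (k * x + c)).
  have := is_derive_affine (smooth_is_derive (k * x + c) sh) => D.
  have := @is_deriveZ _ _ _ _ m _ _ _ D.
  by move=> D'; apply: (is_derive_eq D'); rewrite /GRing.scale/= mulrA.
split; first by move=> x; have [] := D x.
exists (m * k), (derive1 h); split; first exact: smooth_derive1.
exact: is_derive1E.
Qed.

Lemma smooth_sin : smooth (@sin R).
Proof.
apply: (@smooth_coind
  (fun f => exists s c : R, f = fun x => s * sin x + c * cos x)); last first.
  by exists 1, 0; apply/funext => x; rewrite mul1r mul0r addr0.
move=> _ [s [c ->]].
have D (x : R) : is_derive x 1 (fun x => s * sin x + c * cos x) ((- c) * sin x + s * cos x).
  have D1 := @is_deriveZ _ _ _ _ s _ _ _ (is_derive_sin x).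
  have D2 := @is_deriveZ _ _ _ _ c _ _ _ (is_derive_cos x).
  apply: (is_derive_eq (is_deriveD D1 D2)).
  by rewrite /GRing.scale/= addrC mulrN mulNr.
split; first by move=> x; have [] := D x.
by exists (- c), s; apply: is_derive1E.
Qed.

Lemma smooth_cos : smooth (@cos R).
Proof.
have := smooth_derive1 smooth_sin.
by rewrite (@is_derive1E sin cos).
Qed.

Lemma smooth_sin_lin k c : smooth (fun x => sin (k * (x - c))).
Proof.
have := smooth_affine k (- (k * c)) smooth_sin.
by congr smooth; apply/funext => x; rewrite mulrBr.
Qed.

Lemma smooth_cos_lin k c : smooth (fun x => cos (k * (x - c))).
Proof.
have := smooth_affine k (- (k * c)) smooth_cos.
by congr smooth; apply/funext => x; rewrite mulrBr.
Qed.

Lemma is_derive_sin_lin (k c x : R) :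
  is_derive x 1 (fun x => sin (k * (x - c))) (k * cos (k * (x - c))).
Proof.
rewrite mulrBr.
have := @is_derive_affine sin k (- (k * c)) x _ (is_derive_sin _).
by congr (is_derive _ _ _ _); apply/funext => y; rewrite mulrBr.
Qed.

Lemma is_derive_cos_lin (k c x : R) :
  is_derive x 1 (fun x => cos (k * (x - c))) (- k * sin (k * (x - c))).
Proof.
rewrite mulNr -mulrN mulrBr.
have := @is_derive_affine cos k (- (k * c)) x _ (is_derive_cos _).
by congr (is_derive _ _ _ _); apply/funext => y; rewrite mulrBr.
Qed.

(** For [p = 1] this is the standard function that is flat at [0].  With an
    arbitrary polynomial in [1 / x] the family is stable under derivation. *)
Definition flat p (x : R) : R :=
  if 0 < x then p.[x^-1] * expR (- x^-1) else 0.

(** A monomial [x ^ -i] is absorbed by [exp (- 1 / x)], which is smaller than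
    any power of [x]; the two spare powers give the derivative at [0]. *)
Lemma flat_bound p : exists2 C, 0 <= C & forall x, `|flat p x| <= C * x ^+ 2.
Proof.
exists (\sum_(i < size p) `|p`_i| * (i.+2)`!%:R).
  by apply: sumr_ge0 => i _; rewrite mulr_ge0.
move=> x; rewrite /flat; case: ifPn => [x0|_]; last first.
  rewrite normr0 mulr_ge0 ?sqr_ge0//.
  by apply: sumr_ge0 => i _; rewrite mulr_ge0.
rewrite normrM (ger0_norm (expR_ge0 _)) horner_coef mulr_suml.
apply: (@le_trans _ _ (\sum_(i < size p) `|p`_i * x^-1 ^+ i| * expR (- x^-1))).
  by rewrite -mulr_suml ler_wpM2r ?expR_ge0// ler_norm_sum.
apply: ler_sum => i _.
rewrite normrM -!mulrA ler_wpM2l//.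
have y0 : 0 < x^-1 by rewrite invr_gt0.
rewrite ger0_norm ?exprn_ge0 ?(ltW y0)// expRN.
have := expR_ge1Dxn i.+1 (ltW y0) => H.
have {}H : x^-1 ^+ i.+2 / i.+2`!%:R <= expR x^-1 by apply: le_trans H; rewrite lerDr.
rewrite ler_pdivrMr ?expR_gt0//.
rewrite ler_pdivrMr ?ltr0n ?fact_gt0// in H.
(* The exponential series is truncated at degree [i + 2] to gain the factor [x ^ 2]. *)
have -> : x^-1 ^+ i = x ^+ 2 * x^-1 ^+ i.+2.
  have xx : x ^+ 2 * x^-1 ^+ 2 = 1 by rewrite exprVn divff// sqrf_eq0 gt_eqF.
  by rewrite -[i.+2]addn2 exprD mulrCA xx mulr1.
rewrite (_ : _ * x ^+ 2 * _ = x ^+ 2 * (expR x^-1 * i.+2`!%:R)); last by ring.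
by rewrite ler_wpM2l ?sqr_ge0.
Qed.

Lemma is_derive_flat p (x : R) :
  is_derive x 1 (flat p) (flat ('X^2 * (p - p^`())) x).
Proof.
have [x0|x0|x0] := ltgtP 0 x.
- have -> : flat ('X^2 * (p - p^`())) x =
      (- x ^- 2 * p^`().[x^-1]) * expR (- x^-1) + p.[x^-1] * (x ^- 2 * expR (- x^-1)).
    rewrite /flat x0 hornerM hornerXn hornerD hornerN exprVn.
    by move: p.[_] p^`().[_] (x ^- 2) => u v w; ring.
  apply: (@near_eq_is_derive _ _ _ (fun x : R => p.[x^-1] * expR (- x^-1))).
  + near=> y; rewrite /flat ifT//; near: y; exact: lt_nbhsr.
  + have dV : is_derive x 1 (fun x : R => x^-1) (- x ^- 2).
      have := @is_deriveV _ id x 1 1 (lt0r_neq0 x0) (is_derive_id x 1).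
      by move=> D; apply: (is_derive_eq D); rewrite /GRing.scale/= mulr1.
    have dp := @is_derive1_comp _ (horner p) (fun x => x^-1) x _ _ (is_derive_poly _ _) dV.
    have de := @is_derive1_comp _ expR (fun x : R => - x^-1) x _ _ (is_derive_expR _)
       (is_deriveN dV).
    apply: (is_derive_eq (is_deriveM dp de)).
    rewrite /= /GRing.scale/=; ring.
- rewrite {2}/flat ltNge (ltW x0)/=.
  apply: (@near_eq_is_derive _ _ _ (cst 0)).
  near=> y; rewrite /flat ifF//; apply/negbTE; rewrite -leNgt ltW//.
  near: y; exact: lt_nbhsl.
- rewrite -x0 {2}/flat ltxx.
  have [C C0 HC] := flat_bound p.
  apply/is_derive1_caratheodory; exists (fun z => flat p z / z).
  have f0 : flat p 0 = 0 by rewrite /flat ltxx.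
  split.
  + move=> z; rewrite f0 !subr0; have [->|z0] := eqVneq z 0; first by rewrite f0 mulr0.
    by rewrite divfK.
  + rewrite /prop_for /continuous_at /= f0 mul0r; apply/cvgr0Pnorm_le => e e0; near=> z.
    rewrite normrM normfV.
    have [->|z0] := eqVneq z 0; first by rewrite f0 normr0 mul0r ltW.
    rewrite ler_pdivrMr ?normr_gt0//; apply: (le_trans (HC z)).
    rewrite -real_normK ?num_real// expr2 mulrA ler_wpM2r//.
    have : `|z| < e / (C + 1).
      near: z; exists (e / (C + 1)); first by rewrite /= divr_gt0// ltr_wpDl.
      by move=> z /=; rewrite sub0r normrN.
    move/ltW; rewrite ler_pdivlMr ?ltr_wpDl// mulrDr mulr1 mulrC.
    by apply: le_trans; rewrite lerDl.
  + by rewrite f0 mul0r.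
Unshelve. all: by end_near. Qed.

Lemma smooth_flat p : smooth (flat p).
Proof.
apply: (@smooth_coind (fun f => exists p, f = flat p)); last by exists p.
move=> _ [{}p ->]; split; first by move=> x; have [] := is_derive_flat p x.
by exists ('X^2 * (p - p^`())); apply: is_derive1E => x; apply: is_derive_flat.
Qed.

Lemma flat1_ge0 x : 0 <= flat 1%:P x.
Proof. by rewrite /flat; case: ifP => // _; rewrite hornerE mul1r expR_ge0. Qed.

Lemma flat1_gt0 x : 0 < x -> 0 < flat 1%:P x.
Proof. by rewrite /flat => ->; rewrite hornerE mul1r expR_gt0. Qed.

Lemma flat_le0 p x : x <= 0 -> flat p x = 0.
Proof. by rewrite /flat leNgt => /negbTE ->. Qed.

Lemma derive_flat1_ge0 x : 0 <= derive1 (flat 1%:P) x.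
Proof.
rewrite (is_derive1P (is_derive_flat _ _)) /flat; case: ifP => // x0.
by rewrite derivC subr0 !hornerE mulr_ge0 ?expR_ge0// exprn_ge0// invr_ge0 ltW.
Qed.

Let den x := flat 1%:P (x - 1) + flat 1%:P (2 - x).

Let den_gt0 x : 0 < den x.
Proof.
have [x1|x1] := ltP 1 x.
  by rewrite /den ltr_pwDl ?flat1_ge0// flat1_gt0// subr_gt0.
by rewrite /den ltr_wpDl ?flat1_ge0// flat1_gt0// subr_gt0 (le_lt_trans x1)// ltr1n.
Qed.

Definition step01 x := flat 1%:P (x - 1) / den x.

Let is_derive_left (x : R) :
  is_derive x 1 (fun x => flat 1%:P (x - 1)) (derive1 (flat 1%:P) (x - 1)).
Proof.
have := @is_derive_affine (flat 1%:P) 1 (-1) x _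
  (smooth_is_derive (1 * x - 1) (smooth_flat _)).
rewrite !mul1r; congr (is_derive _ _ _ _).
by apply/funext => y; rewrite mul1r.
Qed.

Let is_derive_right (x : R) :
  is_derive x 1 (fun x => flat 1%:P (2 - x)) (- derive1 (flat 1%:P) (2 - x)).
Proof.
have := @is_derive_affine (flat 1%:P) (-1) 2 x _
  (smooth_is_derive (-1 * x + 2) (smooth_flat _)).
rewrite !mulN1r addrC; congr (is_derive _ _ _ _).
by apply/funext => y; rewrite mulN1r addrC.
Qed.

Lemma smooth_step01 : smooth step01.
Proof.
have s1 : smooth (fun x => flat 1%:P (x - 1)).
  have := @smooth_affine _ 1 (-1) (smooth_flat 1%:P).
  by congr smooth; apply/funext => x; rewrite mul1r.
have s2 : smooth (fun x => flat 1%:P (2 - x)).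
  have := @smooth_affine _ (-1) 2 (smooth_flat 1%:P).
  by congr smooth; apply/funext => x; rewrite mulN1r addrC.
apply: smoothM => //; apply: smoothV; last exact: smoothD.
by move=> x; rewrite gt_eqF// den_gt0.
Qed.

Lemma step01_0 x : x <= 1 -> step01 x = 0.
Proof. by move=> x1; rewrite /step01 flat_le0 ?subr_le0// mul0r. Qed.

Lemma step01_1 x : 2 <= x -> step01 x = 1.
Proof.
move=> x2; have := den_gt0 x; rewrite /step01 /den (@flat_le0 _ (2 - x)) ?subr_le0//.
by rewrite addr0 => d0; rewrite divff// gt_eqF.
Qed.

Lemma step01_ge0 x : 0 <= step01 x.
Proof. by rewrite divr_ge0 ?flat1_ge0// ltW ?den_gt0. Qed.

Lemma step01_le1 x : step01 x <= 1.
Proof. by rewrite ler_pdivrMr ?den_gt0// mul1r lerDl flat1_ge0. Qed.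

Lemma derive_step01_ge0 x : 0 <= derive1 step01 x.
Proof.
have d0 : den x != 0 by rewrite gt_eqF ?den_gt0.
have Dd : is_derive x 1 den _ := is_deriveD (is_derive_left x) (is_derive_right x).
have DV : is_derive x 1 (fun x => (den x)^-1) _ := is_deriveV d0 Dd.
have DM : is_derive x 1 step01 _ := is_deriveM (is_derive_left x) DV.
rewrite (is_derive1P DM) /GRing.scale/=.
have := derive_flat1_ge0 (x - 1); have := derive_flat1_ge0 (2 - x).
have := flat1_ge0 (x - 1); have := flat1_ge0 (2 - x).
move: d0; rewrite /den.
move: (flat _ (x - 1)) (flat _ (2 - x)) (derive1 _ (x - 1)) (derive1 _ (2 - x)).
move=> E1 E2 d1 d2 d0 E2_ge0 E1_ge0 d2_ge0 d1_ge0.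
(* Quotient rule: the numerator is a sum of nonnegative products. *)
rewrite (_ : _ + _ = (d1 * E2 + E1 * d2) / (E1 + E2) ^+ 2).
  by rewrite divr_ge0 ?sqr_ge0// addr_ge0// mulr_ge0.
by field.
Qed.

(** Vanishes up to [y + e], equals [1] from [y + 2 e] on, and increases in
    between. *)
Definition step (e y x : R) := step01 (e^-1 * x - e^-1 * y).

Lemma smooth_step e y : smooth (step e y).
Proof. exact: (@smooth_affine step01 e^-1 (- (e^-1 * y)) smooth_step01). Qed.

Lemma step_0 e y x : 0 < e -> x <= y + e -> step e y x = 0.
Proof.
move=> e0 xye; rewrite /step -mulrBr step01_0// mulrC ler_pdivrMr// mul1r.
by rewrite lerBlDl.
Qed.

Lemma step_1 e y x : 0 < e -> y + 2 * e <= x -> step e y x = 1.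
Proof.
move=> e0 xye; rewrite /step -mulrBr step01_1// mulrC ler_pdivlMr//.
by rewrite lerBrDl.
Qed.

Lemma step_ge0 e y x : 0 <= step e y x. Proof. exact: step01_ge0. Qed.

Lemma step_le1 e y x : step e y x <= 1. Proof. exact: step01_le1. Qed.

Lemma derive_step_ge0 e y x : 0 < e -> 0 <= derive1 (step e y) x.
Proof.
move=> e0; have := is_derive_affine
  (smooth_is_derive (e^-1 * x + - (e^-1 * y)) smooth_step01).
move/is_derive1P => ->; rewrite mulr_ge0 ?invr_ge0 ?(ltW e0)//.
exact: derive_step01_ge0.
Qed.

Lemma derive_step_0 (e y x : R) : 0 < e -> ~~ (y + e <= x <= y + 2 * e) ->
  derive1 (step e y) x = 0.
Proof.
move=> e0; rewrite negb_and -!ltNge => /orP[xy|xy].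
- apply: is_derive1P; apply: (@near_eq_is_derive _ _ _ (cst 0)).
  by near=> z; rewrite /= step_0// ltW//; near: z; exact: lt_nbhsl.
- apply: is_derive1P; apply: (@near_eq_is_derive _ _ _ (cst (1 : R))).
  by near=> z; rewrite /= step_1// ltW//; near: z; exact: lt_nbhsr.
Unshelve. all: by end_near. Qed.

End SmoothStep.

(** * Integration over an open interval *)

Section IntervalIntegral.
Variable R : realType.
Implicit Types (a b : R) (f g h : R -> R).

Local Notation mu := (@lebesgue_measure R).

Lemma eq_ler (x y : R) : x = y -> x <= y. Proof. by move->. Qed.

Lemma ae_impl (P Q : R -> Prop) : (forall x, P x -> Q x) ->
  {ae mu, forall x, P x} -> {ae mu, forall x, Q x}.
Proof. by move=> PQ H; apply: filterS H; first exact: (ae_filter_ringOfSetsType mu). Qed.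

Definition itg a b f := mu.-integrable `]a, b[%classic (EFin \o f).
Definition rint a b f := Rintegral mu `]a, b[%classic f.
Definition mfun a b f := measurable_fun (`]a, b[%classic : set (measurableTypeR R)) f.

Lemma measurable_oo a b : measurable (`]a, b[%classic : set (measurableTypeR R)).
Proof. exact: measurable_itv. Qed.
Hint Resolve measurable_oo : core.

Lemma eq_rint a b f g : {in `]a, b[, f =1 g} -> rint a b f = rint a b g.
Proof. by move=> fg; apply: eq_Rintegral => x; rewrite inE => /fg. Qed.

Lemma itg_mfun a b f : itg a b f -> mfun a b f.
Proof. by move=> /(measurable_int mu)/measurable_EFinP. Qed.

Lemma mfunD a b f g : mfun a b f -> mfun a b g -> mfun a b (fun x => f x + g x).
Proof. exact: measurable_funD. Qed.

Lemma mfunB a b f g : mfun a b f -> mfun a b g -> mfun a b (fun x => f x - g x).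
Proof. exact: measurable_funB. Qed.

Lemma mfunM a b f g : mfun a b f -> mfun a b g -> mfun a b (fun x => f x * g x).
Proof. exact: measurable_funM. Qed.

Lemma mfunX a b n f : mfun a b f -> mfun a b (fun x => f x ^+ n).
Proof. exact: measurable_funX. Qed.

Lemma mfun_cst a b c : mfun a b (fun=> c).
Proof. exact: measurable_cst. Qed.

Lemma mfunZ a b c f : mfun a b f -> mfun a b (fun x => c * f x).
Proof. by move=> mf; apply: mfunM => //; apply: mfun_cst. Qed.

Lemma mfun_cont a b f : {within `[a, b], continuous f} -> mfun a b f.
Proof.
move=> cf; apply: (@measurable_funS _ _ _ _ `[a, b]%classic) => //.
  exact: subset_itv_oo_cc.
by apply: subspace_continuous_measurable_fun.
Qed.

Lemma itg_cont a b f : {within `[a, b], continuous f} -> itg a b f.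
Proof.
move=> cf; apply: (@integrableS _ (measurableTypeR R) R mu `[a, b]%classic) => //.
  exact: subset_itv_oo_cc.
by apply: continuous_compact_integrable => //; exact: segment_compact.
Qed.

Lemma itgD a b f g : itg a b f -> itg a b g -> itg a b (fun x => f x + g x).
Proof. by move=> If Ig; have := integrableD (measurable_oo a b) If Ig. Qed.

Lemma itgB a b f g : itg a b f -> itg a b g -> itg a b (fun x => f x - g x).
Proof. by move=> If Ig; have := integrableB (measurable_oo a b) If Ig. Qed.

Lemma itgZ a b c f : itg a b f -> itg a b (fun x => c * f x).
Proof. by move=> If; have := integrableZl (measurable_oo a b) c If. Qed.

Lemma itg_cst a b c : itg a b (fun=> c).
Proof. by apply: itg_cont; apply: continuous_subspaceT; apply: cst_continuous. Qed.

Lemma rintD a b f g : itg a b f -> itg a b g ->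
  rint a b (fun x => f x + g x) = rint a b f + rint a b g.
Proof. exact: RintegralD. Qed.

Lemma rintB a b f g : itg a b f -> itg a b g ->
  rint a b (fun x => f x - g x) = rint a b f - rint a b g.
Proof. exact: RintegralB. Qed.

Lemma rintZ a b c f : itg a b f -> rint a b (fun x => c * f x) = c * rint a b f.
Proof. exact: RintegralZl. Qed.

Lemma rint_cst a b c : a < b -> rint a b (fun=> c) = c * (b - a).
Proof.
move=> ab; rewrite /rint Rintegral_cst//; congr (_ * _).
have E := @lebesgue_measure_itv R `]a, b[; rewrite /= lte_fin ab -EFinD in E.
by transitivity (fine (b - a)%:E) => //; congr fine; exact: E.
Qed.

Lemma rint_ge0 a b f : {in `]a, b[, forall x, 0 <= f x} -> 0 <= rint a b f.
Proof. by move=> f0; apply: Rintegral_ge0 => x /f0. Qed.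

Lemma le_rint a b f g : itg a b f -> itg a b g ->
  {in `]a, b[, forall x, f x <= g x} -> rint a b f <= rint a b g.
Proof. by move=> If Ig fg; apply: le_Rintegral. Qed.

Lemma le_norm_rint a b f : itg a b f -> `|rint a b f| <= rint a b (fun x => `|f x|).
Proof. by move=> If; apply: le_normr_Rintegral. Qed.

Lemma itg_norm a b f : itg a b f -> itg a b (fun x => `|f x|).
Proof. exact: integrable_norm. Qed.

Lemma itg_dom a b f g : mfun a b f -> itg a b g ->
  {in `]a, b[, forall x, `|f x| <= g x} -> itg a b f.
Proof.
move=> mf Ig fg; apply: (le_integrable (measurable_oo a b) _ _ Ig).
  exact/measurable_EFinP.
move=> x xI; rewrite /= lee_fin; apply: (le_trans (fg x xI)).
exact: ler_norm.
Qed.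

Lemma itg_bounded a b f M : mfun a b f ->
  {in `]a, b[, forall x, `|f x| <= M} -> itg a b f.
Proof. by move=> mf fM; apply: (itg_dom mf (itg_cst a b M)). Qed.

Lemma itgM_bounded a b f h M : itg a b f -> mfun a b h ->
  {in `]a, b[, forall x, `|h x| <= M} -> itg a b (fun x => f x * h x).
Proof.
move=> If mh hM; apply: (itg_dom _ (itgZ M (itg_norm If))).
  by apply: mfunM => //; apply: itg_mfun.
by move=> x /hM hx; rewrite normrM mulrC ler_wpM2r.
Qed.

Lemma cont_bounded a b f : {within `[a, b], continuous f} ->
  exists M, {in `[a, b], forall x, `|f x| <= M}.
Proof.
move=> cf; have /compact_bounded[M [_ HM]] :=
  continuous_compact cf (@segment_compact _ a b).
exists (`|M| + 1) => x xab; apply: (HM (`|M| + 1)); last by exists x.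
by rewrite (le_lt_trans (ler_norm M))// ltrDl.
Qed.

Lemma itgM_cont a b f h : itg a b f -> {within `[a, b], continuous h} ->
  itg a b (fun x => f x * h x).
Proof.
move=> If ch; have [M HM] := cont_bounded ch.
apply: (itgM_bounded If (mfun_cont ch)) => x xI; apply: HM.
exact: subset_itv_oo_cc.
Qed.

Lemma rint_ae a b f g : mfun a b f -> mfun a b g ->
  {ae mu, forall x, x \in `]a, b[ -> f x = g x} -> rint a b f = rint a b g.
Proof.
move=> mf mg fg; rewrite /rint /Rintegral; congr fine.
apply: ae_eq_integral => //; try exact/measurable_EFinP.
apply: ae_impl fg.
by move=> x fg xI; rewrite fg.
Qed.

Lemma itg_ae a b f g : mfun a b f -> itg a b g ->
  {ae mu, forall x, x \in `]a, b[ -> f x = g x} -> itg a b f.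
Proof.
move=> mf Ig fg; have mg := itg_mfun Ig.
have [/measurable_EFinP _ foo] := integrableP _ _ _ Ig.
apply/integrableP; split; first exact/measurable_EFinP.
rewrite (@ae_eq_integral _ (measurableTypeR R) R mu `]a, b[%classic (fun x => `|(EFin \o g) x|%E))//.
- exact/measurableT_comp/measurable_EFinP.
- exact/measurableT_comp/measurable_EFinP.
- apply: ae_impl fg.
  by move=> x fg xI; rewrite /= fg.
Qed.

Lemma rint_dct a b (f_ : nat -> R -> R) f g :
  (forall n, mfun a b (f_ n)) -> mfun a b f -> itg a b g ->
  (forall n, {in `]a, b[, forall x, `|f_ n x| <= g x}) ->
  {in `]a, b[, forall x, f_ n x @[n --> \oo] --> f x} ->
  itg a b f /\ rint a b (f_ n) @[n --> \oo] --> rint a b f.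
Proof.
move=> mf_ mf Ig fg fcv.
have [||||If _ C] := @dominated_convergence _ (measurableTypeR R) R mu _ (measurable_oo a b)
  (fun n => EFin \o f_ n) (EFin \o f) (EFin \o g) _ _ _ Ig.
- by move=> n; apply/(@measurable_EFinP _ (measurableTypeR R)); exact: mf_.
- by apply/(@measurable_EFinP _ (measurableTypeR R)); exact: mf.
- apply/aeW => x xI; apply: cvg_EFin; first by near=> n.
  exact: fcv.
- by apply/aeW => x n xI; rewrite /= lee_fin; exact: fg.
split => //; rewrite /rint /Rintegral; apply: fine_cvg.
by rewrite fineK ?integrable_fin_num.
Unshelve. all: by end_near. Qed.

Lemma rint_FTC a b F f : a < b -> (forall x : R, is_derive x 1 F (f x)) ->
  continuous f -> rint a b f = F b - F a.
Proof.
move=> ab DF cf.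
have cF : continuous F.
  move=> x; apply: differentiable_continuous; apply/derivable1_diffP.
  by have [] := DF x.
rewrite /rint Rintegral_itv_bndo_bndc; last first.
  by apply: itg_cont; exact: continuous_subspaceT.
rewrite Rintegral_itv_obnd_cbnd; last first.
  apply: (@integrableS _ (measurableTypeR R) R mu `[a, b]%classic) => //.
    exact: subset_itv_oc_cc.
  apply: continuous_compact_integrable; first exact: segment_compact.
  exact: continuous_subspaceT.
rewrite /Rintegral (continuous_FTC2 ab _ (_ : derivable_oo_LRcontinuous F a b))//.
- exact: continuous_subspaceT.
- split.
  + by move=> x _; have [] := DF x.
  + by apply: cvg_at_right_filter; exact: cF.
  + by apply: cvg_at_left_filter; exact: cF.
- by move=> x _; apply: is_derive1P.
Qed.

Lemma rint_sub a b c d f : a <= c -> d <= b ->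
  itg c d f ->
  rint c d f = rint a b (fun x => if x \in `]c, d[ then f x else 0).
Proof.
move=> ac db If.
rewrite /rint (_ : `]c, d[%classic = `]a, b[%classic `&` `]c, d[%classic).
  rewrite Rintegral_mkcondr; apply: eq_Rintegral => x _.
  by rewrite patchE mem_setE.
rewrite setIidr// => x /=; rewrite !in_itv/= => /andP[cx xd].
by rewrite (le_lt_trans ac cx) (lt_le_trans xd db).
Qed.

End IntervalIntegral.
#[global] Hint Resolve measurable_oo : core.

(** * Integration by parts against weak derivatives *)

Section WeakDerivative.
Variable R : realType.
Implicit Types (a b c d : R) (p u q e f : R -> R).

Local Notation mu := (@lebesgue_measure R).

(** Complex weak derivatives split into two real ones, see [weak_derivP]. *)
Definition weak_deriv_real a b u q := forall phi, test_function a b phi ->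
  rint a b (fun x => u x * derive1 phi x) = - rint a b (fun x => q x * phi x).

Lemma smooth_within a b f : smooth f -> {within `[a, b], continuous f}.
Proof. by move=> sf; apply: continuous_subspaceT; apply: smooth_continuous. Qed.

Lemma rint_derive_step a b (e y : R) : a < b -> 0 < e -> a <= y -> y + 2 * e <= b ->
  rint a b (derive1 (step e y)) = 1.
Proof.
move=> ab e0 ay yb; rewrite (rint_FTC ab (fun x => smooth_is_derive x (smooth_step e y))).
  rewrite step_1// step_0 ?subr0//.
  by rewrite (le_trans ay)// lerDl ltW.
exact/smooth_continuous/smooth_derive1/smooth_step.
Qed.

(** The derivative of a step is a nonnegative bump of integral [1]. *)
Lemma rint_step_near a b (e y : R) f (L eta : R) : a < b -> 0 < e -> a <= y -> y + 2 * e <= b ->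
  {within `[a, b], continuous f} ->
  (forall x, y + e <= x <= y + 2 * e -> `|f x - L| <= eta) ->
  `|rint a b (fun x => f x * derive1 (step e y) x) - L| <= eta.
Proof.
move=> ab e0 ay yb cf fL.
have ss := smooth_derive1 (smooth_step e y).
have cs := @smooth_within a b _ ss.
have If := itg_cont cf.
have -> : rint a b (fun x => f x * derive1 (step e y) x) - L =
   rint a b (fun x => (f x - L) * derive1 (step e y) x).
  rewrite -[in LHS](mulr1 L) -(rint_derive_step ab e0 ay yb) -rintZ ?itg_cont//.
  rewrite -rintB; [|exact: itgM_cont|exact/itgZ/itg_cont].
  by apply: eq_rint => x _; rewrite mulrBl.
have Ifs : itg a b (fun x => (f x - L) * derive1 (step e y) x).
  by apply: itgM_cont => //; apply: itgB => //; apply: itg_cst.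
apply: (le_trans (le_norm_rint Ifs)).
rewrite -[leRHS]mulr1 -(rint_derive_step ab e0 ay yb) -rintZ ?itg_cont//.
apply: le_rint; [exact: itg_norm|exact/itgZ/itg_cont|].
move=> x _; rewrite normrM (ger0_norm (derive_step_ge0 _ _ e0)).
have [xy|xy] := boolP (y + e <= x <= y + 2 * e).
  by rewrite ler_wpM2r ?derive_step_ge0// fL.
by rewrite derive_step_0// !mulr0.
Qed.

Lemma within_continuous_near a b c f eta : {within `[a, b], continuous f} ->
  c \in `[a, b] -> 0 < eta ->
  exists2 del, 0 < del & forall x, x \in `[a, b] -> `|x - c| < del ->
    `|f x - f c| <= eta.
Proof.
move=> /subspace_continuousP /(_ c) cf cab eta0.
have /cvgrPdist_le/(_ _ eta0) := cf cab.
rewrite near_withinE => -[del /= del0 H]; exists del => // x xab xc.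
by rewrite distrC; apply: H => //=; rewrite distrC.
Qed.

Lemma cvg_rint_step a b (c : R) f (eps y : nat -> R) : a < b -> c \in `[a, b] ->
  {within `[a, b], continuous f} ->
  (forall n, 0 < eps n) -> (forall n, a <= y n) ->
  (forall n, y n + 2 * eps n <= b) ->
  eps n @[n --> \oo] --> 0 -> y n @[n --> \oo] --> c ->
  rint a b (fun x => f x * derive1 (step (eps n) (y n)) x) @[n --> \oo] --> f c.
Proof.
move=> ab cab cf eps0 ay yb ceps cy.
apply/cvgrPdist_le => eta eta0.
have [del del0 H] := within_continuous_near cf cab eta0.
have del2 : 0 < del / 3 by rewrite divr_gt0.
near=> n; rewrite distrC; apply: rint_step_near => // x /andP[yx xy].
apply: H.
  by rewrite in_itv/=; have := ay n; have := yb n; have := eps0 n; lra.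
have h1 : `|c - y n| < del / 3.
  by near: n; move/cvgrPdist_lt : cy; apply.
have h2 : `|0 - eps n| < del / 3.
  by near: n; move/cvgrPdist_lt : ceps; apply.
rewrite sub0r normrN (ger0_norm (ltW (eps0 n))) in h2.
have := eps0 n; move: h1 h2 yx xy; rewrite !ltr_norml => /andP[h1 h1'] h2 yx xy e0.
by apply/andP; split; lra.
Unshelve. all: by end_near. Qed.

(** A smooth approximation of the indicator of [c, d] from the inside: its
    support lies strictly between [c] and [d], whence the shift by [3 e]. *)
Definition plateau c d (e : R) x := step e c x - step e (d - 3 * e) x.

Section Plateau.
Variables (c d e : R).
Hypotheses (e_gt0 : 0 < e) (e_small : 4 * e <= d - c).

Lemma smooth_plateau : smooth (plateau c d e).
Proof. by apply: smoothD; [exact: smooth_step|apply: smoothN; exact: smooth_step]. Qed.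

Lemma derive_plateau x : derive1 (plateau c d e) x =
  derive1 (step e c) x - derive1 (step e (d - 3 * e)) x.
Proof.
exact: (is_derive1P (is_deriveB (smooth_is_derive x (smooth_step e c))
  (smooth_is_derive x (smooth_step e (d - 3 * e))))).
Qed.

Lemma plateau_le1 x : `|plateau c d e x| <= 1.
Proof.
have := step_ge0 e c x; have := step_le1 e c x.
have := step_ge0 e (d - 3 * e) x; have := step_le1 e (d - 3 * e) x.
by rewrite /plateau ler_norml; lra.
Qed.

Lemma plateau_supp x : plateau c d e x != 0 -> c + e <= x <= d - e.
Proof.
apply: contraNT; rewrite negb_and -!ltNge => /orP[xc|xd]; rewrite /plateau.
  have h1 : x <= c + e by lra.
  have h2 : x <= d - 3 * e + e by move: e_gt0 e_small; lra.
  by rewrite !step_0// subrr.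
have h1 : c + 2 * e <= x by move: e_gt0 e_small; lra.
have h2 : d - 3 * e + 2 * e <= x by lra.
by rewrite !step_1// subrr.
Qed.

Lemma plateau_1 x : c + 2 * e <= x <= d - 2 * e -> plateau c d e x = 1.
Proof.
by move=> /andP[xc xd]; rewrite /plateau step_1// step_0 ?subr0//; lra.
Qed.

Lemma test_plateau a b f : a <= c -> d <= b -> smooth f ->
  test_function a b (fun x => f x * plateau c d e x).
Proof.
move=> ac db sf; split.
  by apply: smooth_derive1n; apply: smoothM => //; apply: smooth_plateau.
exists (c + e), (d - e); split.
- by rewrite (le_lt_trans ac)// ltrDl.
- by rewrite (lt_le_trans _ db)// gtrDl oppr_lt0.
- by move=> x; rewrite mulf_eq0 negb_or => /andP[_]; exact: plateau_supp.
Qed.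

End Plateau.

Lemma plateau_widths c d : c < d -> exists eps : nat -> R,
  [/\ forall n, 0 < eps n, forall n, 4 * eps n <= d - c & eps n @[n --> \oo] --> 0].
Proof.
move=> cd; exists (fun n => (d - c) / 4 * harmonic n); split.
- move=> n; rewrite mulr_gt0// ?divr_gt0// ?subr_gt0//.
  by rewrite /harmonic/= invr_gt0.
- move=> n; rewrite mulrA mulrCA divff// mulr1 ler_piMr ?subr_ge0 ?(ltW cd)//.
  by rewrite /harmonic/= invf_le1// ler1n.
- by rewrite -[X in _ --> X](mulr0 ((d - c) / 4)); apply: cvgMr; exact: cvg_harmonic.
Qed.

Lemma cvg_plateau c d (eps : nat -> R) x : (forall n, 0 < eps n) ->
  (forall n, 4 * eps n <= d - c) -> eps n @[n --> \oo] --> 0 ->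
  plateau c d (eps n) x @[n --> \oo] --> (if x \in `]c, d[ then 1 else 0 : R).
Proof.
move=> eps0 eps4 ceps; case: ifPn; rewrite in_itv/= => xcd.
  have /andP[cx xd] := xcd.
  have m0 : 0 < Num.min ((x - c) / 2) ((d - x) / 2).
    by rewrite lt_min !divr_gt0 ?subr_gt0.
  apply: cvg_near_cst; near=> n; apply: plateau_1 => //.
  have : `|0 - eps n| < Num.min ((x - c) / 2) ((d - x) / 2).
    by near: n; move/cvgrPdist_lt : ceps => /(_ _ m0); apply.
  rewrite sub0r normrN (ger0_norm (ltW (eps0 n))) lt_min => /andP[h1 h2].
  by apply/andP; split; lra.
apply: cvg_near_cst; near=> n.
apply/eqP; apply: contraNT xcd => /(plateau_supp (eps0 n) (eps4 n)) /andP[h1 h2].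
by have := eps0 n => e0; apply/andP; split; lra.
Unshelve. all: by end_near. Qed.

(** Test the weak derivative with [e] times a plateau over [c, d].  The two
    bumps in the derivative of the plateau converge to the evaluations at [d]
    and [c] of the continuous representative [p]; the rest converges by
    dominated convergence.  Boundary terms are thus those of [p] even at the
    end points [a] and [b]. *)
Lemma weak_deriv_by_parts a b c d p u q e : a <= c -> c < d -> d <= b ->
  {within `[a, b], continuous p} -> mfun a b u -> itg a b q ->
  {ae mu, forall x, x \in `]a, b[ -> p x = u x} ->
  weak_deriv_real a b u q -> smooth e ->
  p d * e d - p c * e c = rint c d (fun x => p x * derive1 e x + q x * e x).
Proof.
move=> ac cd db cp mu' Iq pu wd se.
have ab : a < b by rewrite (le_lt_trans ac)// (lt_le_trans cd).
have Ip := itg_cont cp.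
have sub : {subset `]c, d[ <= `]a, b[}.
  move=> x; rewrite !in_itv/= => /andP[cx xd].
  by rewrite (le_lt_trans ac cx) (lt_le_trans xd db).
pose g x := p x * derive1 e x + q x * e x.
have Ig : itg a b g.
  by apply: itgD; apply: itgM_cont => //; apply: smooth_within => //; apply: smooth_derive1.
pose F x := p x * e x.
have cF : {within `[a, b], continuous F}.
  move=> x; apply: (@continuousM _ (subspace `[a, b]) p e x); first exact: cp.
  exact: smooth_within.
have [eps [eps0 eps4 ceps]] := plateau_widths cd.
have key n : rint a b (fun x => g x * plateau c d (eps n) x) =
    rint a b (fun x => F x * derive1 (step (eps n) (d - 3 * eps n)) x) -
    rint a b (fun x => F x * derive1 (step (eps n) c) x).
  pose th := plateau c d (eps n).
  have st : smooth th by exact: smooth_plateau.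
  have D x : derive1 (fun x => e x * th x) x = e x * derive1 th x + th x * derive1 e x.
    exact: (is_derive1P (is_deriveM (smooth_is_derive x se) (smooth_is_derive x st))).
  have se' := smooth_derive1 se; have st' := smooth_derive1 st.
  have cet : {within `[a, b], continuous (derive1 (fun x => e x * th x))}.
    by apply: smooth_within; apply: smooth_derive1; apply: smoothM.
  have := wd _ (test_plateau (eps0 n) (eps4 n) ac db se).
  rewrite (@rint_ae _ _ _ _ (fun x => p x * derive1 (fun x => e x * th x) x)); last first.
  - apply: ae_impl pu.
    by move=> x pux xI; rewrite pux.
  - by apply: itg_mfun; apply: itgM_cont.
  - by apply: mfunM => //; apply: mfun_cont.
  have I1 : itg a b (fun x => F x * derive1 th x).
    by apply: itgM_cont; [exact: itg_cont|exact: smooth_within].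
  have I2 : itg a b (fun x => p x * (th x * derive1 e x)).
    by apply: itgM_cont => //; apply: smooth_within; apply: smoothM.
  have I3 : itg a b (fun x => q x * (e x * th x)).
    by apply: itgM_cont => //; apply: smooth_within; apply: smoothM.
  have I4 : itg a b (fun x => F x * derive1 (step (eps n) c) x).
    apply: itgM_cont; [exact: itg_cont|apply: smooth_within].
    exact/smooth_derive1/smooth_step.
  have I5 : itg a b (fun x => F x * derive1 (step (eps n) (d - 3 * eps n)) x).
    apply: itgM_cont; [exact: itg_cont|apply: smooth_within].
    exact/smooth_derive1/smooth_step.
  have -> : rint a b (fun x => p x * derive1 (fun x => e x * th x) x) =
     rint a b (fun x => F x * derive1 th x) + rint a b (fun x => p x * (th x * derive1 e x)).
    by rewrite -rintD//; apply: eq_rint => x _; rewrite D mulrDr mulrA.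
  have -> : rint a b (fun x => F x * derive1 th x) =
      rint a b (fun x => F x * derive1 (step (eps n) c) x) -
      rint a b (fun x => F x * derive1 (step (eps n) (d - 3 * eps n)) x).
    by rewrite -rintB//; apply: eq_rint => x _; rewrite derive_plateau// mulrBr.
  have -> : rint a b (fun x => g x * plateau c d (eps n) x) =
      rint a b (fun x => p x * (th x * derive1 e x)) +
      rint a b (fun x => q x * (e x * th x)).
    by rewrite -rintD//; apply: eq_rint => x _; rewrite /g -/th; ring.
  have lin (A B P Q : R) : A - B + P = - Q -> P + Q = B - A by lra.
  exact: lin.
have cd1 : c \in `[a, b] by rewrite in_itv/= ac (le_trans (ltW cd)).
have cd2 : d \in `[a, b] by rewrite in_itv/= db (le_trans ac (ltW cd)).
have L1 : rint a b (fun x => F x * derive1 (step (eps n) c) x) @[n --> \oo] --> F c.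
  apply: (@cvg_rint_step a b c F eps (fun=> c)) => //; last exact: cvg_cst.
  by move=> n; have := eps4 n; have := eps0 n; lra.
have L2 : rint a b (fun x => F x * derive1 (step (eps n) (d - 3 * eps n)) x)
    @[n --> \oo] --> F d.
  apply: (@cvg_rint_step a b d F eps (fun n => d - 3 * eps n)) => //.
  - by move=> n; have := eps4 n; have := eps0 n; lra.
  - by move=> n; have := eps0 n; lra.
  - rewrite -[X in _ --> X]subr0; apply: cvgB; first exact: cvg_cst.
    by rewrite -[X in _ --> X](mulr0 3); apply: cvgMr.
have [_ L3] : itg a b (fun x => if x \in `]c, d[ then g x else 0) /\
    rint a b (fun x => g x * plateau c d (eps n) x) @[n --> \oo] -->
    rint a b (fun x => if x \in `]c, d[ then g x else 0).
  apply: (@rint_dct _ _ _ _ _ (fun x => `|g x|)).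
  - move=> n; apply: itg_mfun; apply: itgM_cont => //.
    by apply: smooth_within; apply: smooth_plateau.
  - rewrite (_ : (fun x => _) = (fun x => g x * \1_(`]c, d[%classic) x)).
      apply: mfunM; first exact: itg_mfun.
      by apply: measurable_indic.
    by apply/funext => x; rewrite indicE mem_setE; case: ifP; rewrite ?mulr1 ?mulr0.
  - exact: itg_norm.
  - by move=> n x _; rewrite normrM ler_piMr// plateau_le1.
  - move=> x _; rewrite (_ : (if _ then _ else _) = g x * (if x \in `]c, d[ then 1 else 0)).
      by apply: cvgMr; by apply: cvg_plateau.
    by case: ifP; rewrite ?mulr1 ?mulr0.
have Igcd : itg c d g by apply: integrableS Ig.
rewrite (rint_sub ac db Igcd); apply/esym; apply: cvg_unique L3 _ => //.
rewrite (_ : (fun n => _) = (fun n =>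
    rint a b (fun x => F x * derive1 (step (eps n) (d - 3 * eps n)) x) -
    rint a b (fun x => F x * derive1 (step (eps n) c) x))); last exact/funext.
exact: cvgB.
Qed.

End WeakDerivative.

(** * Moduli and the real inner product of square-integrable functions *)

Section ModulusSquared.
Variable R : realType.
Implicit Types z w : R[i].
Import Normc.

Lemma normc_sqr z : normc z ^+ 2 = complex.Re z ^+ 2 + complex.Im z ^+ 2.
Proof. by case: z => x y /=; rewrite sqr_sqrtr// addr_ge0// sqr_ge0. Qed.

Lemma normc_ge0 z : 0 <= normc z.
Proof. by case: z => x y /=; rewrite sqrtr_ge0. Qed.

Lemma ReD z w : complex.Re (z + w) = complex.Re z + complex.Re w.
Proof. by case: z; case: w. Qed.
Lemma ImD z w : complex.Im (z + w) = complex.Im z + complex.Im w.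
Proof. by case: z; case: w. Qed.
Lemma ReN z : complex.Re (- z) = - complex.Re z. Proof. by case: z. Qed.
Lemma ImN z : complex.Im (- z) = - complex.Im z. Proof. by case: z. Qed.
Lemma ReB z w : complex.Re (z - w) = complex.Re z - complex.Re w.
Proof. by rewrite ReD ReN. Qed.
Lemma ImB z w : complex.Im (z - w) = complex.Im z - complex.Im w.
Proof. by rewrite ImD ImN. Qed.
Lemma ReM z w : complex.Re (z * w) =
  complex.Re z * complex.Re w - complex.Im z * complex.Im w.
Proof. by case: z; case: w. Qed.
Lemma ImM z w : complex.Im (z * w) =
  complex.Re z * complex.Im w + complex.Im z * complex.Re w.
Proof. by case: z => ? ?; case: w. Qed.
Lemma ReC (x : R) : complex.Re x%:C = x. Proof. by []. Qed.
Lemma ImC (x : R) : complex.Im x%:C = (0 : R). Proof. by []. Qed.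
Lemma Rei : complex.Re ('i%C : R[i]) = (0 : R). Proof. by []. Qed.
Lemma Imi : complex.Im ('i%C : R[i]) = (1 : R). Proof. by []. Qed.

Lemma ReJ z : complex.Re (z^*%C) = complex.Re z. Proof. by case: z. Qed.
Lemma ImJ z : complex.Im (z^*%C) = - complex.Im z. Proof. by case: z. Qed.

(** To be used as a multirule that decomposes real and imaginary parts. *)
Definition ReImE := (ReB, ImB, ReD, ImD, ReN, ImN, Rei, Imi, ReJ, ImJ, ReM, ImM, ReC, ImC).

Lemma complex_eqP z w :
  complex.Re z = complex.Re w -> complex.Im z = complex.Im w -> z = w.
Proof. by case: z; case: w => ? ? ? ? /= -> ->. Qed.

Lemma normcE z : normc z = Num.sqrt (complex.Re z ^+ 2 + complex.Im z ^+ 2).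
Proof. by case: z. Qed.

Lemma le_Re_normc z : `|complex.Re z| <= normc z.
Proof. by rewrite normcE -sqrtr_sqr ler_wsqrtr// lerDl sqr_ge0. Qed.

Lemma le_Im_normc z : `|complex.Im z| <= normc z.
Proof. by rewrite normcE -sqrtr_sqr ler_wsqrtr// lerDr sqr_ge0. Qed.

Lemma normc_le_ReIm z : normc z <= `|complex.Re z| + `|complex.Im z|.
Proof.
rewrite -ler_sqr ?nnegrE ?normc_ge0 ?addr_ge0// normc_sqr.
rewrite -(real_normK (num_real (complex.Re z))) -(real_normK (num_real (complex.Im z))).
have := mulr_ge0 (normr_ge0 (complex.Re z)) (normr_ge0 (complex.Im z)).
by rewrite sqrrD mulr2n; lra.
Qed.

Lemma normc_real (x : R) : normc x%:C = `|x|.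
Proof. by rewrite normcE /= expr0n/= addr0 sqrtr_sqr. Qed.

Lemma normc_i : normc ('i%C : R[i]) = 1.
Proof. by rewrite normcE /= expr0n/= add0r expr1n sqrtr1. Qed.

Lemma normcB z w : normc (z - w) = normc (w - z).
Proof. by rewrite -normcN opprB. Qed.

Lemma le_normc_sum (I : Type) (s : seq I) (F : I -> R[i]) :
  normc (\sum_(i <- s) F i) <= \sum_(i <- s) normc (F i).
Proof.
elim/big_rec2: _ => [|i x y _ le]; first by rewrite normc0.
by apply: (le_trans (le_normcD _ _)); rewrite lerD2l.
Qed.

Lemma le_normcB z w : normc (z - w) <= normc z + normc w.
Proof. by rewrite -(normcN w) le_normcD. Qed.

Lemma le_normcBD z w : normc z <= normc (z - w) + normc w.
Proof. by have := le_normcD (z - w) w; rewrite subrK. Qed.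

End ModulusSquared.

(** The discriminant argument behind both Cauchy-Schwarz inequalities below. *)
Lemma sqr_le_mul_of_quadratic_ge0 (R : realType) (A B C : R) : 0 <= A -> 0 <= C ->
  (forall t, 0 <= A - 2 * t * B + t ^+ 2 * C) -> B ^+ 2 <= A * C.
Proof.
move=> A0 C0 H; have [C00|C00] := eqVneq C 0.
  rewrite C00 mulr0; have [->|B0] := eqVneq B 0; first by rewrite expr0n.
  have := H ((A + 1) / (2 * B)); rewrite C00 mulr0 addr0.
  have -> : 2 * ((A + 1) / (2 * B)) * B = A + 1 by field.
  by lra.
have Cp : 0 < C by rewrite lt_def C00.
have := H (B / C).
have -> : A - 2 * (B / C) * B + (B / C) ^+ 2 * C = A - B ^+ 2 / C by field.
by rewrite subr_ge0 ler_pdivrMr.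
Qed.

Section SquareIntegrable.
Variables (R : realType) (a b : R).
Hypothesis hab : a < b.
Implicit Types (u v w h : R -> R[i]) (f g : R -> R).
Import Normc.

Local Notation mu := (@lebesgue_measure R).

(** The real part of the Hermitian product; real bilinearity suffices, since
    imaginary parts are products with [i] times the second function. *)
Definition ip u v := rint a b (fun x =>
  complex.Re (u x) * complex.Re (v x) + complex.Im (u x) * complex.Im (v x)).

Definition nrm u := Num.sqrt (ip u u).

Lemma itg_prod f g : mfun a b f -> mfun a b g ->
  itg a b (fun x => f x ^+ 2) -> itg a b (fun x => g x ^+ 2) ->
  itg a b (fun x => f x * g x).
Proof.
move=> mf mg If Ig; apply: (itg_dom (mfunM mf mg) (itgD If Ig)) => x _.
have := sqr_ge0 (f x - g x); have := sqr_ge0 (f x + g x).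
by rewrite ler_norml !expr2; nra.
Qed.

Lemma L2P u : L2 a b u <-> [/\ mfun a b (fun x => complex.Re (u x)),
  mfun a b (fun x => complex.Im (u x)) &
  itg a b (fun x => complex.Re (u x) ^+ 2 + complex.Im (u x) ^+ 2)].
Proof.
have E : (\int[mu]_(x in `]a, b[) (normc (u x) ^+ 2)%:E =
    \int[mu]_(x in `]a, b[) `|(EFin \o (fun x => (complex.Re (u x) ^+ 2 + complex.Im (u x) ^+ 2)%R)) x|)%E.
  apply: eq_integral => x _; by rewrite normc_sqr /= ger0_norm// addr_ge0// sqr_ge0.
rewrite /L2 /L2norm E; split=> -[mr mi].
  move=> H; split => //; apply/integrableP; split.
    by apply/measurable_EFinP; apply: mfunD; apply: mfunX.
  by apply: lty_poweRy H; rewrite invr_neq0.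
move=> /integrableP[_ oo]; split => //.
by rewrite poweR_lty.
Qed.

Lemma L2_mRe u : L2 a b u -> mfun a b (fun x => complex.Re (u x)).
Proof. by case/L2P. Qed.

Lemma L2_mIm u : L2 a b u -> mfun a b (fun x => complex.Im (u x)).
Proof. by case/L2P. Qed.

Lemma L2_itg2 u : L2 a b u ->
  itg a b (fun x => complex.Re (u x) ^+ 2) /\ itg a b (fun x => complex.Im (u x) ^+ 2).
Proof.
case/L2P => mr mi I; split; apply: (itg_dom _ I); try exact: mfunX.
- by move=> x _; rewrite ger0_norm ?sqr_ge0// lerDl sqr_ge0.
- by move=> x _; rewrite ger0_norm ?sqr_ge0// lerDr sqr_ge0.
Qed.

Lemma L2_intro u : mfun a b (fun x => complex.Re (u x)) ->
  mfun a b (fun x => complex.Im (u x)) ->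
  itg a b (fun x => complex.Re (u x) ^+ 2) ->
  itg a b (fun x => complex.Im (u x) ^+ 2) -> L2 a b u.
Proof. by move=> mr mi ir ii; apply/L2P; split => //; apply: itgD. Qed.

Lemma L2_itgRR u v : L2 a b u -> L2 a b v ->
  itg a b (fun x => complex.Re (u x) * complex.Re (v x)).
Proof.
move=> Lu Lv; apply: itg_prod; do ?[exact: L2_mRe|exact: L2_mIm];
  do ?[exact: (L2_itg2 Lu).1|exact: (L2_itg2 Lv).1].
Qed.

Lemma L2_itgII u v : L2 a b u -> L2 a b v ->
  itg a b (fun x => complex.Im (u x) * complex.Im (v x)).
Proof.
move=> Lu Lv; apply: itg_prod; do ?[exact: L2_mRe|exact: L2_mIm];
  do ?[exact: (L2_itg2 Lu).2|exact: (L2_itg2 Lv).2].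
Qed.

Lemma L2_itg_ip u v : L2 a b u -> L2 a b v ->
  itg a b (fun x => complex.Re (u x) * complex.Re (v x) +
    complex.Im (u x) * complex.Im (v x)).
Proof. by move=> Lu Lv; apply: itgD; [exact: L2_itgRR|exact: L2_itgII]. Qed.

Lemma L2_bounded u M : mfun a b (fun x => complex.Re (u x)) ->
  mfun a b (fun x => complex.Im (u x)) ->
  {in `]a, b[, forall x, normc (u x) <= M} -> L2 a b u.
Proof.
move=> mr mi uM; apply: L2_intro => //; apply: (@itg_bounded _ _ _ _ (M ^+ 2));
  try exact: mfunX; move=> x /uM xM; rewrite normrX.
- by apply: lerXn2r; rewrite ?nnegrE// ?(le_trans (normc_ge0 _) xM)// (le_trans (le_Re_normc _) xM).
- by apply: lerXn2r; rewrite ?nnegrE// ?(le_trans (normc_ge0 _) xM)// (le_trans (le_Im_normc _) xM).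
Qed.

Lemma L2_cst (c : R[i]) : L2 a b (fun=> c).
Proof. by apply: (@L2_bounded _ (normc c)) => //; exact: mfun_cst. Qed.

Lemma L2D u v : L2 a b u -> L2 a b v -> L2 a b (fun x => u x + v x).
Proof.
move=> Lu Lv.
have mr : mfun a b (fun x => complex.Re (u x + v x)).
  by under eq_fun do rewrite ReD; apply: mfunD; exact: L2_mRe.
have mi : mfun a b (fun x => complex.Im (u x + v x)).
  by under eq_fun do rewrite ImD; apply: mfunD; exact: L2_mIm.
have [r1 i1] := L2_itg2 Lu; have [r2 i2] := L2_itg2 Lv.
apply: L2_intro => //.
- apply: (itg_dom _ (itgZ 2 (itgD r1 r2))); first exact: mfunX.
  move=> x _; rewrite ReD ger0_norm ?sqr_ge0//.
  by have := sqr_ge0 (complex.Re (u x) - complex.Re (v x)); rewrite !expr2; lra.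
- apply: (itg_dom _ (itgZ 2 (itgD i1 i2))); first exact: mfunX.
  move=> x _; rewrite ImD ger0_norm ?sqr_ge0//.
  by have := sqr_ge0 (complex.Im (u x) - complex.Im (v x)); rewrite !expr2; lra.
Qed.

Lemma L2M_bounded u h M : L2 a b u -> mfun a b (fun x => complex.Re (h x)) ->
  mfun a b (fun x => complex.Im (h x)) ->
  {in `]a, b[, forall x, normc (h x) <= M} -> L2 a b (fun x => u x * h x).
Proof.
move=> Lu mhr mhi hM.
have [mr mi I] := (L2P u).1 Lu.
have mr' : mfun a b (fun x => complex.Re (u x * h x)).
  by under eq_fun do rewrite ReM; apply: mfunB; apply: mfunM.
have mi' : mfun a b (fun x => complex.Im (u x * h x)).
  by under eq_fun do rewrite ImM; apply: mfunD; apply: mfunM.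
apply/L2P; split.
- exact: mr'.
- exact: mi'.
apply: (itg_dom _ (itgZ (M ^+ 2) I)).
  by apply: mfunD; apply: mfunX.
move=> x /hM xM; rewrite ger0_norm ?addr_ge0 ?sqr_ge0//.
rewrite -normc_sqr normcM exprMn mulrC -normc_sqr ler_wpM2r ?sqr_ge0//.
by apply: lerXn2r; rewrite ?nnegrE ?normc_ge0// (le_trans (normc_ge0 _) xM).
Qed.

(** Dividing by a function that may vanish: the quotient is bounded by the
    hypothesis where [v] is nonzero, and it is set to [0] elsewhere. *)
Lemma L2_quotient u v C : 0 <= C ->
  mfun a b (fun x => complex.Re (u x)) -> mfun a b (fun x => complex.Im (u x)) ->
  mfun a b (fun x => complex.Re (v x)) -> mfun a b (fun x => complex.Im (v x)) ->
  {in `]a, b[, forall x, normc (u x) <= C * normc (v x)} ->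
  exists2 q, L2 a b q & {in `]a, b[, forall x, q x * v x = u x}.
Proof.
move=> C0 mur mui mvr mvi uv.
pose n2 x := complex.Re (v x) ^+ 2 + complex.Im (v x) ^+ 2.
have mn : mfun a b (fun x => n2 x `^ (-1)).
  apply: (measurableT_comp (@measurable_powR R (-1))).
  by apply: mfunD; apply: mfunX.
have n2E x : n2 x = normc (v x) ^+ 2 by rewrite normc_sqr.
have n2V x : n2 x `^ (-1) = (n2 x)^-1.
  by rewrite powR_inv1// n2E sqr_ge0.
pose q x := u x * (v x)^*%C * ((n2 x) `^ (-1))%:C.
have qv x : x \in `]a, b[ -> q x * v x = u x.
  move=> xI; have [n0|n0] := eqVneq (n2 x) 0.
    have v0 : normc (v x) = 0 by apply/eqP; rewrite -sqrf_eq0 -n2E n0.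
    have u0 : normc (u x) = 0.
      by apply/eqP; rewrite eq_le normc_ge0 andbT; have := uv x xI; rewrite v0 mulr0.
    by rewrite (eq0_normc v0) (eq0_normc u0) mulr0.
  rewrite /q n2V -!mulrA (_ : _ * (_ * v x) = 1) ?mulr1//.
  by apply: complex_eqP; rewrite !ReImE /=; move: n0; rewrite /n2 => n0; field.
exists q => //.
have mq : mfun a b (fun x => complex.Re (q x)) /\ mfun a b (fun x => complex.Im (q x)).
  split.
    rewrite (_ : (fun x => _) = fun x => (complex.Re (u x) * complex.Re (v x) +
      complex.Im (u x) * complex.Im (v x)) * n2 x `^ (-1)).
      by apply: mfunM => //; apply: mfunD; apply: mfunM.
    by apply/funext => x; rewrite !ReImE; ring.
  rewrite (_ : (fun x => _) = fun x => (complex.Im (u x) * complex.Re (v x) -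
    complex.Re (u x) * complex.Im (v x)) * n2 x `^ (-1)).
    by apply: mfunM => //; apply: mfunB; apply: mfunM.
  by apply/funext => x; rewrite !ReImE; ring.
case: mq => mqr mqi.
apply: (@L2_bounded _ C) => // x xI.
have [n0|n0] := eqVneq (n2 x) 0.
  have v0 : normc (v x) = 0 by apply/eqP; rewrite -sqrf_eq0 -n2E n0.
  by rewrite /q (eq0_normc v0) conjc0 mulr0 mul0r normc0.
have v0 : 0 < normc (v x).
  by rewrite lt_def normc_ge0 andbT; apply: contraNneq n0; rewrite n2E => ->; rewrite expr0n.
by rewrite -(ler_pM2r v0) -normcM qv// uv.
Qed.

Lemma L2Z c u : L2 a b u -> L2 a b (fun x => c * u x).
Proof.
move=> Lu; rewrite (_ : (fun x => _) = (fun x => u x * c)); last first.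
  by apply/funext => x; rewrite mulrC.
by apply: (@L2M_bounded _ (fun=> c) (normc c)) => //; exact: mfun_cst.
Qed.

Lemma L2N u : L2 a b u -> L2 a b (fun x => - u x).
Proof.
move=> Lu; rewrite (_ : (fun x => _) = (fun x => -1 * u x)); first exact: L2Z.
by apply/funext => x; rewrite mulN1r.
Qed.

Lemma L2B u v : L2 a b u -> L2 a b v -> L2 a b (fun x => u x - v x).
Proof. by move=> Lu Lv; apply: L2D => //; apply: L2N. Qed.

Lemma L2_sum (I : Type) (s : seq I) (F : I -> R -> R[i]) :
  (forall i, L2 a b (F i)) -> L2 a b (fun x => \sum_(i <- s) F i x).
Proof.
move=> LF; elim: s => [|i s IH].
  by under eq_fun do rewrite big_nil; exact: L2_cst.
by under eq_fun do rewrite big_cons; exact: L2D.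
Qed.

Lemma ipC u v : ip u v = ip v u.
Proof. by apply: eq_rint => x _; rewrite mulrC [X in _ + X]mulrC. Qed.

Lemma ipDl u v w : L2 a b u -> L2 a b v -> L2 a b w ->
  ip (fun x => u x + v x) w = ip u w + ip v w.
Proof.
move=> Lu Lv Lw; rewrite /ip -rintD; [|exact: L2_itg_ip..].
by apply: eq_rint => x _; rewrite !ReImE; ring.
Qed.

Lemma ipZl (c : R) u w : L2 a b u -> L2 a b w ->
  ip (fun x => c%:C * u x) w = c * ip u w.
Proof.
move=> Lu Lw; rewrite /ip -rintZ; last exact: L2_itg_ip.
by apply: eq_rint => x _; rewrite !ReImE; ring.
Qed.

Lemma ipNl u w : L2 a b u -> L2 a b w -> ip (fun x => - u x) w = - ip u w.
Proof.
move=> Lu Lw; rewrite -[RHS]mulN1r -ipZl//; apply: eq_rint => x _.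
by rewrite !ReImE; ring.
Qed.

Lemma ipBl u v w : L2 a b u -> L2 a b v -> L2 a b w ->
  ip (fun x => u x - v x) w = ip u w - ip v w.
Proof. by move=> Lu Lv Lw; rewrite ipDl ?ipNl//; exact: L2N. Qed.

Lemma ipDr u v w : L2 a b u -> L2 a b v -> L2 a b w ->
  ip w (fun x => u x + v x) = ip w u + ip w v.
Proof. by move=> Lu Lv Lw; rewrite ipC ipDl// !(ipC w). Qed.

Lemma ipBr u v w : L2 a b u -> L2 a b v -> L2 a b w ->
  ip w (fun x => u x - v x) = ip w u - ip w v.
Proof. by move=> Lu Lv Lw; rewrite ipC ipBl// !(ipC w). Qed.

Lemma ipZr (c : R) u w : L2 a b u -> L2 a b w ->
  ip w (fun x => c%:C * u x) = c * ip w u.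
Proof. by move=> Lu Lw; rewrite ipC ipZl// ipC. Qed.

Lemma ip_sumr (I : Type) (s : seq I) (F : I -> R -> R[i]) u :
  (forall i, L2 a b (F i)) -> L2 a b u ->
  ip u (fun x => \sum_(i <- s) F i x) = \sum_(i <- s) ip u (F i).
Proof.
move=> LF Lu; elim: s => [|i s IH].
  rewrite big_nil /ip (eq_rint (g := fun=> 0)) ?rint_cst ?mul0r// => x _.
  by rewrite big_nil/= !mulr0 addr0.
rewrite big_cons -IH -ipDr//; last exact: L2_sum.
by congr ip; apply/funext => x; rewrite big_cons.
Qed.

Lemma ip_ge0 u : 0 <= ip u u.
Proof. by apply: rint_ge0 => x _; rewrite -!expr2 addr_ge0 ?sqr_ge0. Qed.

Lemma nrm_ge0 u : 0 <= nrm u. Proof. exact: sqrtr_ge0. Qed.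

Lemma nrm_sqr u : nrm u ^+ 2 = ip u u. Proof. by rewrite sqr_sqrtr// ip_ge0. Qed.

Lemma ip_cauchy_schwarz u v : L2 a b u -> L2 a b v -> `|ip u v| <= nrm u * nrm v.
Proof.
move=> Lu Lv.
rewrite -ler_sqr ?nnegrE ?mulr_ge0 ?nrm_ge0// exprMn !nrm_sqr real_normK ?num_real//.
apply: sqr_le_mul_of_quadratic_ge0; [exact: ip_ge0|exact: ip_ge0|move=> t].
have := ip_ge0 (fun x => u x - t%:C * v x).
have Lt : L2 a b (fun x => t%:C * v x) by exact: L2Z.
have Lut := L2B Lu Lt.
rewrite ipBl// !ipBr// !ipZr// !ipZl// (ipC v u).
by move: (ip u u) (ip u v) (ip v v) => A B C; rewrite expr2; lra.
Qed.

Lemma nrmD u v : L2 a b u -> L2 a b v -> nrm (fun x => u x + v x) <= nrm u + nrm v.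
Proof.
move=> Lu Lv; rewrite -ler_sqr ?nnegrE ?addr_ge0 ?nrm_ge0// nrm_sqr.
have Luv := L2D Lu Lv.
rewrite ipDl// !ipDr// (ipC v u) sqrrD !nrm_sqr.
have := ip_cauchy_schwarz Lu Lv; rewrite ler_norml => /andP[_].
by rewrite mulr2n; lra.
Qed.

Lemma nrmBC u v : nrm (fun x => u x - v x) = nrm (fun x => v x - u x).
Proof. by congr Num.sqrt; apply: eq_rint => x _; rewrite !ReImE; ring. Qed.

Lemma nrm_triangle u v w : L2 a b u -> L2 a b v -> L2 a b w ->
  nrm (fun x => u x - w x) <= nrm (fun x => u x - v x) + nrm (fun x => v x - w x).
Proof.
move=> Lu Lv Lw; apply: le_trans (nrmD (L2B Lu Lv) (L2B Lv Lw)).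
by apply: eq_ler; congr nrm; apply/funext => x; ring.
Qed.

Lemma nrmZ (c : R[i]) u : L2 a b u -> nrm (fun x => c * u x) = normc c * nrm u.
Proof.
move=> Lu; rewrite -[normc c]ger0_norm ?normc_ge0// -sqrtr_sqr -sqrtrM ?sqr_ge0//.
congr Num.sqrt; rewrite /ip -rintZ; last exact: L2_itg_ip.
by apply: eq_rint => x _; rewrite normc_sqr !ReImE; ring.
Qed.

Lemma L2normE u : L2 a b u -> L2norm a b u = (nrm u)%:E.
Proof.
move=> Lu; have [_ _ I] := (L2P u).1 Lu.
have E : (\int[mu]_(x in `]a, b[) (normc (u x) ^+ 2)%:E)%E = (ip u u)%:E.
  rewrite /ip /rint /Rintegral fineK.
    by apply: eq_integral => x _; rewrite normc_sqr !expr2.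
  by apply: integrable_fin_num => //; exact: L2_itg_ip.
by rewrite /L2norm E poweR_EFin powR12_sqrt// ip_ge0.
Qed.

(** Truncating one integrand at the other reduces the almost-everywhere bound
    to a pointwise one. *)
Lemma le_nrm_ae u v K : 0 <= K -> L2 a b u -> L2 a b v ->
  {ae mu, forall x, x \in `]a, b[ -> normc (u x) <= K * normc (v x)} ->
  nrm u <= K * nrm v.
Proof.
move=> K0 Lu Lv uv.
rewrite -ler_sqr ?nnegrE ?mulr_ge0 ?nrm_ge0// exprMn !nrm_sqr.
pose sq (w : R -> R[i]) x := complex.Re (w x) * complex.Re (w x) +
  complex.Im (w x) * complex.Im (w x).
have sqE w x : sq w x = normc (w x) ^+ 2 by rewrite normc_sqr !expr2.
have Iu : itg a b (sq u) := L2_itg_ip Lu Lu.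
have Iv : itg a b (sq v) := L2_itg_ip Lv Lv.
(* [f] coincides with [sq u] almost everywhere and is below the bound everywhere. *)
pose f x := Num.min (sq u x) (K ^+ 2 * sq v x).
have mf : mfun a b f.
  by apply: measurable_minr; [exact: itg_mfun|apply: mfunZ; exact: itg_mfun].
have If : itg a b f.
  apply: (itg_dom mf Iu) => x _; rewrite ger0_norm ?ge_min ?lexx//.
  by rewrite /f !sqE le_min sqr_ge0 mulr_ge0 ?sqr_ge0.
rewrite /ip -[rint _ _ _]/(rint a b (sq u)) (rint_ae (g := f)).
- rewrite -rintZ//; apply: le_rint => //; first exact: itgZ.
  by move=> x _; rewrite /f ge_min lexx orbT.
- exact: itg_mfun.
- exact: mf.
apply: ae_impl uv.
move=> x xuv /xuv xle; rewrite /f min_l// !sqE -exprMn.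
by apply: lerXn2r; rewrite ?nnegrE ?mulr_ge0 ?normc_ge0.
Qed.

Lemma nrm_le_sup u M : L2 a b u -> {in `]a, b[, forall x, normc (u x) <= M} ->
  nrm u <= M * Num.sqrt (b - a).
Proof.
move=> Lu uM; have M0 : 0 <= M.
  have h : (a + b) / 2 \in `]a, b[ by rewrite in_itv/=; apply/andP; split; have := hab; lra.
  exact: le_trans (normc_ge0 _) (uM _ h).
have -> : Num.sqrt (b - a) = nrm (fun=> 1).
  congr Num.sqrt; rewrite /ip (eq_rint (g := fun=> 1)) ?rint_cst ?mul1r// => x _.
  have -> : complex.Re (1 : R[i]) = 1 by [].
  by have -> : complex.Im (1 : R[i]) = 0 by []; rewrite mulr0 addr0.
apply: le_nrm_ae => //; first exact: L2_cst.
by apply/aeW => x /uM; rewrite normc1 mulr1.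
Qed.

Lemma ip_ae u v w : L2 a b u -> L2 a b v -> L2 a b w -> ae_eq_on a b u v ->
  ip u w = ip v w.
Proof.
move=> Lu Lv Lw uv; apply: rint_ae.
- exact: itg_mfun (L2_itg_ip Lu Lw).
- exact: itg_mfun (L2_itg_ip Lv Lw).
- apply: ae_impl uv.
  by move=> x uvx xI; rewrite uvx.
Qed.

Lemma nrm_ae u v : L2 a b u -> L2 a b v -> ae_eq_on a b u v -> nrm u = nrm v.
Proof.
by move=> Lu Lv uv; rewrite /nrm (ip_ae Lu Lv Lu uv) ipC (ip_ae Lu Lv Lv uv).
Qed.

End SquareIntegrable.

(** * Finite families of coefficients and Fourier coefficients *)

Section FiniteSums.
Variables (R : realType) (I : eqType).
Implicit Types (s : seq I) (z w : I -> R[i]).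
Import Normc.

Definition l2 s z := Num.sqrt (\sum_(l <- s) normc (z l) ^+ 2).

Lemma l2_ge0 s z : 0 <= l2 s z. Proof. exact: sqrtr_ge0. Qed.

Lemma l2_sqr s z : l2 s z ^+ 2 = \sum_(l <- s) normc (z l) ^+ 2.
Proof. by rewrite sqr_sqrtr// sumr_ge0// => l _; rewrite sqr_ge0. Qed.

Lemma sum_cauchy_schwarz s (f g : I -> R) :
  (\sum_(l <- s) f l * g l) ^+ 2 <=
  (\sum_(l <- s) f l ^+ 2) * (\sum_(l <- s) g l ^+ 2).
Proof.
apply: sqr_le_mul_of_quadratic_ge0.
- by apply: sumr_ge0 => l _; rewrite sqr_ge0.
- by apply: sumr_ge0 => l _; rewrite sqr_ge0.
move=> t; rewrite (_ : _ + _ = \sum_(l <- s) (f l - t * g l) ^+ 2).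
  by apply: sumr_ge0 => l _; rewrite sqr_ge0.
rewrite !mulr_sumr -sumrB -big_split/=; apply: eq_bigr => l _; ring.
Qed.

Lemma le_l2 s z w : (forall l, l \in s -> normc (z l) <= normc (w l)) ->
  l2 s z <= l2 s w.
Proof.
move=> zw; apply: ler_wsqrtr; rewrite big_seq [leRHS]big_seq.
by apply: ler_sum => l /zw zl; apply: lerXn2r; rewrite ?nnegrE ?normc_ge0.
Qed.

Lemma eq_l2 s z w : {in s, z =1 w} -> l2 s z = l2 s w.
Proof. by move=> zw; congr Num.sqrt; apply: eq_big_seq => l /zw ->. Qed.

Lemma sum_normcM_le s z w : \sum_(l <- s) normc (z l) * normc (w l) <= l2 s z * l2 s w.
Proof.
rewrite -ler_sqr ?nnegrE ?mulr_ge0 ?l2_ge0//; last first.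
  by apply: sumr_ge0 => l _; rewrite mulr_ge0 ?normc_ge0.
by rewrite exprMn !l2_sqr; exact: sum_cauchy_schwarz.
Qed.

Lemma l2D s z w : l2 s (fun l => z l + w l) <= l2 s z + l2 s w.
Proof.
rewrite -ler_sqr ?nnegrE ?addr_ge0 ?l2_ge0// l2_sqr sqrrD !l2_sqr.
have zw := sum_normcM_le s z w.
apply: (@le_trans _ _ (\sum_(l <- s) (normc (z l) + normc (w l)) ^+ 2)).
  apply: ler_sum => l _; apply: lerXn2r; rewrite ?nnegrE ?addr_ge0 ?normc_ge0//.
  exact: le_normcD.
rewrite (eq_bigr (fun l => normc (z l) ^+ 2 + 2 * (normc (z l) * normc (w l)) +
  normc (w l) ^+ 2)); last by move=> l _; rewrite sqrrD mulr_natl.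
by rewrite !big_split/= -mulr_sumr -mulr_natl; lra.
Qed.

Lemma l2N s z : l2 s (fun l => - z l) = l2 s z.
Proof. by congr Num.sqrt; apply: eq_bigr => l _; rewrite normcN. Qed.

Lemma l2B s z w : l2 s (fun l => z l - w l) <= l2 s z + l2 s w.
Proof. by rewrite -(l2N s w); exact: l2D. Qed.

Lemma l2Z s (c : R[i]) z : l2 s (fun l => c * z l) = normc c * l2 s z.
Proof.
rewrite -[normc c]ger0_norm ?normc_ge0// -sqrtr_sqr -sqrtrM ?sqr_ge0// mulr_sumr.
by congr Num.sqrt; apply: eq_bigr => l _; rewrite normcM exprMn.
Qed.

Lemma l2_triangle s z w v :
  l2 s (fun l => z l - w l) <= l2 s (fun l => z l - v l) + l2 s (fun l => v l - w l).
Proof.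
apply: le_trans (l2D _ _ _); apply: eq_ler.
by apply: eq_l2 => l _; ring.
Qed.

End FiniteSums.

Section FourierCoefficients.
Variables (R : realType) (a b : R).
Hypothesis hab : a < b.
Implicit Types (u v : R -> R[i]) (l m : int) (s : seq int) (z w : int -> R[i]).
Import Normc.

Local Notation mu := (mu_ a b).
Local Notation e_ := (fourier_basis a b).
Local Notation coef := (fourier_coef a b).

Let ba_gt0 : 0 < b - a. Proof. by rewrite subr_gt0. Qed.
Let ba_neq0 : b - a != 0. Proof. by rewrite gt_eqF. Qed.
Lemma cexp_i (t : R) : cexp ('i%C * t%:C) = cos t +i* sin t.
Proof.
have r : complex.Re ('i%C * t%:C) = 0 by rewrite !ReImE mul0r mulr0 subr0.
have i : complex.Im ('i%C * t%:C) = t by rewrite !ReImE mulr0 mul1r add0r.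
by rewrite /cexp r i expR0 mul1r.
Qed.

Lemma cexp_Ni (t : R) : cexp (- 'i%C * t%:C) = cos t +i* - sin t.
Proof. by rewrite -sinN -(cosN t) -cexp_i mulNr -mulrN; congr (cexp (_ * _)); rewrite -rmorphN. Qed.

Lemma normc_cos_sin (t : R) : normc (cos t +i* sin t) = 1.
Proof. by rewrite /= cos2Dsin2 sqrtr1. Qed.

Lemma basisE l x : e_ l x = cos (mu l * (x - a)) +i* sin (mu l * (x - a)).
Proof. exact: cexp_i. Qed.

Lemma Re_basis l x : complex.Re (e_ l x) = cos (mu l * (x - a)).
Proof. by rewrite basisE. Qed.

Lemma Im_basis l x : complex.Im (e_ l x) = sin (mu l * (x - a)).
Proof. by rewrite basisE. Qed.

Lemma normc_basis l x : normc (e_ l x) = 1.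
Proof. by rewrite basisE normc_cos_sin. Qed.

Lemma mu_D l m : mu (l + m) = mu l + mu m.
Proof. by rewrite /mu_ rmorphD/=; field. Qed.

Lemma mu_0 : mu 0 = 0. Proof. by rewrite /mu_ mulr0 mul0r. Qed.

Lemma mu_N l : mu (- l) = - mu l.
Proof. by rewrite /mu_ rmorphN/= mulrN mulNr. Qed.

Lemma basisD l m x : e_ (l + m) x = e_ l x * e_ m x.
Proof.
rewrite !basisE mu_D mulrDl; apply: complex_eqP; rewrite !ReImE/=.
  by rewrite cosD.
by rewrite sinD addrC.
Qed.

Lemma basis0 x : e_ 0 x = 1.
Proof. by rewrite basisE mu_0 mul0r cos0 sin0. Qed.

Lemma basisNK l x : e_ (- l) x * e_ l x = 1.
Proof. by rewrite -basisD addNr basis0. Qed.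

Lemma basis_left l : e_ l a = 1.
Proof. by rewrite basisE subrr mulr0 cos0 sin0. Qed.

Lemma basis_right l : e_ l b = 1.
Proof.
have nat_case (n : nat) : e_ n%:Z b = 1.
  rewrite basisE (_ : mu _ * _ = 0 + (pi *+ 2) *+ n); last first.
    by rewrite /mu_ divfK// add0r -mulrnA -[in RHS]mulr_natl natrM mulrAC.
  rewrite (periodicn (@cosD2pi R)) (periodicn (@sinD2pi R)) cos0 sin0.
  by [].
case: l => n; first exact: nat_case.
rewrite NegzE.
by have := basisNK n.+1%:Z b; rewrite nat_case mulr1.
Qed.

Lemma mfun_cos l : mfun a b (fun x => cos (mu l * (x - a))).
Proof. apply: mfun_cont; apply: smooth_within; exact: smooth_cos_lin. Qed.

Lemma mfun_sin l : mfun a b (fun x => sin (mu l * (x - a))).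
Proof. apply: mfun_cont; apply: smooth_within; exact: smooth_sin_lin. Qed.

Lemma mfun_Re_basis l : mfun a b (fun x => complex.Re (e_ l x)).
Proof. by under eq_fun do rewrite Re_basis; exact: mfun_cos. Qed.

Lemma mfun_Im_basis l : mfun a b (fun x => complex.Im (e_ l x)).
Proof. by under eq_fun do rewrite Im_basis; exact: mfun_sin. Qed.

Lemma L2_basis l : L2 a b (e_ l).
Proof.
apply: (@L2_bounded _ _ _ _ 1); [exact: mfun_Re_basis|exact: mfun_Im_basis|].
by move=> x _; rewrite normc_basis.
Qed.

Lemma coefE u l : coef u l = (b - a)^-1%:C *
  (ip a b u (e_ l) +i* ip a b u (fun x => 'i%C * e_ l x)).
Proof.
rewrite /fourier_coef /cintegral; congr (_ * (_ +i* _)); apply: eq_rint => x _;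
  by rewrite cexp_Ni !(Re_basis, Im_basis, @ReImE R)/=; ring.
Qed.

Lemma Re_coef u l : complex.Re (coef u l) = (b - a)^-1 * ip a b u (e_ l).
Proof. by rewrite coefE !ReImE mul0r subr0. Qed.

Lemma Im_coef u l : complex.Im (coef u l) =
  (b - a)^-1 * ip a b u (fun x => 'i%C * e_ l x).
Proof. by rewrite coefE !ReImE mul0r addr0. Qed.

Definition coef_ReImE := (Re_coef, Im_coef, Re_basis, Im_basis, @ReImE R).

Let L2_ibasis l : L2 a b (fun x => 'i%C * e_ l x).
Proof. exact/L2Z/L2_basis. Qed.

Lemma coefD u v l : L2 a b u -> L2 a b v ->
  coef (fun x => u x + v x) l = coef u l + coef v l.
Proof.
move=> Lu Lv; have Le := L2_basis l; have Li := L2_ibasis l.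
by apply: complex_eqP; rewrite !(Re_coef, Im_coef, @ReImE R) ipDl// mulrDr.
Qed.

Lemma coefB u v l : L2 a b u -> L2 a b v ->
  coef (fun x => u x - v x) l = coef u l - coef v l.
Proof.
move=> Lu Lv; have Le := L2_basis l; have Li := L2_ibasis l.
by apply: complex_eqP; rewrite !(Re_coef, Im_coef, @ReImE R) ipBl// mulrBr.
Qed.

Lemma coefZ c u l : L2 a b u -> coef (fun x => c * u x) l = c * coef u l.
Proof.
move=> Lu; have Le := L2_basis l; have Li := L2_ibasis l.
apply: complex_eqP; rewrite !(Re_coef, Im_coef, @ReImE R).
  rewrite (mulrCA (complex.Re c)) (mulrCA (complex.Im c)) -mulrBr; congr (_ * _).
  rewrite /ip -!rintZ ?L2_itg_ip// -rintB ?itgZ ?L2_itg_ip//.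
  by apply: eq_rint => x _; rewrite !coef_ReImE; ring.
rewrite (mulrCA (complex.Re c)) (mulrCA (complex.Im c)) -mulrDr; congr (_ * _).
rewrite /ip -!rintZ ?L2_itg_ip// -rintD ?itgZ ?L2_itg_ip//.
by apply: eq_rint => x _; rewrite !coef_ReImE; ring.
Qed.

Lemma coef_cst0 l : coef (fun=> 0) l = 0.
Proof.
have -> : (fun=> 0 : R[i]) = (fun x : R => 0 * (1 : R[i])).
  by apply/funext => x; rewrite mul0r.
by rewrite (@coefZ 0 (fun=> 1)) ?mul0r//; exact: L2_cst.
Qed.

Lemma coef_sum (I : Type) (r : seq I) (F : I -> R -> R[i]) l :
  (forall i, L2 a b (F i)) ->
  coef (fun x => \sum_(i <- r) F i x) l = \sum_(i <- r) coef (F i) l.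
Proof.
move=> LF; elim: r => [|i r IH].
  by under eq_fun do rewrite big_nil; rewrite coef_cst0 big_nil.
under eq_fun do rewrite big_cons.
by rewrite big_cons coefD ?IH//; exact: L2_sum.
Qed.

Lemma coef_ae u v l : L2 a b u -> L2 a b v -> ae_eq_on a b u v -> coef u l = coef v l.
Proof.
move=> Lu Lv uv; have Le := L2_basis l; have Li := L2_ibasis l.
apply: complex_eqP; rewrite !(Re_coef, Im_coef).
  by rewrite (ip_ae Lu Lv Le uv).
by rewrite (ip_ae Lu Lv Li uv).
Qed.

Lemma mu_neq0 l : l != 0 -> mu l != 0.
Proof.
move=> l0; rewrite /mu_ !mulf_neq0 ?invr_eq0 ?intr_eq0//.
by rewrite gt_eqF// pi_gt0.
Qed.

Lemma coef_basis l m : coef (e_ m) l = (l == m)%:R.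
Proof.
rewrite /fourier_coef (_ : cintegral _ _ _ = cintegral a b (e_ (m - l))).
  have [->|lm] := eqVneq l m.
    rewrite subrr /cintegral.
    have -> : Rintegral lebesgue_measure `]a, b[%classic (fun x => complex.Re (e_ 0 x)) = b - a.
      rewrite -[LHS]/(rint a b _) (eq_rint (g := fun=> 1)) ?rint_cst ?mul1r// => x _.
      by rewrite basis0.
    have -> : Rintegral lebesgue_measure `]a, b[%classic (fun x => complex.Im (e_ 0 x)) = 0.
      rewrite -[LHS]/(rint a b _) (eq_rint (g := fun=> 0)) ?rint_cst ?mul0r// => x _.
      by rewrite basis0.
    by apply: complex_eqP; rewrite !ReImE/= ?mulVf// !mul0r ?subr0// mulr0 addr0.
  rewrite (_ : cintegral _ _ _ = 0) ?mulr0//.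
  set k := m - l; have k0 : mu k != 0 by rewrite mu_neq0// subr_eq0 eq_sym.
  have Ds (x : R) : is_derive x 1 (fun x => (mu k)^-1 * sin (mu k * (x - a)))
      (cos (mu k * (x - a))).
    apply: (is_derive_eq (is_deriveZ (mu k)^-1 (is_derive_sin_lin (mu k) a x))).
    by rewrite /GRing.scale/= mulrA mulVf// mul1r.
  have Dc (x : R) : is_derive x 1 (fun x => - (mu k)^-1 * cos (mu k * (x - a)))
      (sin (mu k * (x - a))).
    apply: (is_derive_eq (is_deriveZ (- (mu k)^-1) (is_derive_cos_lin (mu k) a x))).
    by rewrite /GRing.scale/= mulrA mulrNN mulVf// mul1r.
  have er := basis_right k; have el := basis_left k.
  rewrite /cintegral -[X in X +i* _]/(rint a b _) -[X in _ +i* X]/(rint a b _).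
  under [X in X +i* _]eq_rint do rewrite Re_basis.
  under [X in _ +i* X]eq_rint do rewrite Im_basis.
  rewrite (rint_FTC hab Ds); last exact/smooth_continuous/smooth_cos_lin.
  rewrite (rint_FTC hab Dc); last exact/smooth_continuous/smooth_sin_lin.
  by rewrite -!Re_basis -!Im_basis er el !subrr.
rewrite /cintegral; congr (_ +i* _); apply: eq_rint => x _;
  by rewrite basisD !basisE mu_N (mulNr (mu l)) cosN sinN cexp_Ni.
Qed.

Lemma cexp_Ni_basis l x : cexp (- 'i%C * (mu l * (x - a))%:C) = e_ (- l) x.
Proof. by rewrite cexp_Ni basisE mu_N mulNr cosN sinN. Qed.

Lemma coef_shift u l k : coef (fun x => u x * e_ k x) l = coef u (l - k).
Proof.
rewrite /fourier_coef; congr (_ * _).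
have E x : u x * e_ k x * cexp (- 'i%C * (mu l * (x - a))%:C) =
    u x * cexp (- 'i%C * (mu (l - k) * (x - a))%:C).
  by rewrite -mulrA !cexp_Ni_basis -basisD opprB.
by rewrite /cintegral; congr (_ +i* _); apply: eq_rint => x _; rewrite E.
Qed.

Definition trig s z x := \sum_(l <- s) z l * e_ l x.

Lemma L2_term z l : L2 a b (fun x => z l * e_ l x).
Proof. exact/L2Z/L2_basis. Qed.

Lemma L2_trig s z : L2 a b (trig s z).
Proof. by apply: L2_sum => l; exact: L2_term. Qed.

Lemma coef_trig s z l : uniq s -> coef (trig s z) l = if l \in s then z l else 0.
Proof.
move=> us; rewrite coef_sum; last by move=> i; exact: L2_term.
rewrite (eq_bigr (fun i => if i == l then z i else 0)); last first.
  move=> i _; rewrite coefZ ?coef_basis; last exact: L2_basis.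
  by rewrite eq_sym; case: eqP; rewrite ?mulr1 ?mulr0.
rewrite -big_mkcond/=; case: ifPn => ls.
  by rewrite -big_filter filter_pred1_uniq// big_seq1.
rewrite big_seq_cond big1// => i /andP[/[swap]/eqP ->]; rewrite (negPf ls).
by [].
Qed.

Lemma ip_term u z l : L2 a b u -> ip a b u (fun x => z l * e_ l x) =
  (b - a) * (complex.Re (z l) * complex.Re (coef u l) +
             complex.Im (z l) * complex.Im (coef u l)).
Proof.
move=> Lu; have Le := L2_basis l; have Li := L2_ibasis l.
rewrite Re_coef Im_coef (mulrCA (complex.Re _)) (mulrCA (complex.Im _)) -mulrDr.
rewrite mulrA divff// mul1r -!ipZr// -ipDr//; [|exact: L2Z..].
by apply: eq_rint => x _; rewrite !coef_ReImE; ring.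
Qed.

Lemma ip_trig u s z : L2 a b u -> ip a b u (trig s z) =
  (b - a) * \sum_(l <- s) (complex.Re (z l) * complex.Re (coef u l) +
             complex.Im (z l) * complex.Im (coef u l)).
Proof.
move=> Lu; rewrite ip_sumr//; last by move=> l; exact: L2_term.
by rewrite mulr_sumr; apply: eq_bigr => l _; exact: ip_term.
Qed.

(** Bessel's inequality is the case [z = coef u]. *)
Lemma pythagoras u s z : L2 a b u -> uniq s ->
  nrm a b (fun x => u x - trig s z x) ^+ 2 =
  nrm a b u ^+ 2 - (b - a) * l2 s (coef u) ^+ 2
  + (b - a) * l2 s (fun l => coef u l - z l) ^+ 2.
Proof.
move=> Lu us; have Lt := L2_trig s z.
rewrite !nrm_sqr ipBl// ?ipBr//; [|exact: L2B..].
rewrite (ipC a b (trig s z) u) !ip_trig// !l2_sqr.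
rewrite [X in _ - _ - (_ - _ * X)](eq_big_seq (fun l => normc (z l) ^+ 2)); last first.
  by move=> l ls; rewrite coef_trig// ls normc_sqr !expr2.
rewrite -!mulrBr -!addrA; congr (_ + _).
rewrite -!mulrN -!mulrDr; congr (_ * _).
move: (coef u) => c; rewrite -sumrB -!sumrN -!big_split/=; apply: eq_bigr => l _.
by move: (c l) (z l) => p q; rewrite !normc_sqr !ReImE; ring.
Qed.

Lemma bessel u s : L2 a b u -> uniq s ->
  Num.sqrt (b - a) * l2 s (coef u) <= nrm a b u.
Proof.
move=> Lu us; rewrite -ler_sqr ?nnegrE ?mulr_ge0 ?nrm_ge0 ?sqrtr_ge0 ?l2_ge0//.
have := sqr_ge0 (nrm a b (fun x => u x - trig s (coef u) x)).
rewrite pythagoras// exprMn (sqr_sqrtr (ltW ba_gt0)).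
rewrite [X in _ + _ * X ^+ 2](_ : _ = 0).
  by rewrite expr0n mulr0 addr0 subr_ge0.
rewrite /l2 big1 ?sqrtr0// => l _.
by rewrite subrr normc0 expr0n.
Qed.

Lemma nrm_trig s z : uniq s -> nrm a b (trig s z) = Num.sqrt (b - a) * l2 s z.
Proof.
move=> us; apply/eqP; rewrite -(@eqrXn2 _ 2) ?nrm_ge0 ?mulr_ge0 ?sqrtr_ge0 ?l2_ge0//.
rewrite exprMn (sqr_sqrtr (ltW ba_gt0)) nrm_sqr ip_trig; last exact: L2_trig.
rewrite l2_sqr; apply/eqP; congr (_ * _); apply: eq_big_seq => l ls.
by rewrite coef_trig// ls normc_sqr !expr2.
Qed.

Lemma trigB s z w x : trig s z x - trig s w x = trig s (fun l => z l - w l) x.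
Proof. by rewrite /trig -sumrB; apply: eq_bigr => l _; rewrite mulrBl. Qed.

Lemma nrm_trigB s z w : uniq s -> nrm a b (fun x => trig s z x - trig s w x) =
  Num.sqrt (b - a) * l2 s (fun l => z l - w l).
Proof. by move=> us; rewrite -nrm_trig//; congr nrm; apply/funext => x; exact: trigB. Qed.

Lemma normc_trig_le s z x : normc (trig s z x) <= \sum_(l <- s) normc (z l).
Proof.
apply: (le_trans (le_normc_sum _ _)); apply: ler_sum => l _.
by rewrite normcM normc_basis mulr1.
Qed.

Lemma eq_trig s z w x : {in s, z =1 w} -> trig s z x = trig s w x.
Proof. by move=> zw; apply: eq_big_seq => l /zw ->. Qed.

End FourierCoefficients.

#[local] Opaque fourier_basis fourier_coef.

(** * The quotient of the sine, and sets of frequencies *)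

Section SineQuotient.
Variable R : realType.
Implicit Types x y t : R.
Import Normc.

Lemma phi_s_0 : phi_s (0 : R) = 1. Proof. by rewrite /phi_s eqxx. Qed.

Lemma mul_phi_s t : t * phi_s t = sin t.
Proof.
rewrite /phi_s; case: eqP => [->|/eqP t0]; first by rewrite sin0 mul0r.
by rewrite mulrC divfK.
Qed.

Lemma continuous_phi_s : continuous (@phi_s R).
Proof.
move=> t; have [->|t0] := eqVneq t 0.
  have /is_derive1_caratheodory[g [gE cg g0]] := is_derive_sin (0 : R).
  suff -> : @phi_s R = g by [].
  apply/funext => z; have [->|z0] := eqVneq z 0; first by rewrite phi_s_0 g0 cos0.
  by rewrite /phi_s (negPf z0); have := gE z; rewrite sin0 !subr0 => ->; rewrite mulfK.
have c : {for t, continuous (fun x : R => sin x / x)}.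
  apply: cvgM; first exact: continuous_sin.
  by apply: cvgV => //; exact: cvg_id.
have near_eq : {near t, (fun x : R => sin x / x) =1 @phi_s R}.
  by near=> z; rewrite /phi_s ifF//; apply/negbTE; near: z; exact: open_neq.
rewrite /continuous_at {2}/phi_s (negPf t0).
by apply: cvg_trans c; apply: near_eq_cvg.
Unshelve. all: by end_near. Qed.

Lemma phi_sN t : phi_s (- t) = phi_s t.
Proof. by rewrite /phi_s oppr_eq0; case: eqP => // _; rewrite sinN mulNr invrN mulrN opprK. Qed.

Lemma phi_s_gt0 t : - pi < t < pi -> 0 < phi_s t.
Proof.
wlog t0 : t / 0 <= t => [H tpi|].
  have [/H|t0] := leP 0 t; first exact.
  by rewrite -phi_sN; apply: H; rewrite ?oppr_ge0 ?ltW//; lra.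
move=> /andP[_ tpi]; move: t0; rewrite le_eqVlt => /predU1P[<-|t0].
  by rewrite phi_s_0.
by rewrite /phi_s gt_eqF// divr_gt0// sin_gt0_pi// t0.
Qed.

Lemma norm_sin_le t : `|sin t| <= `|t|.
Proof.
wlog t0 : t / 0 < t => [H|].
  have [t0|t0|<-] := ltgtP 0 t; [exact: H| |by rewrite sin0].
  by have := H (- t); rewrite sinN !normrN oppr_gt0; apply.
have [x _] := MVT t0 (fun x _ => is_derive_sin x)
  (continuous_subspaceT (@continuous_sin R)).
rewrite sin0 !subr0 => ->; rewrite normrM ler_piMl//; exact: cos_max.
Qed.

Lemma sin_half_sqr t : 1 - cos t = 2 * sin (t / 2) ^+ 2.
Proof.
have -> : cos t = cos ((t / 2) *+ 2) by congr cos; rewrite -mulr_natr divfK.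
by rewrite cos_mulr2n cos2sin2 mulr2n; ring.
Qed.

Lemma normc_sub_cis x y :
  normc ((cos x +i* sin x) - (cos y +i* sin y)) = 2 * `|sin ((x - y) / 2)|.
Proof.
apply/eqP; rewrite -(@eqrXn2 _ 2) ?normc_ge0 ?mulr_ge0//.
rewrite normc_sqr !ReImE /= exprMn real_normK ?num_real// -[2 ^+ 2]/(2 * 2).
rewrite -mulrA -sin_half_sqr cosB.
have := cos2Dsin2 x; have := cos2Dsin2 y.
move: (cos x) (sin x) (cos y) (sin y) => c1 s1 c2 s2 h2 h1; apply/eqP.
by lra.
Qed.

Lemma normc_sub_cis_le x y :
  normc ((cos x +i* sin x) - (cos y +i* sin y)) <= `|x - y|.
Proof.
rewrite normc_sub_cis -ler_pdivlMl// mulrC.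
by rewrite (le_trans (norm_sin_le _))// normrM ger0_norm.
Qed.

End SineQuotient.

Section FrequencySets.
Implicit Types (s t : seq int).

(** The frequencies as a sequence of integers, so that partial sums and tails
    are sums over plain finite sets of frequencies. *)
Definition freqs (N : nat) : seq int := [seq freq k | k <- index_enum 'I_N].

Lemma freqs_uniq N : uniq (freqs N).
Proof.
rewrite map_inj_uniq ?index_enum_uniq// => i j; rewrite /freq => /addIr [] ij.
exact: val_inj.
Qed.

Lemma mem_freqs N l : (l \in freqs N) = (- (N./2)%:Z <= l < N%:Z - (N./2)%:Z).
Proof.
apply/mapP/idP => [[k _ ->]|/andP[h1 h2]].
  by have := ltn_ord k; rewrite /freq; lia.
have h : (absz (l + (N./2)%:Z)%R < N)%N by lia.
exists (Ordinal h); first by rewrite mem_index_enum.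
by rewrite /freq /=; lia.
Qed.

Lemma freqsS N M : (N <= M)%N -> ~~ odd N -> ~~ odd M -> {subset freqs N <= freqs M}.
Proof. by move=> NM oN oM l; rewrite !mem_freqs; lia. Qed.

Lemma notin_freqs N l : ~~ odd N -> l \notin freqs N -> (N./2 <= `|l|)%N.
Proof. by move=> oN; rewrite mem_freqs; lia. Qed.

Lemma sum_freqs (V : zmodType) N (F : int -> V) :
  \sum_(l <- freqs N) F l = \sum_(k < N) F (freq k).
Proof. by rewrite big_map. Qed.

Definition tail s t := [seq l <- t | l \notin s].

Lemma tail_uniq s t : uniq t -> uniq (tail s t).
Proof. exact: filter_uniq. Qed.

Lemma sum_tail (V : zmodType) s t (F : int -> V) : uniq s -> uniq t ->
  {subset s <= t} ->
  \sum_(l <- t) F l = \sum_(l <- s) F l + \sum_(l <- tail s t) F l.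
Proof.
move=> us ut st; rewrite -big_cat; apply: perm_big; apply: uniq_perm => //.
  rewrite cat_uniq us filter_uniq// andbT; apply/hasPn => l.
  by rewrite mem_filter => /andP[].
move=> l; rewrite mem_cat mem_filter; case: (boolP (l \in s)) => //= ls.
by rewrite st.
Qed.

(** Compared with the telescoping series of general term
    [2 / k - 2 / (k + 1)]. *)
Lemma sum_nat_inv_sqr (R : realType) (r : seq nat) m : uniq r -> (0 < m)%N ->
  (forall k, k \in r -> (m <= k)%N) ->
  \sum_(k <- r) (k%:R ^+ 2)^-1 <= 2 / m%:R :> R.
Proof.
move=> ur m0 rm.
have [M rM] : exists M, forall k, k \in r -> (k < M)%N.
  exists (\max_(k <- r) k).+1 => k kr; rewrite ltnS; exact: leq_bigmax_seq.
have tele n : (m <= n)%N -> \sum_(m <= k < n) (k%:R ^+ 2)^-1 <= 2 / m%:R - 2 / n%:R :> R.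
  elim: n => [|n IH]; first by rewrite leqn0 => /eqP mz; rewrite mz in m0.
  rewrite leq_eqVlt => /predU1P[<-|]; first by rewrite big_geq// subrr.
  rewrite ltnS => mn; rewrite big_nat_recr//=.
  have n0 : 0 < n%:R :> R by rewrite ltr0n (leq_trans m0).
  have n1 : 1 <= n%:R :> R by rewrite ler1n (leq_trans m0).
  have key : (n%:R ^+ 2)^-1 <= 2 / n%:R - 2 / n.+1%:R :> R.
    rewrite -natr1 -subr_ge0.
    rewrite (_ : _ - _ = (n%:R - 1) / (n%:R ^+ 2 * (n%:R + 1))).
      by rewrite divr_ge0 ?subr_ge0// mulr_ge0// ?exprn_ge0// addr_ge0// ltW.
    by field; rewrite !gt_eqF// addr_gt0.
  by apply: (le_trans (lerD (IH mn) key)); rewrite addrA subrK.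
have [mM|Mm] := leqP m M; last first.
  rewrite big1_seq ?divr_ge0// => k /andP[_ kr].
  by have := rm _ kr; have := rM _ kr; lia.
apply: (@le_trans _ _ (\sum_(m <= k < M) (k%:R ^+ 2)^-1)).
  rewrite (perm_big [seq k <- index_iota m M | k \in r]); last first.
    apply: uniq_perm => //; first by rewrite filter_uniq// iota_uniq.
    move=> k; rewrite mem_filter mem_index_iota.
    case: (boolP (k \in r)) => kr //=.
    by rewrite rm// rM.
  rewrite big_filter [leRHS](bigID (mem r))/= lerDl.
  by apply: sumr_ge0 => k _; rewrite invr_ge0 sqr_ge0.
by apply: (le_trans (tele _ mM)); rewrite gerBl divr_ge0.
Qed.

Lemma sum_int_inv_sqr (R : realType) s m : uniq s -> (0 < m)%N ->
  (forall l, l \in s -> (m <= `|l|)%N) ->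
  \sum_(l <- s) (l%:~R ^+ 2)^-1 <= 4 / m%:R :> R.
Proof.
move=> us m0 sm; rewrite (bigID (fun l => 0 <= l))/=.
have half (p : pred int) : {in p &, forall k l : int, `|k|%N = `|l|%N -> k = l} ->
    \sum_(l <- s | p l) (l%:~R ^+ 2)^-1 <= 2 / m%:R :> R.
  move=> pinj; rewrite -big_filter.
  rewrite (eq_bigr (fun l : int => ((`|l|%N)%:R ^+ 2)^-1 : R)); last first.
    by move=> l _; rewrite natr_absz intr_norm real_normK// num_real.
  rewrite -(big_map (fun l : int => `|l|%N) predT (fun k => (k%:R ^+ 2)^-1)).
  apply: sum_nat_inv_sqr => //.
    rewrite map_inj_in_uniq ?filter_uniq// => k l.
    by rewrite !mem_filter => /andP[pk _] /andP[pl _]; exact: pinj.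
  by move=> k /mapP[l]; rewrite mem_filter => /andP[_ /sm h] ->.
rewrite (_ : 4 / m%:R = 2 / m%:R + 2 / m%:R); last by rewrite -mulrDl -natrD.
apply: lerD; [apply: (half (fun l => 0 <= l))|apply: (half (fun l => ~~ (0 <= l)))];
  by move=> k l; rewrite /in_mem/= => hk hl; lia.
Qed.

End FrequencySets.

(** * Pointwise convergence of Fourier series *)

Section FourierConvergence.
Variables (R : realType) (a b : R).
Hypothesis hab : a < b.
Implicit Types (u v p : R -> R[i]) (l m : int) (s t : seq int) (z w : int -> R[i]).
Import Normc.

Local Notation mu := (mu_ a b).
Local Notation e_ := (fourier_basis a b).
Local Notation coef := (fourier_coef a b).
Local Notation trig := (trig a b).

Let ba_gt0 : 0 < b - a. Proof. by rewrite subr_gt0. Qed.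

Lemma normc_basisB l x y : normc (e_ l x - e_ l y) <= `|mu l| * `|x - y|.
Proof.
rewrite !basisE (le_trans (normc_sub_cis_le _ _))// -normrM -mulrBr.
by rewrite opprB addrA subrK.
Qed.

Lemma le_norm_mu l : `|l|%:~R <= (b - a) * `|mu l|.
Proof.
rewrite /mu_ !normrM normfV (gtr0_norm ba_gt0) mulrC divfK ?gt_eqF//.
rewrite -intr_norm ler_peMl// ?ler0z// (ger0_norm (pi_ge0 R)) normr_nat.
by have := pi_ge2 R; lra.
Qed.

Lemma sum_inv_mu_sqr s (m : nat) : uniq s -> (0 < m)%N ->
  (forall l, l \in s -> (m <= `|l|)%N) ->
  \sum_(l <- s) (mu l ^+ 2)^-1 <= (b - a) ^+ 2 * (4 / m%:R).
Proof.
move=> us m0 sm.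
apply: le_trans (ler_wpM2l (sqr_ge0 (b - a)) (sum_int_inv_sqr R us m0 sm)).
rewrite mulr_sumr big_seq [leRHS]big_seq; apply: ler_sum => l /sm ml.
have l0 : l != 0 by apply: contraTneq ml => ->; rewrite -ltnNge.
have ml0 : 0 < mu l ^+ 2 by rewrite exprn_even_gt0//= mu_neq0.
have il0 : 0 < l%:~R ^+ 2 :> R by rewrite exprn_even_gt0//= intr_eq0.
rewrite ler_pdivlMr// mulrC ler_pdivrMr//.
rewrite -[leLHS]real_normK ?num_real// -(real_normK (num_real (mu l))) -exprMn.
apply: lerXn2r; rewrite ?nnegrE ?mulr_ge0 ?(ltW ba_gt0)//.
by rewrite -intr_norm le_norm_mu.
Qed.

(** Cauchy-Schwarz with the weights [1 / mu l], whose squares are summable. *)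
Lemma l1_tail s z (m : nat) : uniq s -> (0 < m)%N ->
  (forall l, l \in s -> (m <= `|l|)%N) ->
  \sum_(l <- s) normc (z l) <=
  (b - a) * Num.sqrt (4 / m%:R) * l2 s (fun l => (mu l)%:C * z l).
Proof.
move=> us m0 sm.
rewrite -ler_sqr ?nnegrE ?mulr_ge0 ?sqrtr_ge0 ?l2_ge0 ?(ltW ba_gt0)//; last first.
  by apply: sumr_ge0 => l _; exact: normc_ge0.
rewrite !exprMn sqr_sqrtr ?divr_ge0// l2_sqr.
apply: le_trans (ler_wpM2r _ (sum_inv_mu_sqr us m0 sm)); last first.
  by apply: sumr_ge0 => l _; rewrite sqr_ge0.
rewrite (eq_big_seq (fun l => `|mu l|^-1 * normc ((mu l)%:C * z l))); last first.
  move=> l /sm ml; rewrite normcM normc_real mulrA mulVf ?mul1r// normr_eq0.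
  by apply: mu_neq0 => //; apply: contraTneq ml => ->; rewrite -ltnNge.
have -> : \sum_(l <- s) (mu l ^+ 2)^-1 = \sum_(l <- s) (`|mu l|^-1) ^+ 2.
  by apply: eq_bigr => l _; rewrite exprVn real_normK// num_real.
exact: sum_cauchy_schwarz.
Qed.

Lemma l1_le s z : uniq s -> \sum_(l <- s) normc (z l) <=
  l2 s z + 2 * (b - a) * l2 s (fun l => (mu l)%:C * z l).
Proof.
move=> us; rewrite (bigID (fun l => l == 0))/=; apply: lerD.
  rewrite -big_filter; have [s0|s0] := boolP (0 \in s).
    rewrite filter_pred1_uniq// big_seq1 -(@ler_sqr _ _ (l2 s z)) ?nnegrE ?l2_ge0 ?normc_ge0//.
    rewrite l2_sqr (big_rem _ s0)/= lerDl sumr_ge0// => l _; exact: sqr_ge0.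
  rewrite big_filter big_seq_cond big1 ?l2_ge0// => l /andP[/[swap]/eqP ->].
  by rewrite (negPf s0).
rewrite -big_filter; apply: (le_trans (@l1_tail _ _ 1 _ _ _)) => //.
- exact: filter_uniq.
- by move=> l; rewrite mem_filter absz_gt0 => /andP[].
have -> : Num.sqrt (4 / 1%:R) = 2 :> R.
  by rewrite divr1 (_ : 4 = 2 ^+ 2) ?sqrtr_sqr ?ger0_norm// expr2 -natrM.
rewrite (mulrC 2) ler_wpM2l ?mulr_ge0 ?(ltW ba_gt0)//.
apply: ler_wsqrtr; rewrite big_filter [leRHS](bigID (fun l => l == 0))/= lerDr.
by apply: sumr_ge0 => l _; exact: sqr_ge0.
Qed.

(** Cauchy-Schwarz; this is the interpolation of [H^1] between [L^2] and
    [H^2]. *)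
Lemma l2_interpolation s z : l2 s (fun l => (mu l)%:C * z l) ^+ 2 <=
  l2 s z * l2 s (fun l => (mu l ^+ 2)%:C * z l).
Proof.
rewrite -ler_sqr ?nnegrE ?mulr_ge0 ?l2_ge0 ?sqr_ge0// [leRHS]exprMn !l2_sqr.
rewrite (eq_bigr (fun l => normc (z l) * normc ((mu l ^+ 2)%:C * z l))); last first.
  move=> l _; rewrite !normcM !normc_real normrX expr2 expr2; ring.
exact: sum_cauchy_schwarz.
Qed.

Lemma normc_basis1B x y :
  normc (e_ 1 x - e_ 1 y) = 2 * `|sin (pi / (b - a) * (x - y))|.
Proof.
rewrite !basisE normc_sub_cis; congr (_ * `|sin _|).
rewrite -mulrBr opprB addrA subrK /mu_ mulr1.
by field; rewrite subr_eq0 gt_eqF.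
Qed.

Lemma normc_basis1B_ge y : y \in `]a, b[ ->
  exists2 c, 0 < c & {in `]a, b[, forall x, c * `|x - y| <= normc (e_ 1 x - e_ 1 y)}.
Proof.
rewrite in_itv/= => /andP[ay yb].
have pb : 0 < pi / (b - a) by rewrite divr_gt0 ?pi_gt0.
have [|c cI cmin] := @EVT_min R (@phi_s R) (pi / (b - a) * (a - y))
    (pi / (b - a) * (b - y)) _ (continuous_subspaceT (@continuous_phi_s R)).
  by rewrite ler_wpM2l ?(ltW pb)// lerD2r ltW.
have c0 : 0 < phi_s c.
  move: cI; rewrite in_itv/= => /andP[c1 c2].
  apply: phi_s_gt0; apply/andP; split.
    apply: lt_le_trans c1; rewrite mulrAC ltr_pdivlMr// mulNr -mulrN ltr_pM2l ?pi_gt0//; lra.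
  by apply: le_lt_trans c2 _; rewrite mulrAC ltr_pdivrMr// ltr_pM2l ?pi_gt0//; lra.
have nb x := normc_basis1B x y.
move: (pi / (b - a)) pb cmin nb {cI} => k k0 cmin nb.
exists (2 * (k * phi_s c)); first by rewrite !mulr_gt0.
move=> x; rewrite in_itv/= => /andP[xa bx].
rewrite nb -mul_phi_s !normrM (ger0_norm (ltW k0)) -!mulrA ler_wpM2l//.
rewrite ler_wpM2l ?(ltW k0)// mulrC ler_wpM2l//.
apply: le_trans (ler_norm _); apply: cmin.
by rewrite in_itv/= !ler_wpM2l ?(ltW k0)// lerD2r ltW.
Qed.

(** Chernoff's proof of pointwise convergence.  Where the difference quotient [g]
    of [p] against [e_ 1] is square integrable, the coefficients of
    [p - p x0] are differences of consecutive terms, so partial sums telescope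
    and the remaining terms tend to [0] by Bessel's inequality. *)
Section Chernoff.
Variables (p : R -> R[i]) (x0 : R) (g : R -> R[i]).
Hypotheses (Lp : L2 a b p) (L2_g : L2 a b g).
Hypothesis g_den : {in `]a, b[, forall x, g x * (e_ 1 x - e_ 1 x0) = p x - p x0}.

Let G l := coef g l * e_ (l + 1) x0.

Lemma chernoff_telescope l :
  coef p l * e_ l x0 - (if l == 0 then p x0 else 0) = G (l - 1) - G l.
Proof.
have Lge : L2 a b (fun x => g x * e_ 1 x).
  apply: (@L2M_bounded _ _ _ g (e_ 1) 1) => //.
  - exact: mfun_Re_basis.
  - exact: mfun_Im_basis.
  - by move=> x _; rewrite normc_basis.
have Lg0 : L2 a b (fun x => e_ 1 x0 * g x) by exact: L2Z.
have := coefB l Lge Lg0.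
rewrite coefZ// coef_shift.
have -> : coef (fun x => g x * e_ 1 x - e_ 1 x0 * g x) l = coef (fun x => p x - p x0) l.
  apply: coef_ae; [exact: L2B|by apply: L2B => //; exact: L2_cst|].
  by apply/aeW => x xI; rewrite -g_den//; ring.
rewrite coefB//; last exact: L2_cst.
have -> : coef (fun=> p x0) l = if l == 0 then p x0 else 0.
  have -> : (fun=> p x0) = (fun x : R => p x0 * e_ 0 x).
    by apply/funext => x; rewrite basis0 mulr1.
  rewrite coefZ ?(coef_basis hab)//; last exact: L2_basis.
  by case: eqP; rewrite ?mulr1 ?mulr0.
move=> H; rewrite /G subrK (basisD hab l 1) mulrA (mulrAC (coef g l)) -mulrBl.
rewrite (mulrC (coef g l)) -H mulrBl; congr (_ - _).
  by case: eqP => [->|]; rewrite ?basis0 ?mulr1 ?mul0r.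
exact: hab.
Qed.

Lemma fourier_partial_sum n :
  trig (freqs n.+1.*2) (coef p) x0 - p x0 = G (- n.+2%:Z) - G n%:Z.
Proof.
have E : trig (freqs n.+1.*2) (coef p) x0 - p x0 =
    \sum_(l <- freqs n.+1.*2) (coef p l * e_ l x0 - (if l == 0 then p x0 else 0)).
  rewrite sumrB; congr (_ - _).
  rewrite -big_mkcond/= -big_filter filter_pred1_uniq ?freqs_uniq ?big_seq1//.
  by rewrite mem_freqs; lia.
rewrite {}E (eq_bigr _ (fun l _ => chernoff_telescope l)) sum_freqs.
rewrite -(big_mkord predT (fun k => G (k%:Z - (n.+1.*2./2)%:Z - 1) - G (k%:Z - (n.+1.*2./2)%:Z))).
rewrite doubleK.
pose f (k : nat) := - G (k%:Z - n.+2%:Z).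
rewrite (eq_bigr (fun k => f k.+1 - f k)); last first.
  move=> k _; rewrite /f opprK addrC; congr (- G _ + G _); lia.
by rewrite telescope_sumr// /f opprK addrC; congr (G _ - G _); lia.
Qed.

Lemma cvg_fourier_partial_sum :
  normc (trig (freqs n.+1.*2) (coef p) x0 - p x0) @[n --> \oo] --> 0.
Proof.
have Gc l : normc (G l) = normc (coef g l) by rewrite /G normcM normc_basis mulr1.
pose q n := normc (coef g (- n.+2%:Z)) ^+ 2 + normc (coef g n%:Z) ^+ 2.
have q0 n : 0 <= q n by rewrite addr_ge0 ?sqr_ge0.
have bound n : series q n <= nrm a b g ^+ 2 / (b - a).
  rewrite ler_pdivlMr// /series/= big_split/=.
  pose s : seq int := [seq - k.+2%:Z | k <- index_iota 0 n] ++ [seq k%:Z | k <- index_iota 0 n].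
  have us : uniq s.
    rewrite cat_uniq !map_inj_uniq ?iota_uniq/=; [|by move=> i j []|by move=> i j; lia].
    rewrite andbT; apply/hasPn => _ /mapP[k _ ->]; apply/negP => /mapP[j _]; lia.
  have := bessel hab L2_g us.
  rewrite -ler_sqr ?nnegrE ?mulr_ge0 ?sqrtr_ge0 ?l2_ge0 ?nrm_ge0// exprMn.
  by rewrite sqr_sqrtr ?(ltW ba_gt0)// mulrC l2_sqr big_cat !big_map.
have cq : q n @[n --> \oo] --> 0.
  apply: cvg_series_cvg_0; apply: nondecreasing_is_cvgn.
    by apply: nondecreasing_series => k _ _.
  by exists (nrm a b g ^+ 2 / (b - a)) => _ [n _ <-].
have cs : 2 * Num.sqrt (q n) @[n --> \oo] --> 0.
  rewrite -[X in _ --> X](mulr0 2); apply: cvgMr; rewrite -(@sqrtr0 R).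
  by apply: continuous_cvg => //; exact: sqrt_continuous.
apply: (squeeze_cvgr _ (cvg_cst 0) cs); near=> n; rewrite normc_ge0/=.
rewrite fourier_partial_sum (le_trans (le_normcB _ _))// !Gc.
have h l : normc (coef g l) ^+ 2 <= q n -> normc (coef g l) <= Num.sqrt (q n).
  by move=> h; rewrite -(ger0_norm (normc_ge0 (coef g l))) -sqrtr_sqr ler_wsqrtr.
by rewrite mulr_natl mulr2n lerD// h// /q ?lerDl ?lerDr sqr_ge0.
Unshelve. all: by end_near. Qed.

End Chernoff.

(** A Lipschitz bound makes Chernoff's quotient bounded because
    [e_ 1 x - e_ 1 x0] is bounded below by a multiple of [x - x0]; this last
    bound requires [x0] to be an interior point. *)
Lemma cvg_fourier_lipschitz p K x0 : L2 a b p -> 0 <= K ->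
  {in `]a, b[ &, forall x y, normc (p x - p y) <= K * `|x - y|} -> x0 \in `]a, b[ ->
  normc (trig (freqs n.+1.*2) (coef p) x0 - p x0) @[n --> \oo] --> 0.
Proof.
move=> Lp K0 lip x0I; have [c c0 Hc] := normc_basis1B_ge x0I.
have [||||||g Lg gE] := @L2_quotient _ a b (fun x => p x - p x0)
  (fun x => e_ 1 x - e_ 1 x0) (K / c); last exact: cvg_fourier_partial_sum Lp Lg gE.
- by rewrite divr_ge0// ltW.
- under eq_fun do rewrite ReB.
  by apply: mfunB; [exact: L2_mRe|exact: mfun_cst].
- under eq_fun do rewrite ImB.
  by apply: mfunB; [exact: L2_mIm|exact: mfun_cst].
- under eq_fun do rewrite ReB.
  by apply: mfunB; [exact: mfun_Re_basis|exact: mfun_cst].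
- under eq_fun do rewrite ImB.
  by apply: mfunB; [exact: mfun_Im_basis|exact: mfun_cst].
move=> x xI; apply: (le_trans (lip _ _ xI x0I)).
by rewrite -mulrA ler_wpM2l// mulrC ler_pdivlMr// mulrC Hc.
Qed.

End FourierConvergence.

(** * Fourier coefficients of weak derivatives *)

Section WeakDerivativeFourier.
Variables (R : realType) (a b : R).
Hypothesis hab : a < b.
Implicit Types (u v q : R -> R[i]) (g : nat -> R -> R[i]) (phi : R -> R) (l : int).
Import Normc.

Local Notation mu := (mu_ a b).
Local Notation e_ := (fourier_basis a b).
Local Notation coef := (fourier_coef a b).

Let ba_gt0 : 0 < b - a. Proof. by rewrite subr_gt0. Qed.

Lemma test_smooth phi : test_function a b phi -> smooth phi.
Proof.
move=> [D _] n; elim: n phi D => [//|n IH] phi D; split; first exact: (D 0%N).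
by apply: IH => k x; rewrite -derive1Sn.
Qed.

Lemma test_derive1 phi : test_function a b phi -> test_function a b (derive1 phi).
Proof.
move=> tp; have sp := test_smooth tp; case: tp => _ [c [d [ac db supp]]].
split; first exact/smooth_derive1n/smooth_derive1.
exists c, d; split => // x; apply: contraNT => xcd.
have z y : ~~ (c <= y <= d) -> phi y = 0.
  by move=> ycd; apply/eqP; apply: contraNT ycd => /supp.
apply/eqP; apply: is_derive1P; apply: (@near_eq_is_derive _ _ _ (cst (0 : R))).
move: xcd; rewrite negb_and -!ltNge => /orP[xc|dx].
  near=> y; rewrite /= z// negb_and -!ltNge; apply/orP; left.
  by near: y; exact: lt_nbhsl.
near=> y; rewrite /= z// negb_and -!ltNge; apply/orP; right.
by near: y; exact: lt_nbhsr.
Unshelve. all: by end_near. Qed.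

Lemma weak_derivP u v : weak_deriv a b u v <->
  weak_deriv_real a b (fun x => complex.Re (u x)) (fun x => complex.Re (v x)) /\
  weak_deriv_real a b (fun x => complex.Im (u x)) (fun x => complex.Im (v x)).
Proof.
have Rr z (r : R) : complex.Re (z * r%:C) = complex.Re z * r.
  by rewrite !ReImE mulr0 subr0.
have Ri z (r : R) : complex.Im (z * r%:C) = complex.Im z * r.
  by rewrite !ReImE mulr0 add0r.
have Er w phi : Rintegral lebesgue_measure `]a, b[%classic (fun x => complex.Re (w x * (phi x)%:C)) =
    rint a b (fun x => complex.Re (w x) * phi x).
  by apply: eq_rint => x _; exact: Rr.
have Ei w phi : Rintegral lebesgue_measure `]a, b[%classic (fun x => complex.Im (w x * (phi x)%:C)) =
    rint a b (fun x => complex.Im (w x) * phi x).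
  by apply: eq_rint => x _; exact: Ri.
split=> [wd|[wr wi] phi tp].
  by split => phi /wd; rewrite /cintegral !Er !Ei => -[].
by rewrite /cintegral !Er !Ei wr// wi.
Qed.

Lemma L2_itg u : L2 a b u ->
  itg a b (fun x => complex.Re (u x)) /\ itg a b (fun x => complex.Im (u x)).
Proof.
move=> Lu; have [r2 i2] := L2_itg2 Lu.
have h (t : R) : `|t| <= 1 + t ^+ 2.
  have := sqr_ge0 (t - 1); have := sqr_ge0 (t + 1).
  by rewrite ler_norml !expr2; nra.
split.
  by apply: (itg_dom (L2_mRe Lu) (itgD (itg_cst a b 1) r2)) => x _; exact: h.
by apply: (itg_dom (L2_mIm Lu) (itgD (itg_cst a b 1) i2)) => x _; exact: h.
Qed.

Lemma weak_deriv_realB (u v q r : R -> R) :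
  itg a b u -> itg a b v -> itg a b q -> itg a b r ->
  weak_deriv_real a b u q -> weak_deriv_real a b v r ->
  weak_deriv_real a b (fun x => u x - v x) (fun x => q x - r x).
Proof.
move=> Iu Iv Iq Ir uq vr phi tp; have sp := test_smooth tp.
have cp : {within `[a, b], continuous phi} by exact: smooth_within.
have cp' : {within `[a, b], continuous (derive1 phi)}.
  exact/smooth_within/smooth_derive1.
transitivity (rint a b (fun x => u x * derive1 phi x) - rint a b (fun x => v x * derive1 phi x)).
  by rewrite -rintB; [apply: eq_rint => x _; rewrite mulrBl|exact: itgM_cont..].
rewrite uq// vr// -opprD; congr (- _); rewrite -[LHS]/(_ - _) -rintB; [|exact: itgM_cont..].
by apply: eq_rint => x _; rewrite mulrBl.
Qed.

Lemma weak_derivB u v q r : L2 a b u -> L2 a b v -> L2 a b q -> L2 a b r ->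
  weak_deriv a b u q -> weak_deriv a b v r ->
  weak_deriv a b (fun x => u x - v x) (fun x => q x - r x).
Proof.
move=> /L2_itg[ur ui] /L2_itg[vr vi] /L2_itg[qr qi] /L2_itg[rr ri].
move=> /weak_derivP[w1 w2] /weak_derivP[w3 w4]; apply/weak_derivP; split.
  have E (f g : R -> R[i]) : (fun x => complex.Re (f x - g x)) =
    (fun x => complex.Re (f x) - complex.Re (g x)) by apply/funext => x; rewrite ReB.
  by rewrite !E; exact: weak_deriv_realB.
have E (f g : R -> R[i]) : (fun x => complex.Im (f x - g x)) =
  (fun x => complex.Im (f x) - complex.Im (g x)) by apply/funext => x; rewrite ImB.
by rewrite !E; exact: weak_deriv_realB.
Qed.

(** Boundary values of a square-integrable function refer to such a
    representative. *)
Definition continuous_rep v u :=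
  [/\ {within `[a, b], continuous (fun x => complex.Re (v x))},
      {within `[a, b], continuous (fun x => complex.Im (v x))} & ae_eq_on a b v u].

Lemma continuous_rep_bounded v u : continuous_rep v u ->
  exists2 M, 0 <= M & {in `[a, b], forall x, normc (v x) <= M}.
Proof.
move=> [/cont_bounded[M1 H1] /cont_bounded[M2 H2] _].
have ain : a \in `[a, b] by rewrite in_itv/= lexx ltW.
exists (M1 + M2).
  by apply: addr_ge0; [apply: le_trans (H1 _ ain)|apply: le_trans (H2 _ ain)].
by move=> x xab; rewrite (le_trans (normc_le_ReIm _))// lerD ?H1 ?H2.
Qed.

Lemma continuous_rep_L2 v u : continuous_rep v u -> L2 a b v.
Proof.
move=> rv; have [M _ HM] := continuous_rep_bounded rv; case: rv => cr ci _.
apply: (@L2_bounded _ _ _ _ M); [exact: mfun_cont|exact: mfun_cont|].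
by move=> x xI; apply: HM; exact: subset_itv_oo_cc.
Qed.

Let is_derive_cosl l (x : R) : derive1 (fun x => cos (mu l * (x - a))) x =
  - mu l * sin (mu l * (x - a)).
Proof. exact: is_derive1P (is_derive_cos_lin _ _ _). Qed.

Let is_derive_sinl l (x : R) : derive1 (fun x => sin (mu l * (x - a))) x =
  mu l * cos (mu l * (x - a)).
Proof. exact: is_derive1P (is_derive_sin_lin _ _ _). Qed.

(** The boundary terms cancel since both the representative and the basis
    function take equal values at [a] and [b]. *)
Lemma ip_basis_by_parts u v q l : L2 a b u -> L2 a b q -> continuous_rep v u ->
  v a = v b -> weak_deriv a b u q ->
  ip a b q (e_ l) = - mu l * ip a b v (fun x => 'i%C * e_ l x) /\
  ip a b q (fun x => 'i%C * e_ l x) = mu l * ip a b v (e_ l).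
Proof.
move=> Lu Lq rv vab /weak_derivP[wr wi].
have Lv := continuous_rep_L2 rv.
have [cr ci vu] := rv.
have [Iur Iui] := L2_itg Lu; have [Iqr Iqi] := L2_itg Lq.
have vur : {ae lebesgue_measure, forall x : R, x \in `]a, b[ -> complex.Re (v x) = complex.Re (u x)}.
  apply: ae_impl vu.
  by move=> x vux xI; rewrite vux.
have vui : {ae lebesgue_measure, forall x : R, x \in `]a, b[ -> complex.Im (v x) = complex.Im (u x)}.
  apply: ae_impl vu.
  by move=> x vux xI; rewrite vux.
have scos := smooth_cos_lin (mu l) a; have ssin := smooth_sin_lin (mu l) a.
have c1 : cos (mu l * (b - a)) = 1 by rewrite -Re_basis (basis_right hab).
have s0 : sin (mu l * (b - a)) = 0 by rewrite -Im_basis (basis_right hab).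
have BP (p r k : R -> R) : {within `[a, b], continuous p} -> mfun a b r ->
    forall f, itg a b f ->
    {ae lebesgue_measure, forall x : R, x \in `]a, b[ -> p x = r x} ->
    weak_deriv_real a b r f -> smooth k ->
    p b * k b - p a * k a = rint a b (fun x => p x * derive1 k x + f x * k x).
  by move=> cp mr f If pr wf sk; exact: (weak_deriv_by_parts (lexx a) hab (lexx b) cp mr If pr wf sk).
have rc := BP _ _ _ cr (itg_mfun Iur) _ Iqr vur wr scos.
have rs := BP _ _ _ cr (itg_mfun Iur) _ Iqr vur wr ssin.
have ic := BP _ _ _ ci (itg_mfun Iui) _ Iqi vui wi scos.
have is' := BP _ _ _ ci (itg_mfun Iui) _ Iqi vui wi ssin.
rewrite /= subrr !mulr0 cos0 sin0 c1 s0 vab subrr ?subr0 ?mulr0 in rc rs ic is'.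
have Icos f : itg a b f -> itg a b (fun x => f x * cos (mu l * (x - a))).
  by move=> If; apply: itgM_cont => //; exact: smooth_within.
have Isin f : itg a b f -> itg a b (fun x => f x * sin (mu l * (x - a))).
  by move=> If; apply: itgM_cont => //; exact: smooth_within.
have Ivr := itg_cont cr; have Ivi := itg_cont ci.
have X (f k : R -> R) : itg a b f -> itg a b k ->
   rint a b (fun x => f x * derive1 (fun x => cos (mu l * (x - a))) x + k x * cos (mu l * (x - a))) =
   - mu l * rint a b (fun x => f x * sin (mu l * (x - a))) + rint a b (fun x => k x * cos (mu l * (x - a))).
  move=> If Ik; rewrite -rintZ ?Isin// -rintD ?itgZ ?Isin ?Icos//.
  by apply: eq_rint => x _; rewrite is_derive_cosl mulrCA.
have Y (f k : R -> R) : itg a b f -> itg a b k ->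
   rint a b (fun x => f x * derive1 (fun x => sin (mu l * (x - a))) x + k x * sin (mu l * (x - a))) =
   mu l * rint a b (fun x => f x * cos (mu l * (x - a))) + rint a b (fun x => k x * sin (mu l * (x - a))).
  move=> If Ik; rewrite -rintZ ?Icos// -rintD ?itgZ ?Isin ?Icos//.
  by apply: eq_rint => x _; rewrite is_derive_sinl mulrCA.
rewrite X// in rc; rewrite Y// in rs; rewrite X// in ic; rewrite Y// in is'.
have E1 w : L2 a b w -> ip a b w (e_ l) =
    rint a b (fun x => complex.Re (w x) * cos (mu l * (x - a))) +
    rint a b (fun x => complex.Im (w x) * sin (mu l * (x - a))).
  move=> /L2_itg[? ?]; rewrite -rintD ?Icos ?Isin//.
  by apply: eq_rint => x _; rewrite Re_basis Im_basis.
have E2 w : L2 a b w -> ip a b w (fun x => 'i%C * e_ l x) =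
    rint a b (fun x => complex.Im (w x) * cos (mu l * (x - a))) -
    rint a b (fun x => complex.Re (w x) * sin (mu l * (x - a))).
  move=> /L2_itg[? ?]; rewrite -rintB ?Icos ?Isin//.
  apply: eq_rint => x _; rewrite (ReM 'i%C) (ImM 'i%C) Rei Imi Re_basis Im_basis; ring.
rewrite !E1// !E2//; move: rc rs ic is'.
move: (rint _ _ _) => A1; move: (rint _ _ _) => A2; move: (rint _ _ _) => A3.
move: (rint _ _ _) => A4; move: (rint _ _ _) => A5; move: (rint _ _ _) => A6.
move: (rint _ _ _) => A7; move: (rint _ _ _) => A8 rc rs ic is'.
by split; lra.
Qed.

Lemma coef_weak_deriv u v q l : L2 a b u -> L2 a b q -> continuous_rep v u ->
  v a = v b -> weak_deriv a b u q -> coef q l = 'i%C * (mu l)%:C * coef u l.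
Proof.
move=> Lu Lq rv vab wd.
have [e1 e2] := ip_basis_by_parts l Lu Lq rv vab wd.
have Lv := continuous_rep_L2 rv.
rewrite -(coef_ae l Lv Lu); last by case: rv.
have := Re_coef a b q l; have := Im_coef a b q l; rewrite e1 e2.
have := Re_coef a b v l; have := Im_coef a b v l.
move: (coef q l) (coef v l) => d c ic rc id rd.
by apply: complex_eqP; rewrite !ReImE ?rd ?id rc ic; ring.
Qed.

(** The zero function is its own periodic continuous representative. *)
Lemma coef_weak_deriv0 q l : L2 a b q -> weak_deriv a b (fun=> 0) q -> coef q l = 0.
Proof.
move=> Lq wd; have L0 : L2 a b (fun=> 0) by exact: L2_cst.
rewrite (@coef_weak_deriv (fun=> 0) (fun=> 0) q l)//; last first.
  by split; [apply: continuous_subspaceT; exact: cst_continuous..|exact/aeW].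
by rewrite coef_cst0 mulr0.
Qed.

(** Two second weak derivatives of one function differ by a weak derivative of
    [0], whatever the intermediate first derivatives are. *)
Lemma weak_jet2_coef_unique u g g' l : weak_jet a b 2 u g -> weak_jet a b 2 u g' ->
  coef (g 2%N) l = coef (g' 2%N) l.
Proof.
move=> [g0 Lg wg] [g0' Lg' wg'].
have L2g := Lg 2%N isT; have L2g' := Lg' 2%N isT.
apply/eqP; rewrite -subr_eq0 -coefB//; apply/eqP.
apply: coef_weak_deriv0; first exact: L2B.
have second (h : nat -> R -> R[i]) : h 0%N = u -> (forall k, (k < 2)%N -> weak_deriv a b (h k) (h k.+1)) ->
    forall phi, test_function a b phi ->
    rint a b (fun x => complex.Re (h 2%N x) * phi x) =
      rint a b (fun x => complex.Re (u x) * derive1 (derive1 phi) x) /\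
    rint a b (fun x => complex.Im (h 2%N x) * phi x) =
      rint a b (fun x => complex.Im (u x) * derive1 (derive1 phi) x).
  move=> h0 wh phi tp; have tp' := test_derive1 tp.
  have /weak_derivP[r1 i1] := wh 0%N isT; have /weak_derivP[r2 i2] := wh 1%N isT.
  rewrite h0 in r1 i1.
  split; first by rewrite r1// -[LHS]opprK -r2.
  by rewrite i1// -[LHS]opprK -i2.
apply/weak_derivP; split => phi tp.
  have [e _] := second g g0 wg phi tp; have [e' _] := second g' g0' wg' phi tp.
  rewrite (eq_rint (g := fun=> 0)) ?rint_cst ?mul0r//; last by move=> x _; rewrite mul0r.
  have cp : {within `[a, b], continuous phi} by exact/smooth_within/test_smooth.
  rewrite (eq_rint (g := fun x => complex.Re (g 2%N x) * phi x - complex.Re (g' 2%N x) * phi x)).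
    rewrite rintB ?e ?e' ?subrr ?oppr0//; apply: itgM_cont => //.
      by have [] := L2_itg L2g.
    by have [] := L2_itg L2g'.
  by move=> x _; rewrite ReB mulrBl.
have [_ e] := second g g0 wg phi tp; have [_ e'] := second g' g0' wg' phi tp.
rewrite (eq_rint (g := fun=> 0)) ?rint_cst ?mul0r//; last by move=> x _; rewrite mul0r.
have cp : {within `[a, b], continuous phi} by exact/smooth_within/test_smooth.
rewrite (eq_rint (g := fun x => complex.Im (g 2%N x) * phi x - complex.Im (g' 2%N x) * phi x)).
  rewrite rintB ?e ?e' ?subrr ?oppr0//; apply: itgM_cont => //.
    by have [] := L2_itg L2g.
  by have [] := L2_itg L2g'.
by move=> x _; rewrite ImB mulrBl.
Qed.

Lemma Hper2_coef u g l : Hper a b 2 u -> weak_jet a b 2 u g ->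
  coef (g 2%N) l = - (mu l ^+ 2)%:C * coef u l.
Proof.
move=> [h jh bc] jg; rewrite (weak_jet2_coef_unique l jg jh).
have [h0 Lh wh] := jh.
have [v0 [r0 i0 ae0 p0]] := bc 0%N isT; have [v1 [r1 i1 ae1 p1]] := bc 1%N isT.
rewrite (@coef_weak_deriv (h 1%N) v1 (h 2%N) l (Lh 1%N isT) (Lh 2%N isT) _ p1 (wh 1%N isT))//.
rewrite (@coef_weak_deriv (h 0%N) v0 (h 1%N) l (Lh 0%N isT) (Lh 1%N isT) _ p0 (wh 0%N isT))//.
transitivity ('i%C ^+ 2 * ((mu l)%:C ^+ 2 * coef u l)); first by rewrite h0; ring.
by rewrite sqr_i rmorphXn mulN1r mulNr.
Qed.

End WeakDerivativeFourier.

(** * Fourier approximation of periodic functions with two derivatives *)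

Section PeriodicH2.
Variables (R : realType) (a b : R).
Hypothesis hab : a < b.
Implicit Types (u v : R -> R[i]) (l : int) (s : seq int) (z : int -> R[i]).
Import Normc.

Local Notation mu := (mu_ a b).
Local Notation e_ := (fourier_basis a b).
Local Notation coef := (fourier_coef a b).
Local Notation trig := (trig a b).

Let ba_gt0 : 0 < b - a. Proof. by rewrite subr_gt0. Qed.

Lemma rep_increment (p r f : R -> R) c d : a <= c -> c < d -> d <= b ->
  {within `[a, b], continuous p} -> itg a b r -> itg a b f ->
  {ae lebesgue_measure, forall x : R, x \in `]a, b[ -> p x = r x} ->
  weak_deriv_real a b r f -> p d - p c = rint c d f.
Proof.
move=> ac cd db cp Ir If pr wf.
have := weak_deriv_by_parts ac cd db cp (itg_mfun Ir) If pr wf (smooth_cst 1).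
rewrite !mulr1 => ->; apply: eq_rint => x _.
rewrite (is_derive1P (is_derive_cst (1 : R) x 1)) mulr0 add0r mulr1.
by [].
Qed.

Lemma norm_rint_le (f : R -> R) c d K : c < d -> itg c d f ->
  {in `]c, d[, forall x, `|f x| <= K} -> `|rint c d f| <= K * (d - c).
Proof.
move=> cd If fK; apply: (le_trans (le_norm_rint If)).
rewrite -(rint_cst _ cd); apply: le_rint => //; [exact: itg_norm|exact: itg_cst].
Qed.

(** The averages of [f] over shrinking intervals to the right of [x] tend to
    [f x]. *)
Lemma norm_le_of_rint (f : R -> R) K x : {within `[a, b], continuous f} ->
  (forall c d, a < c -> c < d -> d < b -> `|rint c d f| <= K * (d - c)) ->
  x \in `]a, b[ -> `|f x| <= K.
Proof.
move=> cf H xI; apply/ler_addgt0Pr => eps eps0.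
have xab : x \in `[a, b] by exact: subset_itv_oo_cc.
have [del del0 Hd] := within_continuous_near cf xab eps0.
have /andP[ax xb] : a < x < b by move: xI; rewrite in_itv.
(* An interval [x, d] inside ]a, b[ on which f varies by at most eps. *)
pose d := x + Num.min (del / 2) ((b - x) / 2).
have m0 : 0 < Num.min (del / 2) ((b - x) / 2) by rewrite lt_min !divr_gt0// subr_gt0.
have xd : x < d by rewrite ltrDl.
have db : d < b.
  apply: (@le_lt_trans _ _ (x + (b - x) / 2)); first by rewrite lerD2l ge_min lexx orbT.
  by lra.
have ddel : d - x < del.
  rewrite addrAC subrr add0r; apply: (@le_lt_trans _ _ (del / 2)).
    by rewrite ge_min lexx.
  by rewrite ltr_pdivrMr// mulr2n mulrDr mulr1 ltrDl.
have Ifxd : itg x d f.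
  apply: itg_cont; apply: continuous_subspaceW cf => y /=.
  by rewrite !in_itv/= => /andP[xy yd]; rewrite (le_trans (ltW ax) xy) (le_trans yd (ltW db)).
have dx0 : 0 < d - x by rewrite subr_gt0.
rewrite -(ler_pM2r dx0) -{1}(gtr0_norm dx0) -normrM -(rint_cst (f x) xd).
have -> : rint x d (fun=> f x) = rint x d f - rint x d (fun y => f y - f x).
  rewrite rintB ?itg_cst//; ring.
apply: (le_trans (ler_normB _ _)); rewrite mulrDl; apply: lerD; first exact: H.
apply: norm_rint_le => //; first by apply: itgB => //; exact: itg_cst.
move=> y; rewrite in_itv/= => /andP[xy yd]; apply: Hd.
  by rewrite in_itv/=; apply/andP; split; lra.
by rewrite gtr0_norm ?subr_gt0//; lra.
Qed.

Lemma trig_subset s t z x : uniq s -> uniq t -> {subset s <= t} ->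
  trig t z x - trig s z x = trig (tail s t) z x.
Proof. by move=> us ut st; rewrite /trig (sum_tail _ us ut st) addrAC subrr add0r. Qed.

(** The constant of [l1_tail] for frequencies larger than [n]. *)
Definition kappa (n : nat) : R := (b - a) * Num.sqrt (4 / n.+1%:R).

Lemma kappa_ge0 n : 0 <= kappa n.
Proof. by rewrite mulr_ge0 ?sqrtr_ge0 ?(ltW ba_gt0). Qed.

Lemma kappa_small C (N : nat) eps : 0 < eps -> exists2 n, (N <= n)%N & C * kappa n <= eps.
Proof.
move=> eps0.
have : C * kappa n @[n --> \oo] --> 0.
  rewrite -[X in _ --> X](mulr0 C); apply: cvgMr.
  rewrite -[X in _ --> X](mulr0 (b - a)); apply: cvgMr.
  rewrite -(@sqrtr0 R); apply: (continuous_cvg _ (@sqrt_continuous R 0)).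
  by rewrite -[X in _ --> X](mulr0 4); apply: cvgMr; exact: cvg_harmonic.
move=> /cvgrPdist_le/(_ _ eps0)[N0 _ H]; exists (maxn N N0); first exact: leq_maxl.
have := H (maxn N N0) (leq_maxr _ _); rewrite /= sub0r normrN.
exact: le_trans (ler_norm _).
Qed.

Lemma le_norm_l l m : (m <= `|l|)%N -> m%:R <= (b - a) * `|mu l|.
Proof.
move=> ml; apply: le_trans (le_norm_mu hab l); rewrite -natr_absz.
by rewrite ler_nat.
Qed.

Lemma is_derive_term (z : R[i]) l (x : R) :
  is_derive x 1 (fun x => complex.Re (z * e_ l x)) (complex.Re ('i%C * (mu l)%:C * z * e_ l x)) /\
  is_derive x 1 (fun x => complex.Im (z * e_ l x)) (complex.Im ('i%C * (mu l)%:C * z * e_ l x)).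
Proof.
have dc := is_derive_cos_lin (mu l) a x; have ds := is_derive_sin_lin (mu l) a x.
split.
  rewrite (_ : (fun x => _) = fun x => complex.Re z * cos (mu l * (x - a)) -
      complex.Im z * sin (mu l * (x - a))).
    apply: (is_derive_eq (is_deriveB (is_deriveZ (complex.Re z) dc) (is_deriveZ (complex.Im z) ds))).
    by have := Re_basis a b l x; have := Im_basis a b l x; move: (e_ l x) => E <- <-; rewrite !ReImE; rewrite /GRing.scale/=; ring.
  by apply/funext => y; have := Re_basis a b l y; have := Im_basis a b l y; move: (e_ l y) => E <- <-; rewrite !ReImE.
rewrite (_ : (fun x => _) = fun x => complex.Re z * sin (mu l * (x - a)) +
    complex.Im z * cos (mu l * (x - a))).
  apply: (is_derive_eq (is_deriveD (is_deriveZ (complex.Re z) ds) (is_deriveZ (complex.Im z) dc))).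
  by have := Re_basis a b l x; have := Im_basis a b l x; move: (e_ l x) => E <- <-; rewrite !ReImE; rewrite /GRing.scale/=; ring.
by apply/funext => y; have := Re_basis a b l y; have := Im_basis a b l y; move: (e_ l y) => E <- <-; rewrite !ReImE.
Qed.

Lemma is_derive_trig s z (x : R) :
  is_derive x 1 (fun x => complex.Re (trig s z x))
    (complex.Re (trig s (fun l => 'i%C * (mu l)%:C * z l) x)) /\
  is_derive x 1 (fun x => complex.Im (trig s z x))
    (complex.Im (trig s (fun l => 'i%C * (mu l)%:C * z l) x)).
Proof.
elim: s => [|l s [IHr IHi]].
  by split; rewrite /trig; under eq_fun do rewrite big_nil; rewrite big_nil; exact: is_derive_cst.
have E w y : trig (l :: s) w y = w l * e_ l y + trig s w y by rewrite /trig big_cons.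
have [Tr Ti] := is_derive_term (z l) l x.
split.
  under eq_fun do rewrite E ReD; rewrite E ReD; exact: is_deriveD Tr IHr.
under eq_fun do rewrite E ImD; rewrite E ImD; exact: is_deriveD Ti IHi.
Qed.

Lemma continuous_trig s z : continuous (fun x => complex.Re (trig s z x)) /\
  continuous (fun x => complex.Im (trig s z x)).
Proof.
split=> x; apply: differentiable_continuous; apply/derivable1_diffP;
  have [D1 D2] := is_derive_trig s z x; [exact: (@ex_derive _ _ _ _ _ _ _ D1)|exact: (@ex_derive _ _ _ _ _ _ _ D2)].
Qed.

Section Representatives.
Variables (u : R -> R[i]) (g : nat -> R -> R[i]) (v0 v1 : R -> R[i]) (K : R).
Hypotheses (ju : weak_jet a b 2 u g)
  (rv0 : continuous_rep a b v0 (g 0%N)) (rv1 : continuous_rep a b v1 (g 1%N))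
  (pv0 : v0 a = v0 b) (pv1 : v1 a = v1 b).
Hypothesis hK : forall s, uniq s -> l2 s (fun l => (mu l ^+ 2)%:C * coef u l) <= K.

Let c := coef u.
Let c1 l := 'i%C * (mu l)%:C * c l.

Lemma rep_L2 k : (k <= 2)%N -> L2 a b (g k). Proof. by case: ju => _ H _; exact: H. Qed.

Let increment cc d : a <= cc -> cc < d -> d <= b ->
  complex.Re (v0 d) - complex.Re (v0 cc) = rint cc d (fun x => complex.Re (v1 x)) /\
  complex.Im (v0 d) - complex.Im (v0 cc) = rint cc d (fun x => complex.Im (v1 x)).
Proof.
move=> ac cd db; have [_ _ wg] := ju.
have /weak_derivP[wr wi] := wg 0%N isT.
have [I0r I0i] := L2_itg (rep_L2 (isT : (0 <= 2)%N)).
have [I1r I1i] := L2_itg (rep_L2 (isT : (1 <= 2)%N)).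
have [cr ci ae0] := rv0; have [cr1 ci1 ae1] := rv1.
have sub : {subset `]cc, d[ <= `]a, b[}.
  move=> x; rewrite !in_itv/= => /andP[cx xd].
  by rewrite (le_lt_trans ac cx) (lt_le_trans xd db).
have Iv1 (f : R -> R) : itg a b f -> mfun cc d f.
  move=> If; apply: itg_mfun; apply: integrableS If => //.
split.
  rewrite (rep_increment ac cd db cr I0r I1r _ wr).
    apply: (rint_ae (Iv1 _ I1r) (Iv1 _ (itg_cont cr1))).
    apply: ae_impl ae1.
    by move=> x E /sub/E ->.
  apply: ae_impl ae0.
  by move=> x E /E ->.
rewrite (rep_increment ac cd db ci I0i I1i _ wi).
  apply: (rint_ae (Iv1 _ I1i) (Iv1 _ (itg_cont ci1))).
  apply: ae_impl ae1.
  by move=> x E /sub/E ->.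
apply: ae_impl ae0.
by move=> x E /E ->.
Qed.

Let subitv cc d : a <= cc -> d <= b -> {subset `]cc, d[ <= `[a, b]}.
Proof.
move=> ac db x; rewrite !in_itv/= => /andP[cx xd].
by rewrite (le_trans ac (ltW cx)) (le_trans (ltW xd) db).
Qed.

Let sub_cont (f : R -> R) cc d : a <= cc -> d <= b -> {within `[a, b], continuous f} ->
  itg cc d f.
Proof.
move=> ac db cf; apply: itg_cont; apply: continuous_subspaceW cf => y /=.
by rewrite !in_itv/= => /andP[xy yd]; rewrite (le_trans ac xy) (le_trans yd db).
Qed.

Lemma rep_lipschitz : exists2 M, 0 <= M &
  {in `]a, b[ &, forall x y, normc (v0 x - v0 y) <= M * `|x - y|}.
Proof.
have [M M0 HM] := continuous_rep_bounded hab rv1; exists (2 * M); first by rewrite mulr_ge0.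
have [cr ci _] := rv1.
have half x y : x \in `]a, b[ -> y \in `]a, b[ -> x < y ->
    normc (v0 y - v0 x) <= 2 * M * `|y - x|.
  rewrite !in_itv/= => /andP[ax xb] /andP[ay yb] xy.
  have [Er Ei] := increment (ltW ax) xy (ltW yb).
  have yx0 : 0 < y - x by rewrite subr_gt0.
  rewrite (le_trans (normc_le_ReIm _))// ReB ImB Er Ei [`|y - x|]gtr0_norm//.
  rewrite (mulrC 2) mulrAC -[X in _ <= X]mulrC mulr_natl mulr2n; apply: lerD;
    apply: norm_rint_le => //; try exact: sub_cont (ltW ax) (ltW yb) _.
    by move=> t /(subitv (ltW ax) (ltW yb))/HM; exact: le_trans (le_Re_normc _).
  by move=> t /(subitv (ltW ax) (ltW yb))/HM; exact: le_trans (le_Im_normc _).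
move=> x y xI yI; have [xy|xy|->] := ltgtP x y.
- by rewrite normcB distrC; exact: half.
- exact: half.
- by rewrite subrr normc0 mulr_ge0// mulr_ge0.
Qed.

Lemma rep_coef0 l : coef v0 l = c l.
Proof.
have [g0 _ _] := ju; rewrite (@coef_ae _ _ _ v0 (g 0%N))//.
- by rewrite g0.
- exact: continuous_rep_L2 rv0.
- exact: rep_L2.
- by case: rv0.
Qed.

Lemma rep_fourier_cvg x : x \in `]a, b[ ->
  normc (trig (freqs n.+1.*2) c x - v0 x) @[n --> \oo] --> 0.
Proof.
move=> xI; have [M M0 lip] := rep_lipschitz.
have := cvg_fourier_lipschitz hab (continuous_rep_L2 hab rv0) M0 lip xI.
have -> : fourier_coef a b v0 = c by apply/funext => l; exact: rep_coef0.
exact.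
Qed.

Lemma rep_tail_l1 n s : uniq s -> (forall l, l \in s -> (n < `|l|)%N) ->
  \sum_(l <- s) normc ((mu l)%:C * c l) <= kappa n * K.
Proof.
move=> us sn; apply: (le_trans (@l1_tail R a b hab s (fun l => (mu l)%:C * c l) n.+1 us (ltn0Sn n) sn)).
rewrite -/(kappa n) ler_wpM2l ?kappa_ge0//.
apply: le_trans (hK us); apply: eq_ler.
by apply: eq_l2 => l _; rewrite rmorphXn/= expr2 mulrA.
Qed.

Let even2 n : ~~ odd n.+1.*2. Proof. by rewrite odd_double. Qed.

Let tail_ge n m l : l \in tail (freqs n.+1.*2) (freqs m) -> (n < `|l|)%N.
Proof. by rewrite mem_filter => /andP[/(notin_freqs (even2 n)) + _]; rewrite doubleK. Qed.

(** The Lipschitz constant of the sum of a tail is at most the sum of the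
    moduli of its coefficients multiplied by [mu]; the tail sums converge
    pointwise to [v0] minus the partial sum. *)
Lemma rep_sub_lipschitz n x y : x \in `]a, b[ -> y \in `]a, b[ ->
  normc ((v0 x - trig (freqs n.+1.*2) c x) - (v0 y - trig (freqs n.+1.*2) c y)) <=
  kappa n * K * `|x - y|.
Proof.
move=> xI yI; apply/ler_addgt0Pr => eps eps0.
have eps2 : 0 < eps / 2 by rewrite divr_gt0.
have /cvgrPdist_lt/(_ _ eps2)[N1 _ H1] := rep_fourier_cvg xI.
have /cvgrPdist_lt/(_ _ eps2)[N2 _ H2] := rep_fourier_cvg yI.
pose m := maxn n (maxn N1 N2).
have mn : (n <= m)%N by rewrite leq_maxl.
have /ltW {}H1 := H1 m (leq_trans (leq_maxl _ _) (leq_maxr _ _)).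
have /ltW {}H2 := H2 m (leq_trans (leq_maxr _ _) (leq_maxr _ _)).
rewrite /= sub0r normrN ger0_norm ?normc_ge0// in H1.
rewrite /= sub0r normrN ger0_norm ?normc_ge0// in H2.
have sub : {subset freqs n.+1.*2 <= freqs m.+1.*2}.
  by apply: freqsS; rewrite ?odd_double// leq_double.
have T y' := trig_subset c y' (freqs_uniq n.+1.*2) (freqs_uniq m.+1.*2) sub.
have -> : v0 x - trig (freqs n.+1.*2) c x - (v0 y - trig (freqs n.+1.*2) c y) =
  (trig (tail (freqs n.+1.*2) (freqs m.+1.*2)) c x - trig (tail (freqs n.+1.*2) (freqs m.+1.*2)) c y)
  + ((trig (freqs m.+1.*2) c y - v0 y) - (trig (freqs m.+1.*2) c x - v0 x)).
  by rewrite -!T; ring.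
apply: (le_trans (le_normcD _ _)); apply: lerD; last first.
  by apply: (le_trans (le_normcB _ _)); lra.
rewrite /trig -sumrB; apply: (le_trans (le_normc_sum _ _)).
apply: (@le_trans _ _ (\sum_(l <- tail (freqs n.+1.*2) (freqs m.+1.*2))
   normc ((mu l)%:C * c l) * `|x - y|)).
  apply: ler_sum => l _; move: (c l) => C; rewrite -mulrBr !normcM normc_real.
  by rewrite [`|mu l| * _]mulrC -mulrA ler_wpM2l ?normc_ge0// normc_basisB.
rewrite -mulr_suml ler_wpM2r//; apply: rep_tail_l1; first exact/tail_uniq/freqs_uniq.
by move=> l; exact: tail_ge.
Qed.

Lemma rep_sup0 n x : x \in `]a, b[ ->
  normc (v0 x - trig (freqs n.+1.*2) c x) <= (b - a) * (kappa n * K).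
Proof.
move=> xI; apply/ler_addgt0Pr => eps eps0.
have /cvgrPdist_lt/(_ _ eps0)[N1 _ H1] := rep_fourier_cvg xI.
pose m := maxn n N1.
have mn : (n <= m)%N by rewrite leq_maxl.
have /ltW {}H1 := H1 m (leq_maxr _ _).
rewrite /= sub0r normrN ger0_norm ?normc_ge0// in H1.
have sub : {subset freqs n.+1.*2 <= freqs m.+1.*2}.
  by apply: freqsS; rewrite ?odd_double// leq_double.
have T := trig_subset c x (freqs_uniq n.+1.*2) (freqs_uniq m.+1.*2) sub.
have -> : v0 x - trig (freqs n.+1.*2) c x =
  trig (tail (freqs n.+1.*2) (freqs m.+1.*2)) c x - (trig (freqs m.+1.*2) c x - v0 x).
  by rewrite -T; ring.
apply: (le_trans (le_normcB _ _)); apply: lerD => //.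
apply: (le_trans (normc_trig_le _ _ _ _ _)).
have ut : uniq (tail (freqs n.+1.*2) (freqs m.+1.*2)) by exact/tail_uniq/freqs_uniq.
apply: le_trans (ler_wpM2l (ltW ba_gt0) (rep_tail_l1 ut (@tail_ge n m.+1.*2))).
rewrite mulr_sumr big_seq [leRHS]big_seq; apply: ler_sum => l /tail_ge ln.
move: (c l) => C; rewrite normcM normc_real mulrA -[leLHS]mul1r ler_wpM2r ?normc_ge0//.
by apply: (@le_norm_l l 1); lia.
Qed.

Let c1E l : c1 l = 'i%C * (mu l)%:C * c l. Proof. by []. Qed.

(** The remainder [v0 - trig] has a small Lipschitz constant and its derivative
    is [v1 - trig], up to integration, so the averages of the latter are small.
    This avoids a second pointwise convergence theorem, for [v1]. *)
Lemma rep_sup1 n x : x \in `]a, b[ ->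
  normc (v1 x - trig (freqs n.+1.*2) c1 x) <= 2 * (kappa n * K).
Proof.
move=> xI; set s := freqs n.+1.*2.
have [cr0 ci0 _] := rv0; have [cr1 ci1 _] := rv1.
have [ctr cti] := continuous_trig s c1.
have cr : {within `[a, b], continuous (fun x => complex.Re (v1 x) - complex.Re (trig s c1 x))}.
  by move=> y; apply: cvgB; [exact: cr1|exact: (continuous_subspaceT ctr)].
have ci : {within `[a, b], continuous (fun x => complex.Im (v1 x) - complex.Im (trig s c1 x))}.
  by move=> y; apply: cvgB; [exact: ci1|exact: (continuous_subspaceT cti)].
have I f y d : a < y -> d < b -> {within `[a, b], continuous f} -> itg y d f.
  by move=> ay db; apply: sub_cont; exact: ltW.
have key y d : a < y -> y < d -> d < b ->
    `|rint y d (fun x => complex.Re (v1 x) - complex.Re (trig s c1 x))| <= kappa n * K * (d - y) /\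
    `|rint y d (fun x => complex.Im (v1 x) - complex.Im (trig s c1 x))| <= kappa n * K * (d - y).
  move=> ay yd db; have [Er Ei] := increment (ltW ay) yd (ltW db).
  have yI : y \in `]a, b[ by rewrite in_itv/= ay (lt_trans yd db).
  have dI : d \in `]a, b[ by rewrite in_itv/= db (lt_trans ay yd).
  have dy0 : 0 < d - y by rewrite subr_gt0.
  have := rep_sub_lipschitz n dI yI; rewrite -/s [`|d - y|]gtr0_norm// => H.
  have [Dr Di] : (forall x : R, is_derive x 1 (fun x => complex.Re (trig s c x)) (complex.Re (trig s c1 x))) /\
     (forall x : R, is_derive x 1 (fun x => complex.Im (trig s c x)) (complex.Im (trig s c1 x))).
    by split=> t; have [] := is_derive_trig s c t.
  rewrite !rintB ?(I _ _ _ ay db)//; try exact: continuous_subspaceT.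
  rewrite (rint_FTC yd Dr ctr) (rint_FTC yd Di cti) -Er -Ei; split.
    apply: le_trans H; apply: le_trans (le_Re_normc _).
    by rewrite !ReB; apply: eq_ler; congr (`|_|); ring.
  apply: le_trans H; apply: le_trans (le_Im_normc _).
  by rewrite !ImB; apply: eq_ler; congr (`|_|); ring.
rewrite (le_trans (normc_le_ReIm _))// ReB ImB mulr_natl mulr2n; apply: lerD.
  by apply: (norm_le_of_rint cr _ xI) => y d ay yd db; have [] := key y d ay yd db.
by apply: (norm_le_of_rint ci _ xI) => y d ay yd db; have [] := key y d ay yd db.
Qed.

(** Partial sums over larger sets of frequencies are arbitrarily close to [w],
    and the difference of two partial sums is controlled by its coefficients. *)
Lemma nrm_sub_partial w z N K' : L2 a b w -> ~~ odd N ->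
  (forall eps, 0 < eps -> exists2 n, (N <= n.+1.*2)%N &
     nrm a b (fun x => w x - trig (freqs n.+1.*2) z x) <= eps) ->
  (forall s, uniq s -> (forall l, l \in s -> (N./2 <= `|l|)%N) -> l2 s z <= K') ->
  nrm a b (fun x => w x - trig (freqs N) z x) <= Num.sqrt (b - a) * K'.
Proof.
move=> Lw oN H HK; apply/ler_addgt0Pr => eps eps0.
have [n Nn Hn] := H eps eps0.
have sub : {subset freqs N <= freqs n.+1.*2} by apply: freqsS.
have := nrm_triangle Lw (L2_trig a b (freqs n.+1.*2) z) (L2_trig a b (freqs N) z).
move=> /le_trans; apply.
rewrite addrC; apply: lerD => //.
have ut : uniq (tail (freqs N) (freqs n.+1.*2)) by exact/tail_uniq/freqs_uniq.
rewrite (_ : (fun x => _) = trig (tail (freqs N) (freqs n.+1.*2)) z); last first.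
  by apply/funext => x; rewrite trig_subset ?freqs_uniq.
rewrite nrm_trig// ler_wpM2l ?sqrtr_ge0//; apply: HK => // l.
by rewrite mem_filter => /andP[/(notin_freqs oN)].
Qed.

(** Outside of the frequencies of the mesh, [`|mu l|] is at least half of the
    inverse of the mesh size. *)
Lemma one_le_mu N l : (0 < N)%N -> ~~ odd N -> (N./2 <= `|l|)%N ->
  1 <= 2 * ((b - a) / N%:R) * `|mu l|.
Proof.
move=> N0 oN Nl; have := le_norm_l Nl => H.
have N0' : 0 < N%:R :> R by rewrite ltr0n.
have -> : 2 * ((b - a) / N%:R) * `|mu l| = (b - a) * `|mu l| / (N%:R / 2).
  by field; rewrite gt_eqF.
rewrite ler_pdivlMr ?divr_gt0// mul1r; apply: le_trans H.
by rewrite -{1}(even_halfK oN) -mul2n natrM mulrAC divff ?mul1r.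
Qed.

Lemma rep_nrm0 N : (0 < N)%N -> ~~ odd N ->
  nrm a b (fun x => u x - trig (freqs N) c x) <=
  Num.sqrt (b - a) * (4 * ((b - a) / N%:R) ^+ 2 * K).
Proof.
move=> N0 oN; have [g0 _ _] := ju.
have Lu : L2 a b u by rewrite -g0; exact: (@rep_L2 0%N isT).
apply: nrm_sub_partial => //.
  move=> eps eps0.
  have [n Nn Hn] := kappa_small ((b - a) * K * Num.sqrt (b - a)) N eps0.
  exists n; first by lia.
  have Lv := continuous_rep_L2 hab rv0.
  rewrite (@nrm_ae _ _ _ _ (fun x => v0 x - trig (freqs n.+1.*2) c x)).
  - apply: le_trans Hn.
    have Lvt := L2B Lv (L2_trig a b (freqs n.+1.*2) c).
    have /le_trans := nrm_le_sup hab Lvt (fun x => rep_sup0 n (x := x)); apply.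
    by apply: eq_ler; ring.
  - exact: L2B Lu (L2_trig a b _ _).
  - exact: L2B Lv (L2_trig a b _ _).
  - have [_ _ ae0] := rv0; rewrite g0 in ae0.
    apply: ae_impl ae0.
    by move=> x E /E ->.
move=> s us sN; apply: le_trans (ler_wpM2l _ (hK us)); last by rewrite mulr_ge0 ?sqr_ge0.
have E : 4 * ((b - a) / N%:R) ^+ 2 = (2 * ((b - a) / N%:R)) ^+ 2 by ring.
have h0 : 0 <= 2 * ((b - a) / N%:R) by rewrite mulr_ge0// divr_ge0// ltW.
have q0 : 0 <= 4 * ((b - a) / N%:R) ^+ 2 by rewrite mulr_ge0 ?sqr_ge0.
rewrite -[X in X * _](ger0_norm q0) -normc_real -l2Z; apply: le_l2 => l ls; rewrite -/(c l); move: (c l) => C.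
rewrite !normcM !normc_real E (ger0_norm (sqr_ge0 (2 * ((b - a) / N%:R)))) mulrA -[leLHS]mul1r ler_wpM2r ?normc_ge0//.
rewrite normrX -exprMn exprn_ege1//.
exact: (one_le_mu N0 oN (sN _ ls)).
Qed.

Lemma rep_nrm1 N : (0 < N)%N -> ~~ odd N ->
  nrm a b (fun x => g 1%N x - trig (freqs N) c1 x) <=
  Num.sqrt (b - a) * (2 * ((b - a) / N%:R) * K).
Proof.
move=> N0 oN; have Lu := @rep_L2 1%N isT.
apply: nrm_sub_partial => //.
  move=> eps eps0.
  have [n Nn Hn] := kappa_small (2 * K * Num.sqrt (b - a)) N eps0.
  exists n; first by lia.
  have Lv := continuous_rep_L2 hab rv1.
  rewrite (@nrm_ae _ _ _ _ (fun x => v1 x - trig (freqs n.+1.*2) c1 x)).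
  - apply: le_trans Hn.
    have Lvt := L2B Lv (L2_trig a b (freqs n.+1.*2) c1).
    have /le_trans := nrm_le_sup hab Lvt (fun x => rep_sup1 n (x := x)); apply.
    by apply: eq_ler; ring.
  - exact: L2B Lu (L2_trig a b _ _).
  - exact: L2B Lv (L2_trig a b _ _).
  - have [_ _ ae0] := rv1.
    apply: ae_impl ae0.
    by move=> x E /E ->.
have h0 : 0 <= 2 * ((b - a) / N%:R) by rewrite mulr_ge0// divr_ge0// ltW.
move=> s us sN; apply: le_trans (ler_wpM2l h0 (hK us)).
rewrite -[X in X * _](ger0_norm h0) -normc_real -l2Z; apply: le_l2 => l ls.
rewrite c1E -/(c l); move: (c l) => C; rewrite !normcM normc_i mul1r !normc_real (ger0_norm h0) normrX mulrA.
rewrite ler_wpM2r ?normc_ge0// expr2 (mulrA _ `|mu l|) -[leLHS]mul1r ler_wpM2r//.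
exact: (one_le_mu N0 oN (sN _ ls)).
Qed.

Lemma rep_bound M : (forall s, uniq s -> \sum_(l <- s) normc (c l) <= M) ->
  {ae lebesgue_measure, forall x : R, x \in `]a, b[ -> normc (u x) <= M}.
Proof.
move=> HM; have [g0 _ _] := ju; have [_ _ ae0] := rv0; rewrite g0 in ae0.
apply: ae_impl ae0.
move=> x E xI; rewrite -(E xI); apply/ler_addgt0Pr => eps eps0.
have [n _ Hn] := kappa_small ((b - a) * K) 0 eps0.
rewrite -[v0 x](subrK (trig (freqs n.+1.*2) c x)) addrC.
apply: (le_trans (le_normcD _ _)); apply: lerD.
  exact: (le_trans (normc_trig_le _ _ _ _ _) (HM _ (freqs_uniq _))).
apply: (le_trans (rep_sup0 n xI)); apply: le_trans Hn.
by apply: eq_ler; ring.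
Qed.

End Representatives.

(** The first bound is where the rate [h ^ 2] in [L^2] comes from, the second
    gives the rate [h] in [H^1], and the third turns summable coefficients into
    a bound in the supremum norm. *)
Lemma Hper2_fourier u K : Hper a b 2 u ->
  (forall s, uniq s -> l2 s (fun l => (mu l ^+ 2)%:C * coef u l) <= K) ->
  [/\ forall N, (0 < N)%N -> ~~ odd N ->
        nrm a b (fun x => u x - trig (freqs N) (coef u) x) <=
        Num.sqrt (b - a) * (4 * ((b - a) / N%:R) ^+ 2 * K),
      exists g1, [/\ L2 a b g1, weak_deriv a b u g1 &
        forall N, (0 < N)%N -> ~~ odd N ->
        nrm a b (fun x => g1 x - trig (freqs N) (fun l => 'i%C * (mu l)%:C * coef u l) x) <=
        Num.sqrt (b - a) * (2 * ((b - a) / N%:R) * K)] &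
      forall M, (forall s, uniq s -> \sum_(l <- s) normc (coef u l) <= M) ->
        {ae lebesgue_measure, forall x : R, x \in `]a, b[ -> normc (u x) <= M}].
Proof.
move=> [g jg bc] HK.
have [v0 [r0 i0 ae0 p0]] := bc 0%N isT; have [v1 [r1 i1 ae1 p1]] := bc 1%N isT.
have rv0 : continuous_rep a b v0 (g 0%N) by [].
have rv1 : continuous_rep a b v1 (g 1%N) by [].
split.
- exact: (rep_nrm0 jg rv0 rv1 HK).
- exists (g 1%N); have [g0 Lg wg] := jg; split; [exact: Lg|by rewrite -g0; exact: wg|].
  exact: (rep_nrm1 jg rv0 rv1 HK).
- move=> M HM; exact: (rep_bound jg rv0 rv1 HK HM).
Qed.

End PeriodicH2.

(** * Sobolev norms *)

Section SobolevNorms.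
Variables (R : realType) (a b : R).
Hypothesis hab : a < b.
Implicit Types (u v w : R -> R[i]) (g : nat -> R -> R[i]) (s : seq int) (z : int -> R[i]).
Import Normc.

Local Notation mu := (mu_ a b).
Local Notation coef := (fourier_coef a b).
Local Notation trig := (trig a b).
Local Notation nrm := (nrm a b).

Lemma weak_deriv_real_classical (f f' : R -> R) : (forall x : R, is_derive x 1 f (f' x)) ->
  continuous f' -> weak_deriv_real a b f f'.
Proof.
move=> Df cf' phi tp; have sp := test_smooth tp.
have cphi := smooth_continuous sp; have cphi' := smooth_continuous (smooth_derive1 sp).
have cf : continuous f.
  move=> x; apply: differentiable_continuous; apply/derivable1_diffP.
  by have D := Df x; exact: ex_derive.
have W (k : R -> R) : continuous k -> {within `[a, b], continuous k}.
  exact: continuous_subspaceT.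
have I1 : itg a b (fun x => f x * derive1 phi x).
  by apply/itg_cont/W => x; apply: cvgM; [exact: cf|exact: cphi'].
have I2 : itg a b (fun x => f' x * phi x).
  by apply/itg_cont/W => x; apply: cvgM; [exact: cf'|exact: cphi].
have [_ [c [d [ac db supp]]]] := tp.
have phia : phi a = 0.
  by apply/eqP; apply: contraT => /supp/andP[ca _]; move: (lt_le_trans ac ca); rewrite ltxx.
have phib : phi b = 0.
  by apply/eqP; apply: contraT => /supp/andP[_ bd]; move: (le_lt_trans bd db); rewrite ltxx.
have D (x : R) : is_derive x 1 (fun x => f x * phi x) (f x * derive1 phi x + f' x * phi x).
  have Dx := Df x; have Dp := smooth_is_derive x sp.
  apply: (is_derive_eq (is_deriveM Dx Dp)).
  by rewrite /GRing.scale/= [phi x * _]mulrC.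
have := rint_FTC hab D.
rewrite phia phib !mulr0 subrr rintD// => H; apply/eqP; rewrite -addr_eq0; apply/eqP/H.
move=> x; apply: cvgD; first by apply: cvgM; [exact: cf|exact: cphi'].
by apply: cvgM; [exact: cf'|exact: cphi].
Qed.

Lemma weak_deriv_trig s z :
  weak_deriv a b (trig s z) (trig s (fun l => 'i%C * (mu l)%:C * z l)).
Proof.
have [cr ci] := continuous_trig a b s (fun l => 'i%C * (mu l)%:C * z l).
apply/weak_derivP; split; apply: weak_deriv_real_classical => //.
  by move=> x; have [] := is_derive_trig a b s z x.
by move=> x; have [] := is_derive_trig a b s z x.
Qed.

Let sqrt_sum m g : (forall k, (k <= m)%N -> L2 a b (g k)) ->
  ((\sum_(k < m.+1) L2norm a b (g k) ^+ 2) `^ 2^-1)%E =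
  (Num.sqrt (\sum_(k < m.+1) nrm (g k) ^+ 2))%:E.
Proof.
move=> Lg; rewrite (eq_bigr (fun k : 'I_m.+1 => (nrm (g k) ^+ 2)%:E)); last first.
  move=> k _; have Lk : L2 a b (g k) by apply: Lg; rewrite -ltnS.
  by rewrite L2normE.
by rewrite sumEFin poweR_EFin -powR12_sqrt// sumr_ge0// => k _; exact: sqr_ge0.
Qed.

Lemma Hnorm_le m u g K : 0 <= K -> weak_jet a b m u g ->
  (forall k, (k <= m)%N -> nrm (g k) <= K) ->
  (Hnorm a b m u <= (m.+1%:R * K)%:E)%E.
Proof.
move=> K0 jg gK; have [_ Lg _] := jg.
apply: (@le_trans _ _ ((\sum_(k < m.+1) L2norm a b (g k) ^+ 2) `^ 2^-1)%E).
  by apply: ereal_inf_lbound; exists g.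
rewrite sqrt_sum// lee_fin -[leRHS]ger0_norm ?mulr_ge0// -sqrtr_sqr ler_wsqrtr//.
apply: (@le_trans _ _ (\sum_(k < m.+1) K ^+ 2)).
  by apply: ler_sum => k _; apply: lerXn2r; rewrite ?nnegrE ?nrm_ge0 ?gK// -ltnS.
rewrite sumr_const card_ord -[K ^+ 2 *+ _]mulr_natl exprMn ler_wpM2r ?sqr_ge0// expr2.
by rewrite ler_peMl// ler1n.
Qed.

Lemma Hnorm_lt m w eps : (Hnorm a b m w < eps%:E)%E ->
  exists2 g, weak_jet a b m w g & forall k, (k <= m)%N -> nrm (g k) <= eps.
Proof.
move=> /ereal_inf_lt[_ [g jg <-]] Hg; exists g => // k km; have [_ Lg _] := jg.
move: Hg; rewrite sqrt_sum// lte_fin => /ltW; apply: le_trans.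
have km' : (k < m.+1)%N by rewrite ltnS.
rewrite -[leLHS]ger0_norm ?nrm_ge0// -sqrtr_sqr ler_wsqrtr//.
by rewrite (bigD1 (Ordinal km'))//= lerDl sumr_ge0// => i _; exact: sqr_ge0.
Qed.

(** The membership of the difference itself in [Hper] is bypassed: the difference
    of the jets of [u] and [v] is a jet of the difference. *)
Lemma Hper2B_coef u v g l : Hper a b 2 u -> Hper a b 2 v ->
  weak_jet a b 2 (u \- v) g ->
  coef (g 2%N) l = - (mu l ^+ 2)%:C * (coef u l - coef v l).
Proof.
move=> hu hv jg; have [gu ju _] := hu; have [gv jv _] := hv.
rewrite (@weak_jet2_coef_unique _ _ _ hab (u \- v) g (fun k x => gu k x - gv k x))//.
  have [_ Lu _] := ju; have [_ Lv _] := jv.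
  have Lu2 := Lu 2%N isT; have Lv2 := Lv 2%N isT.
  by rewrite coefB// (Hper2_coef hab l hu ju) (Hper2_coef hab l hv jv) mulrBr.
have [u0 Lu wu] := ju; have [v0 Lv wv] := jv; split.
- by rewrite u0 v0.
- by move=> k k2; apply: L2B; [exact: Lu|exact: Lv].
- by move=> k k2; apply: weak_derivB; [apply: Lu|apply: Lv|apply: Lu|apply: Lv|exact: wu|exact: wv];
    rewrite ?(ltnW k2).
Qed.

End SobolevNorms.

(** * The exact solution as a path in time *)

Section TimePaths.
Variable (R : realType).
Implicit Types (T t s x y : R) (F D : R -> R).

Lemma cvge0_lt (U : Type) (G : set_system U) {FG : Filter G} (f : U -> \bar R) eps :
  0 < eps -> (f x @[x --> G] --> 0)%E -> \forall x \near G, (f x < eps%:E)%E.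
Proof.
move=> eps0 H; have : nbhs (0%E : \bar R) [set y | (y < eps%:E)%E].
  by apply: open_nbhs_nbhs; split; [exact: open_ereal_lt_ereal|rewrite /= lte_fin].
by move/H.
Qed.

(** Local bounds on a compact interval can be made uniform. *)
Lemma segment_near_bound T (P : R -> R -> Prop) :
  (forall K K' t, K <= K' -> P K t -> P K' t) ->
  (forall t, t \in `[0, T] -> exists K, \forall s \near within `[0, T] (nbhs t), P K s) ->
  exists K, forall t, t \in `[0, T] -> P K t.
Proof.
move=> mono H; have := (@segment_compact R 0 T); rewrite compact_near_coveringP.
move=> /(_ _ (pinfty_nbhs R) (fun K s => s \in `[0, T] -> P K s) _) H'.
have [M [_ HM]] : \forall K \near +oo, `[0, T]%classic `<=` (fun s => s \in `[0, T] -> P K s).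
  apply: H' => t tI; have [K HK] := H t tI.
  exists ([set s | s \in `[0, T] -> P K s], [set K' | K <= K']).
    by split; [exact: HK|exists K; split => [|x /ltW//]; exact: num_real].
  by move=> [s K'] [/= Hs KK'] sI; exact: mono KK' (Hs sI).
by exists (M + 1) => t tI; apply: (HM (M + 1)); rewrite ?ltrDl.
Qed.

(** First-order expansions in place of derivatives treat the end points of the
    time interval and its interior alike. *)
Lemma first_order_path T F D :
  (forall t, t \in `[0, T] -> forall eps, 0 < eps ->
    \forall s \near within `[0, T] (nbhs t), `|F s - F t - (s - t) * D t| <= eps * `|s - t|) ->
  {within `[0, T], continuous F} /\
  (forall t, t \in `]0, T[ -> is_derive t 1 F (D t)).
Proof.
move=> H; split.
  apply/subspace_continuousP => t tI; apply/cvgrPdist_le => eps eps0.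
  have d0 : 0 < 1 + `|D t| by rewrite ltr_wpDr.
  have := H t tI 1 ltr01; rewrite !near_withinE => Ht.
  have B : \forall s \near nbhs t, `|t - s| < eps / (1 + `|D t|).
    by apply/nbhs_ballP; exists (eps / (1 + `|D t|)) => //=; exact: divr_gt0.
  apply: filterS2 Ht B => s Hs Bs sI.
  have {Hs} := Hs sI; rewrite mul1r => Hs; rewrite distrC.
  rewrite -[F s - F t](subrK ((s - t) * D t)); apply: (le_trans (ler_normD _ _)).
  move: Bs; rewrite ltr_pdivlMr// distrC normrM => Bs.
  apply: le_trans (ltW Bs); rewrite mulrDr mulr1; exact: lerD.
move=> t tI; have tI' : t \in `[0, T] by exact: subset_itv_oo_cc.
have L : h^-1 *: (F (h *: 1 + t) - F t) @[h --> 0^'] --> D t.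
  apply/cvgrPdist_le => eps eps0.
  have := H t tI' eps eps0; rewrite !near_withinE => Ht.
  have Ht' : \forall s \near t, `|F s - F t - (s - t) * D t| <= eps * `|s - t|.
    apply: filterS2 Ht (near_in_itvoo tI) => s Hs sI.
    by apply: Hs; exact: subset_itv_oo_cc.
  have c0 : h + t @[h --> (0 : R)] --> t.
    by rewrite -[X in _ --> X]add0r; apply: cvgD; [exact: cvg_id|exact: cvg_cst].
  have N : \forall h \near nbhs (0 : R),
      `|F (h + t) - F t - (h + t - t) * D t| <= eps * `|h + t - t| := c0 _ Ht'.
  suff : \forall h \near nbhs (0 : R), h != 0 -> `|D t - h^-1 *: (F (h *: 1 + t) - F t)| <= eps by [].
  apply: filterS N => h /=; rewrite addrK => N h0.
  rewrite distrC /GRing.scale/= mulr1.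
  have -> : h^-1 * (F (h + t) - F t) - D t = h^-1 * (F (h + t) - F t - h * D t).
    by rewrite [RHS]mulrBr; congr (_ - _); rewrite mulKf.
  by rewrite normrM normfV mulrC ler_pdivrMr ?normr_gt0.
apply: (@DeriveDef _ _ _ _ _ _ _ (cvgP _ L)); exact: cvg_lim L.
Qed.

Lemma mean_value F D s t : s < t -> {within `[s, t], continuous F} ->
  (forall r, r \in `]s, t[ -> is_derive r 1 F (D r)) ->
  exists2 c, c \in `]s, t[ & F t - F s = D c * (t - s).
Proof. by move=> st cF dF; exact: (MVT st dF cF). Qed.

End TimePaths.

Section EvolutionBounds.
Variables (R : realType) (a b : R).
Hypothesis hab : a < b.
Variables (T : R) (psi dpsi : R -> R -> R[i]).
Hypotheses (hT : 0 < T)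
  (psi_H2 : forall t, t \in `[0, T] -> Hper a b 2 (psi t))
  (psi_cont : time_continuous (Hnorm a b 2) T psi)
  (psi_C1 : time_C1_L2 a b T psi dpsi).
Import Normc.

Local Notation mu := (mu_ a b).
Local Notation coef := (fourier_coef a b).
Local Notation nrm := (nrm a b).
Local Notation ip := (ip a b).

Let psi_L2 t : t \in `[0, T] -> L2 a b (psi t). Proof. by case: psi_C1 => H _ _ /H[]. Qed.
Let dpsi_L2 t : t \in `[0, T] -> L2 a b (dpsi t). Proof. by case: psi_C1 => H _ _ /H[]. Qed.

Let B := Num.sqrt (b - a).
Let B_gt0 : 0 < B. Proof. by rewrite sqrtr_gt0 subr_gt0. Qed.

Let bessel_div u s : L2 a b u -> uniq s -> l2 s (coef u) <= nrm u / B.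
Proof. by move=> Lu us; rewrite ler_pdivlMr// mulrC; exact: bessel. Qed.

Let nrm0 : nrm (fun=> 0) = 0.
Proof.
rewrite /nrm /ip (_ : rint _ _ _ = 0) ?sqrtr0// (eq_rint (g := fun=> 0)).
  by rewrite rint_cst ?mul0r.
by move=> x _ /=; rewrite !mul0r addr0.
Qed.

(** Continuity with values in [H^2] gives a bound near each time, and the
    Bessel inequality passes it to the coefficients. *)
Lemma uniform_coef_bound : exists K, forall t, t \in `[0, T] -> forall s, uniq s ->
  l2 s (coef (psi t)) <= K /\ l2 s (fun l => (mu l ^+ 2)%:C * coef (psi t) l) <= K.
Proof.
apply: segment_near_bound.
  move=> K K' t KK' H s us; have [H1 H2] := H s us.
  by rewrite (le_trans H1 KK') (le_trans H2 KK').
move=> t tI; have [h jh _] := psi_H2 tI; have [h0 Lh _] := jh.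
(* The 1 bounds the norm of the difference to [psi t], at nearby times. *)
exists ((1 + nrm (psi t) + nrm (h 2%N)) / B).
have : \forall r \near within `[0, T] (nbhs t), (Hnorm a b 2 (psi r \- psi t)%R < 1%:E)%E.
  exact: (cvge0_lt ltr01 (psi_cont tI)).
rewrite !near_withinE.
apply: filterS => r Hr rI s us; have [g jg gle] := Hnorm_lt (Hr rI).
have [g0 Lg _] := jg.
have Lt := psi_L2 tI; have Lr := psi_L2 rI.
have Lg0 : L2 a b (psi r \- psi t) by rewrite -g0; exact: (Lg 0%N isT).
have n0 : nrm (psi r \- psi t) <= 1 by rewrite -g0; exact: gle.
have n2 := gle 2%N isT; have Lg2 := Lg 2%N isT; have Lh2 := Lh 2%N isT.
have B0 : 0 <= B^-1 by rewrite invr_ge0 ltW.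
split.
  apply: (@le_trans _ _ (l2 s (coef (psi r \- psi t)) + l2 s (coef (psi t)))).
    apply: le_trans (l2D _ _ _); apply: eq_ler.
    by apply: eq_l2 => l _; rewrite coefB// subrK.
  apply: (le_trans (lerD (bessel_div Lg0 us) (bessel_div Lt us))).
  rewrite -mulrDl ler_wpM2r//; have := nrm_ge0 a b (h 2%N).
  by move: n0; move: (nrm _) (nrm _) (nrm _) => x y z; lra.
apply: (@le_trans _ _ (l2 s (coef (g 2%N)) + l2 s (coef (h 2%N)))).
  rewrite -(l2N s (coef (g 2%N))) -(l2N s (coef (h 2%N))).
  apply: le_trans (l2D _ _ _); apply: eq_ler.
  apply: eq_l2 => l _; rewrite (Hper2B_coef hab l (psi_H2 rI) (psi_H2 tI) jg).
  by rewrite (Hper2_coef hab l (psi_H2 tI) jh); ring.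
apply: (le_trans (lerD (bessel_div Lg2 us) (bessel_div Lh2 us))).
rewrite -mulrDl ler_wpM2r//; have := nrm_ge0 a b (psi t).
by move: n2; move: (nrm _) (nrm _) (nrm _) => x y z; lra.
Qed.

Lemma uniform_dpsi_bound : exists K, forall t, t \in `[0, T] -> nrm (dpsi t) <= K.
Proof.
apply: segment_near_bound; first by move=> K K' t KK' /le_trans; exact.
move=> t tI; exists (1 + nrm (dpsi t)).
have [_ dc _] := psi_C1; have : \forall r \near within `[0, T] (nbhs t), (L2norm a b (dpsi r \- dpsi t)%R < 1%:E)%E.
  exact: (cvge0_lt ltr01 (dc t tI)).
rewrite !near_withinE.
apply: filterS => r Hr rI; have Lt := dpsi_L2 tI; have Lr := dpsi_L2 rI.
have := Hr rI; rewrite (L2normE (L2B Lr Lt)) lte_fin => /ltW H.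
have -> : dpsi r = (fun x => (dpsi r x - dpsi t x) + dpsi t x).
  by apply/funext => x; rewrite subrK.
apply: (le_trans (nrmD (L2B Lr Lt) Lt)); exact: lerD.
Qed.

Let first_order t : t \in `[0, T] -> forall eps, 0 < eps ->
  \forall s \near within `[0, T] (nbhs t),
  nrm (fun x => psi s x - psi t x - (s - t)%:C * dpsi t x) <= eps * `|s - t|.
Proof.
move=> tI eps eps0; have [_ _ H] := psi_C1.
have : \forall s \near within `[0, T] t^', (L2norm a b (fun x => ((s - t)^-1)%:C *
    (psi s x - psi t x) - dpsi t x)%R < eps%:E)%E by exact: (cvge0_lt eps0 (H t tI)).
rewrite /dnbhs !near_withinE.
apply: filterS => s Hs sI; have Lt := psi_L2 tI; have Ls := psi_L2 sI; have Ld := dpsi_L2 tI.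
have [->|st] := eqVneq s t.
  rewrite subrr normr0 mulr0 (_ : (fun x => _) = fun=> 0).
    by rewrite nrm0.
  by apply/funext => x; rewrite subrr mul0r subr0.
have st0 : s - t != 0 by rewrite subr_eq0.
have Lq : L2 a b (fun x => ((s - t)^-1)%:C * (psi s x - psi t x) - dpsi t x).
  by apply: L2B => //; apply: L2Z; exact: L2B.
have := Hs st sI; rewrite (L2normE Lq) lte_fin => /ltW Hq.
rewrite (_ : (fun x => _) = fun x => (s - t)%:C *
    (((s - t)^-1)%:C * (psi s x - psi t x) - dpsi t x)).
  by rewrite nrmZ// normc_real mulrC ler_wpM2r.
by apply/funext => x; rewrite [RHS]mulrBr mulrA -rmorphM/= mulfV// mul1r.
Qed.

Lemma ip_path A : L2 a b A ->
  {within `[0, T], continuous (fun t => ip (psi t) A)} /\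
  (forall t, t \in `]0, T[ -> is_derive t 1 (fun t => ip (psi t) A) (ip (dpsi t) A)).
Proof.
move=> LA; apply: first_order_path => t tI eps eps0.
have nA : 0 < 1 + nrm A by rewrite ltr_wpDr// nrm_ge0.
have := first_order tI (divr_gt0 eps0 nA); rewrite !near_withinE.
apply: filterS => s Hs sI; have Lt := psi_L2 tI; have Ls := psi_L2 sI; have Ld := dpsi_L2 tI.
have Lst := L2B Ls Lt; have Lz : L2 a b (fun x => (s - t)%:C * dpsi t x) by exact: L2Z.
rewrite -ipBl// -ipZl// -ipBl//.
apply: (le_trans (ip_cauchy_schwarz (L2B Lst Lz) LA)).
apply: (le_trans (ler_wpM2r (nrm_ge0 a b A) (Hs sI))).
rewrite mulrAC ler_wpM2r// mulrAC ler_pdivrMr// ler_wpM2l ?(ltW eps0)//.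
by rewrite lerDr.
Qed.

(** The mean value theorem applied to the inner product of [psi] with its own
    increment. *)
Lemma psi_lipschitz K : (forall t, t \in `[0, T] -> nrm (dpsi t) <= K) ->
  forall s t, s \in `[0, T] -> t \in `[0, T] ->
  nrm (fun x => psi t x - psi s x) <= K * `|t - s|.
Proof.
move=> HK.
have half s t : s \in `[0, T] -> t \in `[0, T] -> s < t ->
    nrm (fun x => psi t x - psi s x) <= K * (t - s).
  move=> sI tI st; have Lt := psi_L2 tI; have Ls := psi_L2 sI.
  pose A := fun x => psi t x - psi s x; have LA : L2 a b A by exact: L2B.
  have [cF dF] := ip_path LA.
  have sub : {subset `]s, t[ <= `]0, T[}.
    move: sI tI; rewrite !in_itv/= => /andP[s0 _] /andP[_ tT] r.
    by rewrite !in_itv/= => /andP[sr rt]; rewrite (le_lt_trans s0 sr) (lt_le_trans rt tT).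
  have cst : {within `[s, t], continuous (fun t => ip (psi t) A)}.
    apply: continuous_subspaceW cF => r /=; move: sI tI.
    rewrite !in_itv/= => /andP[s0 _] /andP[_ tT] /andP[sr rt].
    by rewrite (le_trans s0 sr) (le_trans rt tT).
  have [c cI E] := mean_value st cst (fun r rI => dF r (sub r rI)).
  have cI' : c \in `[0, T] by apply: subset_itv_oo_cc; exact: sub.
  have [->|nA0] := eqVneq (nrm A) 0.
    by rewrite mulr_ge0 ?subr_ge0 ?(ltW st)//; apply: le_trans (HK s sI); exact: nrm_ge0.
  have nA : 0 < nrm A by rewrite lt_def nA0 nrm_ge0.
  rewrite -(ler_pM2r nA) -expr2 nrm_sqr// {1}/A ipBl// E mulrAC.
  rewrite ler_wpM2r ?subr_ge0 ?(ltW st)//.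
  apply: (le_trans (ler_norm _)); apply: (le_trans (ip_cauchy_schwarz (dpsi_L2 cI') LA)).
  by rewrite ler_wpM2r ?nrm_ge0// HK.
move=> s t sI tI; have [st|ts|->] := ltgtP s t.
- by rewrite gtr0_norm ?subr_gt0//; exact: half.
- by rewrite distrC gtr0_norm ?subr_gt0// nrmBC; exact: half.
- have L := psi_L2 tI; rewrite subrr normr0 mulr0 (_ : (fun x => _) = fun=> 0).
    by rewrite nrm0.
  by apply/funext => x; rewrite subrr.
Qed.

End EvolutionBounds.

(** * Complex-valued paths and variation of constants *)

Section ComplexPaths.
Variable (R : realType).
Implicit Types (f g : R -> R[i]) (x y t r m : R) (s : seq int).
Import Normc.

Definition cis (x : R) : R[i] := cos x +i* sin x.

Lemma normc_cis x : normc (cis x) = 1. Proof. exact: normc_cos_sin. Qed.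

Lemma cisD x y : cis (x + y) = cis x * cis y.
Proof.
apply: complex_eqP; rewrite !ReImE/=; first by rewrite cosD.
by rewrite sinD addrC.
Qed.

Lemma cis0 : cis 0 = 1.
Proof. by rewrite /cis cos0 sin0; apply: complex_eqP. Qed.

Lemma cisNK x (z : R[i]) : cis (- x) * (cis x * z) = z.
Proof. by rewrite mulrA -cisD addNr cis0 mul1r. Qed.

Lemma normc_cisM x (z : R[i]) : normc (cis x * z) = normc z.
Proof. by rewrite normcM normc_cis mul1r. Qed.

Lemma l2_cis s (th : int -> R) (z : int -> R[i]) : l2 s (fun l => cis (th l) * z l) = l2 s z.
Proof. by congr Num.sqrt; apply: eq_bigr => l _; rewrite normc_cisM. Qed.

Lemma normc_cisB1 x : normc (cis x - 1) <= `|x|.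
Proof. by have := normc_sub_cis_le x 0; rewrite -!/(cis _) cis0 subr0. Qed.

Definition cder f t (d : R[i]) :=
  is_derive t 1 (fun r => complex.Re (f r)) (complex.Re d) /\
  is_derive t 1 (fun r => complex.Im (f r)) (complex.Im d).

Definition ccont x y f :=
  {within `[x, y], continuous (fun r => complex.Re (f r))} /\
  {within `[x, y], continuous (fun r => complex.Im (f r))}.

Lemma cder_cst (z : R[i]) t : cder (fun=> z) t 0.
Proof. by split; exact: is_derive_cst. Qed.

Lemma cderD f g t d e : cder f t d -> cder g t e -> cder (fun r => f r + g r) t (d + e).
Proof.
move=> [f1 f2] [g1 g2]; split.
  by under eq_fun do rewrite ReD; rewrite ReD; exact: is_deriveD.
by under eq_fun do rewrite ImD; rewrite ImD; exact: is_deriveD.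
Qed.

Lemma cderM f g t d e : cder f t d -> cder g t e ->
  cder (fun r => f r * g r) t (d * g t + f t * e).
Proof.
move=> [f1 f2] [g1 g2]; split.
  under eq_fun do rewrite ReM.
  apply: (is_derive_eq (is_deriveB (is_deriveM f1 g1) (is_deriveM f2 g2))).
  by rewrite !ReImE /GRing.scale/=; ring.
under eq_fun do rewrite ImM.
apply: (is_derive_eq (is_deriveD (is_deriveM f1 g2) (is_deriveM f2 g1))).
by rewrite !ReImE /GRing.scale/=; ring.
Qed.

Lemma ccont_cst x y (z : R[i]) : ccont x y (fun=> z).
Proof. by split; apply: continuous_subspaceT; exact: cst_continuous. Qed.

Let eq_within x y (F G : R -> R) : F =1 G -> {within `[x, y], continuous F} ->
  {within `[x, y], continuous G}.
Proof. by move=> /funext ->. Qed.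

Lemma ccontD x y f g : ccont x y f -> ccont x y g -> ccont x y (fun r => f r + g r).
Proof.
move=> [f1 f2] [g1 g2]; split.
  apply: (@eq_within _ _ (fun r => complex.Re (f r) + complex.Re (g r))).
    by move=> r; rewrite ReD.
  by move=> r; apply: cvgD; [exact: f1|exact: g1].
apply: (@eq_within _ _ (fun r => complex.Im (f r) + complex.Im (g r))).
  by move=> r; rewrite ImD.
by move=> r; apply: cvgD; [exact: f2|exact: g2].
Qed.

Lemma ccontM x y f g : ccont x y f -> ccont x y g -> ccont x y (fun r => f r * g r).
Proof.
move=> [f1 f2] [g1 g2]; split.
  apply: (@eq_within _ _ (fun r => complex.Re (f r) * complex.Re (g r) -
    complex.Im (f r) * complex.Im (g r))); first by move=> r; rewrite ReM.
  move=> r; apply: cvgB; apply: cvgM; [exact: f1|exact: g1|exact: f2|exact: g2].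
apply: (@eq_within _ _ (fun r => complex.Re (f r) * complex.Im (g r) +
  complex.Im (f r) * complex.Re (g r))); first by move=> r; rewrite ImM.
move=> r; apply: cvgD; apply: cvgM; [exact: f1|exact: g2|exact: f2|exact: g1].
Qed.

Lemma cder_cis m t r : cder (fun r => cis (m * (r - t))) r ('i%C * m%:C * cis (m * (r - t))).
Proof.
split.
  apply: (is_derive_eq (is_derive_cos_lin m t r)).
  by rewrite !ReImE/=; ring.
apply: (is_derive_eq (is_derive_sin_lin m t r)).
by rewrite !ReImE/=; ring.
Qed.

Lemma ccont_cis m t x y : ccont x y (fun r => cis (m * (r - t))).
Proof.
split; first exact/smooth_within/smooth_cos_lin.
exact/smooth_within/smooth_sin_lin.
Qed.

(** The integral of [cis (m * r)] over [0, r]. *)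
Definition int_cis m r : R[i] :=
  if m == 0 then r%:C else (cis (m * r) - 1) / ('i%C * m%:C).

Let im_neq0 m : m != 0 -> 'i%C * m%:C != 0 :> R[i].
Proof. by move=> m0; rewrite mulf_neq0// ?neq0Ci// fmorph_eq0. Qed.

Lemma cder_int_cis m t r : cder (fun r => int_cis m (r - t)) r (cis (m * (r - t))).
Proof.
rewrite /int_cis; have [->|m0] := eqVneq m 0.
  rewrite mul0r cis0; split => /=; last exact: is_derive_cst.
  have := is_deriveB (is_derive_id r 1) (is_derive_cst t r 1).
  by rewrite subr0.
have := cderM (cderD (cder_cis m t r) (cder_cst (-1) r)) (cder_cst ('i%C * m%:C)^-1 r).
by rewrite mulr0 !addr0 mulrAC mulfV ?mul1r ?im_neq0.
Qed.

Lemma ccont_int_cis m t x y : ccont x y (fun r => int_cis m (r - t)).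
Proof.
have [m0|m0] := eqVneq m 0.
  rewrite /int_cis m0 eqxx; split => /=; apply: continuous_subspaceT; last exact: cst_continuous.
  by move=> r; apply: cvgB; [exact: cvg_id|exact: cvg_cst].
have -> : (fun r => int_cis m (r - t)) = (fun r => (cis (m * (r - t)) + - 1) * ('i%C * m%:C)^-1).
  by apply/funext => r; rewrite /int_cis (negPf m0).
by apply: ccontM (ccont_cst _ _ _); apply: ccontD (ccont_cst _ _ _); exact: ccont_cis.
Qed.

(** The mean value theorem fails for vectors; it is applied to the inner product
    of the path with its increment. *)
Lemma vector_mvt s (f d : R -> int -> R[i]) x y K : x < y ->
  (forall l, ccont x y (f^~ l)) ->
  (forall l r, r \in `]x, y[ -> cder (f^~ l) r (d r l)) ->
  (forall r, r \in `]x, y[ -> l2 s (d r) <= K) ->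
  l2 s (fun l => f y l - f x l) <= K * (y - x).
Proof.
move=> xy cf df dK; pose w l := f y l - f x l.
(* The real inner product of the path with its total increment [w]. *)
pose F r := \sum_(l <- s) (complex.Re (w l) * complex.Re (f r l) + complex.Im (w l) * complex.Im (f r l)).
pose D r := \sum_(l <- s) (complex.Re (w l) * complex.Re (d r l) + complex.Im (w l) * complex.Im (d r l)).
have cF : {within `[x, y], continuous F}.
  rewrite /F; elim: s {F D dK} => [|l s IH].
    apply: (@eq_within _ _ (fun=> 0)); first by move=> r; rewrite big_nil.
    by apply: continuous_subspaceT; exact: cst_continuous.
  apply: (@eq_within _ _ (fun r => complex.Re (w l) * complex.Re (f r l) +
      complex.Im (w l) * complex.Im (f r l) + \sum_(l <- s)
      (complex.Re (w l) * complex.Re (f r l) + complex.Im (w l) * complex.Im (f r l)))).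
    by move=> r; rewrite big_cons.
  have [c1 c2] := cf l; move=> r; apply: cvgD; last exact: IH.
  by apply: cvgD; apply: cvgMr; [exact: c1|exact: c2].
have dF r : r \in `]x, y[ -> is_derive r 1 F (D r).
  move=> rI; rewrite /F /D; elim: s {F D dK cF} => [|l s IH].
    by under eq_fun do rewrite big_nil; rewrite big_nil; exact: is_derive_cst.
  under eq_fun do rewrite big_cons; rewrite big_cons; apply: is_deriveD IH.
  have [d1 d2] := df l r rI; apply: is_deriveD; exact: is_deriveZ.
have [c cI E] := mean_value xy cF dF.
have E1 : F y - F x = l2 s w ^+ 2.
  rewrite l2_sqr /F -sumrB; apply: eq_bigr => l _.
  by rewrite normc_sqr /w ReB ImB; ring.
have E2 : `|D c| <= l2 s w * l2 s (d c).
  apply: (@le_trans _ _ (\sum_(l <- s) normc (w l) * normc (d c l))).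
    apply: (le_trans (ler_norm_sum _ _ _)); apply: ler_sum => l _.
    rewrite -ler_sqr ?nnegrE ?mulr_ge0 ?normc_ge0// real_normK ?num_real//.
    rewrite exprMn !normc_sqr -subr_ge0.
    rewrite (_ : _ - _ = (complex.Re (w l) * complex.Im (d c l) -
      complex.Im (w l) * complex.Re (d c l)) ^+ 2) ?sqr_ge0//; ring.
  exact: sum_normcM_le.
have [w0|w0] := eqVneq (l2 s w) 0.
  rewrite -/(l2 s w) w0 mulr_ge0 ?subr_ge0 ?(ltW xy)//.
  exact: le_trans (l2_ge0 _ _) (dK c cI).
have w_gt0 : 0 < l2 s w by rewrite lt_def w0 l2_ge0.
rewrite -(ler_pM2r w_gt0) -expr2 -E1 E mulrAC ler_wpM2r ?subr_ge0 ?(ltW xy)//.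
apply: (le_trans (ler_norm _)); apply: (le_trans E2).
by rewrite mulrC ler_wpM2r ?l2_ge0// dK.
Qed.

(** Variation of constants: in the rotating frame the linear part disappears,
    and freezing the forcing [beta] at the time [t] leaves only its increments. *)
Lemma local_error s (m : int -> R) (c d beta : R -> int -> R[i]) x y t K : x < y ->
  (forall l, ccont x y (c^~ l)) ->
  (forall l r, r \in `]x, y[ -> cder (c^~ l) r (d r l)) ->
  (forall l r, r \in `]x, y[ -> 'i%C * d r l = (m l)%:C * c r l + beta r l) ->
  (forall r, r \in `]x, y[ -> l2 s (fun l => beta r l - beta t l) <= K) ->
  l2 s (fun l => cis (m l * (y - t)) * c y l - cis (m l * (x - t)) * c x l +
    'i%C * beta t l * (int_cis (m l) (y - t) - int_cis (m l) (x - t))) <= K * (y - x).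
Proof.
move=> xy cc dc ode HK.
pose f r l := cis (m l * (r - t)) * c r l + 'i%C * beta t l * int_cis (m l) (r - t).
(* The derivative of [f]: by the equation, the terms in [c] cancel. *)
pose e r l := - 'i%C * (cis (m l * (r - t)) * (beta r l - beta t l)).
have -> : l2 s (fun l => cis (m l * (y - t)) * c y l - cis (m l * (x - t)) * c x l +
    'i%C * beta t l * (int_cis (m l) (y - t) - int_cis (m l) (x - t))) =
  l2 s (fun l => f y l - f x l) by apply: eq_l2 => l _; rewrite /f; ring.
apply: (@vector_mvt s f e) => //.
- move=> l; apply: ccontD; first exact: ccontM (ccont_cis _ _ _ _) (cc l).
  exact: ccontM (ccont_cst _ _ _) (ccont_int_cis _ _ _ _).
- move=> l r rI.
  have := cderD (cderM (cder_cis (m l) t r) (dc l r rI))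
    (cderM (cder_cst ('i%C * beta t l) r) (cder_int_cis (m l) t r)).
  congr cder; rewrite /e.
  have -> : d r l = - 'i%C * ((m l)%:C * c r l + beta r l).
    by rewrite -ode// mulrA mulNr -expr2 sqr_i opprK mul1r.
  by ring.
- move=> r rI; rewrite /e l2Z normcN normc_i mul1r l2_cis; exact: HK.
Qed.

End ComplexPaths.

(** * Lipschitz continuity of the nonlinearity *)

Section Nonlinearity.
Variables (R : realType) (a b : R).
Hypothesis hab : a < b.
Variables (V : R -> R) (beta sigma VM : R).
Hypotheses (mV : mfun a b V) (VM_ge0 : 0 <= VM) (sigma_gt0 : 0 < sigma)
  (V_le : {ae lebesgue_measure, forall x : R, x \in `]a, b[ -> `|V x| <= VM}).
Implicit Types (u v : R -> R[i]) (z w : R[i]) (r s p : R).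
Import Normc.

Local Notation opB := (opB V beta sigma).
Local Notation nrm := (nrm a b).

(** From the convexity bound [exp (- y) >= 1 - y] at [y = p * ln (r / s)] and
    [ln x <= x - 1].  It holds for every positive [p], although [r `^ p] need
    not be Lipschitz near [0]: the factor [s] compensates. *)
Lemma powR_increment p r s : 0 < p -> 0 <= s -> s <= r ->
  (r `^ p - s `^ p) * s <= p * r `^ p * (r - s).
Proof.
move=> p0 s0 sr; have [->|sn0] := eqVneq s 0.
  rewrite mulr0 !mulr_ge0 ?powR_ge0 ?(ltW p0)// subr_ge0.
  by apply: le_trans sr.
have s_gt0 : 0 < s by rewrite lt_def sn0.
have r_gt0 : 0 < r by exact: lt_le_trans sr.
have ln_le : ln r - ln s <= r / s - 1.
  rewrite -ln_div ?posrE// -{1}[r / s](subrK 1) addrC le_ln1Dx//.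
  by rewrite ltrBrDl subrr divr_gt0.
have E : s `^ p = r `^ p * expR (- (p * (ln r - ln s))).
  by rewrite /powR !gt_eqF// -expRD; congr expR; ring.
have H : 1 - p * (r / s - 1) <= expR (- (p * (ln r - ln s))).
  apply: le_trans (expR_ge1Dx _); rewrite lerD2l lerN2.
  by rewrite ler_wpM2l// ltW.
have rp : 0 <= r `^ p by exact: powR_ge0.
have -> : p * r `^ p * (r - s) = r `^ p * (p * (r / s - 1)) * s by field.
rewrite ler_wpM2r// E -{1}[r `^ p]mulr1 -mulrBr ler_wpM2l//.
by move: H; lra.
Qed.

Let f z := nonlin_f beta sigma (normc z ^+ 2).

Lemma nonlin_fE z : f z = beta * normc z `^ (2 * sigma).
Proof. by rewrite /f /nonlin_f powRrM powR_mulrn ?normc_ge0. Qed.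

(** A Lipschitz constant of the nonlinearity on functions bounded by [M]. *)
Definition lip (M : R) := VM + `|beta| * ((2 * sigma + 1) * M `^ (2 * sigma)).

(** The difference is split so that the factor in front of the increment of the
    power is the smaller of the two moduli. *)
Lemma nonlin_lipschitz M z w : normc z <= M -> normc w <= M ->
  normc ((f z)%:C * z - (f w)%:C * w) <=
  `|beta| * ((2 * sigma + 1) * M `^ (2 * sigma)) * normc (z - w).
Proof.
have p0 : 0 < 2 * sigma by rewrite mulr_gt0.
wlog : z w / normc w <= normc z => [H zM wM|wz zM wM].
  have [/H|/ltW/H] := leP (normc w) (normc z); first exact.
  by move=> H'; rewrite (normcB ((f z)%:C * z)) (normcB z); exact: H'.
rewrite !nonlin_fE; move: (2 * sigma) p0 => p p0; move: (normc_ge0 z) (normc_ge0 w) => z0 w0.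
have M0 : 0 <= M by exact: le_trans zM.
have zp : normc z `^ p <= M `^ p.
  by apply: ge0_ler_powR; rewrite ?nnegrE// ltW.
have zpwp : normc w `^ p <= normc z `^ p.
  by apply: ge0_ler_powR; rewrite ?nnegrE// ltW.
have -> : (beta * normc z `^ p)%:C * z - (beta * normc w `^ p)%:C * w =
    beta%:C * ((normc z `^ p)%:C * (z - w) + (normc z `^ p - normc w `^ p)%:C * w).
  by rewrite !rmorphM rmorphB/=; ring.
rewrite normcM normc_real -mulrA ler_wpM2l// mulrDl mul1r mulrDl addrC.
apply: (le_trans (le_normcD _ _)); apply: lerD; rewrite normcM normc_real ger0_norm.
- apply: (le_trans (powR_increment p0 w0 wz)); rewrite -!mulrA ler_wpM2l ?(ltW p0)//.
  apply: ler_pM; rewrite ?powR_ge0 ?subr_ge0//.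
  by rewrite lerBlDr le_normcBD.
- by rewrite subr_ge0.
- by rewrite ler_wpM2r ?normc_ge0.
- exact: powR_ge0.
Qed.

Let aeF := ae_filter_ringOfSetsType (@lebesgue_measure R).

Lemma lip_ge0 M : 0 <= lip M.
Proof.
rewrite addr_ge0 // !mulr_ge0 ?powR_ge0//.
by rewrite addr_ge0 ?mulr_ge0 ?ltW.
Qed.

Lemma opB_lipschitz_ae M u v :
  {ae lebesgue_measure, forall x : R, x \in `]a, b[ -> normc (u x) <= M} ->
  {ae lebesgue_measure, forall x : R, x \in `]a, b[ -> normc (v x) <= M} ->
  {ae lebesgue_measure, forall x : R, x \in `]a, b[ ->
    normc (opB u x - opB v x) <= lip M * normc (u x - v x)}.
Proof.
move=> uM vM; apply: (@filterS3 _ _ aeF _ _ _ _ _ V_le uM vM) => x Vx ux vx xI.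
have -> : opB u x - opB v x = (V x)%:C * (u x - v x) +
    ((f (u x))%:C * u x - (f (v x))%:C * v x) by rewrite /Defs.opB -!/(f _); ring.
apply: (le_trans (le_normcD _ _)); rewrite /lip mulrDl; apply: lerD.
  by rewrite normcM normc_real ler_wpM2r ?normc_ge0// Vx.
by apply: nonlin_lipschitz; [exact: ux|exact: vx].
Qed.

Lemma opB0 x : opB (fun=> 0) x = 0.
Proof. by rewrite /Defs.opB !mulr0 addr0. Qed.

Lemma L2_dom_ae u v K : mfun a b (fun x => complex.Re (u x)) ->
  mfun a b (fun x => complex.Im (u x)) -> L2 a b v ->
  {ae lebesgue_measure, forall x : R, x \in `]a, b[ -> normc (u x) <= K * normc (v x)} ->
  L2 a b u.
Proof.
move=> mr mi Lv uv; apply/L2P; split=> //; have [_ _ Iv] := (L2P _ _ _).1 Lv.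
pose sq (w : R -> R[i]) x := complex.Re (w x) ^+ 2 + complex.Im (w x) ^+ 2 : R.
have sqE (w : R -> R[i]) x : sq w x = normc (w x) ^+ 2 by rewrite normc_sqr.
have mu_ : mfun a b (sq u) by apply: mfunD; exact: mfunX.
have I : itg a b (fun x => K ^+ 2 * sq v x) by exact: itgZ.
pose g x := Num.min (sq u x) (K ^+ 2 * sq v x).
have Ig : itg a b g.
  apply: (itg_dom _ I); first by apply: measurable_minr => //; exact: itg_mfun.
  move=> x _; rewrite ger0_norm ?ge_min ?lexx ?orbT//.
  by rewrite /g !sqE le_min sqr_ge0 mulr_ge0 ?sqr_ge0.
apply: (itg_ae mu_ Ig).
apply: (@filterS _ _ aeF _ _ _ uv) => x uvx /uvx xle; rewrite /g min_l// !sqE -exprMn.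
by rewrite lerXn2r ?nnegrE ?normc_ge0//; apply: le_trans xle; exact: normc_ge0.
Qed.

Lemma L2_opB M u : L2 a b u ->
  {ae lebesgue_measure, forall x : R, x \in `]a, b[ -> normc (u x) <= M} ->
  L2 a b (opB u).
Proof.
move=> Lu uM; have mr := L2_mRe Lu; have mi := L2_mIm Lu.
have mc : mfun a b (fun x => V x + f (u x)).
  apply: mfunD => //; apply: mfunZ.
  apply: (measurableT_comp (measurable_powR sigma)).
  apply: (eq_measurable_fun (fun x => complex.Re (u x) ^+ 2 + complex.Im (u x) ^+ 2)).
    by move=> x _; rewrite normc_sqr.
  by apply: mfunD; exact: mfunX.
have E x : opB u x = (V x + f (u x))%:C * u x by rewrite /Defs.opB -/(f _) rmorphD mulrDl.
have M0 : {ae lebesgue_measure, forall x : R, x \in `]a, b[ -> normc (0 : R[i]) <= M}.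
  apply: (@filterS _ _ aeF _ _ _ uM) => x + xI => /(_ xI); rewrite normc0.
  exact/le_trans/normc_ge0.
apply: (@L2_dom_ae _ u (lip M)) => //.
- have -> : (fun x => complex.Re (opB u x)) = (fun x => (V x + f (u x)) * complex.Re (u x)).
    by apply/funext => x; rewrite E !ReImE mul0r subr0.
  exact: mfunM.
- have -> : (fun x => complex.Im (opB u x)) = (fun x => (V x + f (u x)) * complex.Im (u x)).
    by apply/funext => x; rewrite E !ReImE mul0r addr0.
  exact: mfunM.
- apply: (@filterS _ _ aeF _ _ _ (opB_lipschitz_ae uM M0)) => x H xI.
  by have := H xI; rewrite opB0 !subr0.
Qed.

Lemma opB_lipschitz M u v : L2 a b u -> L2 a b v ->
  {ae lebesgue_measure, forall x : R, x \in `]a, b[ -> normc (u x) <= M} ->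
  {ae lebesgue_measure, forall x : R, x \in `]a, b[ -> normc (v x) <= M} ->
  nrm (fun x => opB u x - opB v x) <= lip M * nrm (fun x => u x - v x).
Proof.
move=> Lu Lv uM vM; apply: le_nrm_ae; first exact: lip_ge0.
- by apply: L2B; [exact: L2_opB uM|exact: L2_opB vM].
- exact: L2B.
- exact: opB_lipschitz_ae.
Qed.

End Nonlinearity.

(** * The two-step recursion on coefficients *)

(** The sequences [z] and [c] stand for the coefficients of the numerical and of
    the exact solution, [g] and [be] for those of the corresponding
    nonlinearities, and [eta] for the contribution of the frequencies outside
    of [s].  The Lipschitz bounds are assumed only for indices at which the
    numerical solution is known to be bounded by [M1]. *)
Section DiscreteFlow.
Variables (R : realType) (a b : R).
Hypothesis hab : a < b.
Implicit Types (n k : nat) (l : int).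
Import Normc.

Local Notation mu := (mu_ a b).

(** The cancellation of [m] here is what makes the Laplacian of the scheme
    controllable, see [laplacian_bound]. *)
Lemma mul_int_cis (m r : R) : 'i%C * m%:C * int_cis m r = cis (m * r) - 1.
Proof.
rewrite /int_cis; have [->|m0] := eqVneq m 0.
  by rewrite mulr0 !mul0r cis0 subrr.
by rewrite mulrC divfK// mulf_neq0// ?neq0Ci// fmorph_eq0.
Qed.

Lemma normc_int_cis_le (m r : R) : normc (int_cis m r) <= `|r|.
Proof.
have [m0|m0] := eqVneq m 0; first by rewrite /int_cis m0 eqxx normc_real.
have m_gt0 : 0 < `|m| by rewrite normr_gt0.
rewrite -(ler_pM2l m_gt0) -normrM; apply: le_trans (normc_cisB1 (m * r)).
by rewrite -mul_int_cis !normcM normc_i mul1r normc_real.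
Qed.

(** The factor [1 + x], and not [1 + x / 2], per step absorbs the dependence on
    two previous values. *)
Lemma two_step_gronwall (f : nat -> R) (A x d : R) k : 0 <= A -> 0 <= x -> 0 <= d ->
  f 0%N <= A -> ((1 <= k)%N -> f 1%N <= A + d) ->
  (forall n, (n.+2 <= k)%N -> f n.+2 <= f n + x * f n.+1 + d) ->
  forall n, (n <= k)%N -> f n <= (A + n%:R * d) * (1 + x) ^+ n.
Proof.
move=> A0 x0 d0 f0 f1 fS.
have q1 : 1 <= 1 + x by rewrite lerDl.
have q_ge1 n : 1 <= (1 + x) ^+ n by exact: exprn_ege1.
have nd0 n : 0 <= A + n%:R * d by rewrite addr_ge0// mulr_ge0.
suff H n : ((n <= k)%N -> f n <= (A + n%:R * d) * (1 + x) ^+ n) /\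
    ((n.+1 <= k)%N -> f n.+1 <= (A + n.+1%:R * d) * (1 + x) ^+ n.+1).
  by move=> n; have [] := H n.
elim: n => [|n [IH1 IH2]].
  split => [_|k1]; first by rewrite mul0r addr0 expr0 mulr1.
  by apply: (le_trans (f1 k1)); rewrite mul1r expr1 ler_peMr// addr_ge0.
split=> // nk; have nk1 : (n.+1 <= k)%N by exact: ltnW.
have {}IH1 := IH1 (ltnW nk1); have {}IH2 := IH2 nk1.
apply: (le_trans (fS n nk)).
have step1 : f n <= (A + n.+1%:R * d) * (1 + x) ^+ n.+1.
  apply: (le_trans IH1); apply: ler_pM => //; first exact: le_trans ler01 (q_ge1 n).
    by rewrite lerD2l ler_wpM2r// ler_nat.
  by rewrite exprS ler_peMl//; exact: le_trans ler01 (q_ge1 n).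
have step2 : x * f n.+1 <= x * ((A + n.+1%:R * d) * (1 + x) ^+ n.+1) by exact: ler_wpM2l.
have step3 : d <= d * (1 + x) ^+ n.+2 by rewrite ler_peMr.
have -> : (A + n.+2%:R * d) * (1 + x) ^+ n.+2 =
    (A + n.+1%:R * d) * (1 + x) ^+ n.+1 + x * ((A + n.+1%:R * d) * (1 + x) ^+ n.+1)
    + d * (1 + x) ^+ n.+2.
  by rewrite -(natr1 n.+1) exprS; ring.
by apply: lerD step3; exact: lerD.
Qed.

Variables (s : seq int) (T tau K L M1 eta R0 : R) (k : nat).
Variables (z g c be : nat -> int -> R[i]).
Hypotheses (us : uniq s) (T_ge0 : 0 <= T) (tau_gt0 : 0 < tau) (K0 : 0 <= K) (L0 : 0 <= L)
  (M10 : 0 <= M1) (eta0 : 0 <= eta) (R00 : 0 <= R0) (kT : k%:R * tau <= T).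

Let m l := mu l ^+ 2.
Let P1 l := cis (- (m l * tau)) * int_cis (m l) tau.
Let P2 l := cis (- (m l * tau)) * (int_cis (m l) tau - int_cis (m l) (- tau)).
Let ok n := \sum_(l <- s) normc (z n l) <= M1.

Hypotheses
  (z0E : {in s, z 0%N =1 c 0%N})
  (z1E : {in s, forall l, z 1%N l = cis (- (m l * tau)) * z 0%N l - 'i%C * P1 l * g 0%N l})
  (zSE : forall n, {in s, forall l, z n.+2 l =
    cis (- (m l * tau) *+ 2) * z n l - 'i%C * P2 l * g n.+1 l})
  (c1E : (1 <= k)%N -> l2 s (fun l => c 1%N l -
    (cis (- (m l * tau)) * c 0%N l - 'i%C * P1 l * be 0%N l)) <= tau * (R0 * tau))
  (cSE : forall n, (n.+2 <= k)%N -> l2 s (fun l => c n.+2 l -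
    (cis (- (m l * tau) *+ 2) * c n l - 'i%C * P2 l * be n.+1 l)) <= tau * (R0 * tau))
  (cK : forall n, (n <= k)%N -> l2 s (c n) <= K)
  (mcK : forall n, (n <= k)%N -> l2 s (fun l => (m l)%:C * c n l) <= K)
  (be_lip : forall n, (n <= k)%N -> ok n ->
    l2 s (fun l => be n l - g n l) <= L * (l2 s (fun l => c n l - z n l) + eta))
  (g_lip : forall p q, ok p -> ok q ->
    l2 s (fun l => g p l - g q l) <= L * l2 s (fun l => z p l - z q l))
  (g_le : forall n, ok n -> l2 s (g n) <= L * M1).

Let P1_le l : normc (P1 l) <= tau.
Proof. by rewrite normc_cisM (le_trans (normc_int_cis_le _ _))// gtr0_norm. Qed.

Let P2_le l : normc (P2 l) <= 2 * tau.
Proof.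
rewrite normc_cisM (le_trans (le_normcB _ _))// mulr_natl mulr2n.
by apply: lerD; rewrite (le_trans (normc_int_cis_le _ _))// ?normrN gtr0_norm.
Qed.

Let l2_P (P : int -> R[i]) (y : int -> R[i]) p : 0 <= p -> (forall l, normc (P l) <= p) ->
  l2 s (fun l => 'i%C * P l * y l) <= p * l2 s y.
Proof.
move=> p0 PM; rewrite -[X in X * _](ger0_norm p0) -normc_real -l2Z.
apply: le_l2 => l _; rewrite !normcM normc_i mul1r normc_real ger0_norm//.
by rewrite ler_wpM2r ?normc_ge0.
Qed.

Let tau0 : 0 <= tau. Proof. exact: ltW. Qed.
Let tau20 : 0 <= 2 * tau. Proof. by rewrite mulr_ge0. Qed.

Let mul_P1 l : 'i%C * (m l)%:C * P1 l = 1 - cis (- (m l * tau)).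
Proof. by rewrite mulrCA mul_int_cis mulrBr mulr1 -cisD addNr cis0. Qed.

Let mul_P2 l : 'i%C * (m l)%:C * P2 l = 1 - cis (- (m l * tau) *+ 2).
Proof.
rewrite mulrCA mulrBr !mul_int_cis mulrN opprB addrA subrK mulrBr -!cisD addNr cis0.
by rewrite mulr2n.
Qed.

Let growth := expR (2 * L * T).

Let growth_le n : (n <= k)%N -> (1 + 2 * tau * L) ^+ n <= growth.
Proof.
move=> nk; have x0 : 0 <= 2 * tau * L by rewrite mulr_ge0.
apply: (@le_trans _ _ (expR (2 * tau * L) ^+ n)).
  apply: lerXn2r; rewrite ?nnegrE ?addr_ge0 ?expR_ge0//; exact: expR_ge1Dx.
rewrite -expRM_natl /growth ler_expR.
rewrite (_ : n%:R * (2 * tau * L) = 2 * L * (n%:R * tau)); last by ring.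
apply: ler_wpM2l; first by rewrite mulr_ge0.
by apply: le_trans kT; rewrite ler_wpM2r ?(ltW tau_gt0)// ler_nat.
Qed.

Let n_tau n : (n <= k)%N -> n%:R * tau <= T.
Proof. by move=> nk; apply: le_trans kT; rewrite ler_wpM2r ?ler_nat. Qed.

Definition err_bound := T * (2 * L * eta + R0 * tau) * growth.

(** The scheme being explicit, the error at step [n] only involves sup bounds at
    earlier steps. *)
Lemma error_bound j : (j <= k)%N -> (forall n, (n < j)%N -> ok n) ->
  forall n, (n <= j)%N -> l2 s (fun l => c n l - z n l) <= err_bound.
Proof.
move=> jk okj n nj; have nk := leq_trans nj jk.
pose e n := l2 s (fun l => c n l - z n l).
have d0 : 0 <= tau * (2 * L * eta + R0 * tau) by rewrite mulr_ge0// addr_ge0 ?mulr_ge0.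
have x0 : 0 <= 2 * tau * L by rewrite mulr_ge0.
have e0 : e 0%N <= 0.
  rewrite /e (@eq_l2 _ _ s _ (fun=> 0)) => [|l ls]; last by rewrite z0E// subrr.
  by have := l2Z s 0 (c 0%N); rewrite normc0 mul0r => <-; under [leRHS]eq_l2 do rewrite mul0r.
have := @two_step_gronwall e 0 (2 * tau * L) (tau * (2 * L * eta + R0 * tau)) j
  (lexx 0) x0 d0 e0 _ _ n nj.
rewrite add0r => /(_ _ _)/le_trans; apply => //.
- move=> j1; have ok0 := okj 0%N j1.
  have H1 := c1E (leq_trans j1 jk); have H2 := be_lip (leq0n k) ok0.
  rewrite /e (@eq_l2 _ _ s _ (fun l => (c 1%N l - (cis (- (m l * tau)) * c 0%N l -
      'i%C * P1 l * be 0%N l)) - 'i%C * P1 l * (be 0%N l - g 0%N l))) => [|l ls]; last first.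
    by rewrite z1E// z0E//; ring.
  apply: (le_trans (l2B _ _ _)); apply: (le_trans (lerD H1 (l2_P _ tau0 P1_le))).
  have := ler_wpM2l tau0 (le_trans H2 (ler_wpM2l L0 (lerD e0 (lexx eta)))).
  have := mulr_ge0 tau0 (mulr_ge0 L0 eta0); move: (l2 _ _) => X.
  by rewrite add0r; lra.
- move=> p pj; have okp : ok p by exact: okj (ltnW pj).
  have okp1 : ok p.+1 by exact: okj.
  have pk := leq_trans pj jk.
  have H1 := cSE pk; have H2 := be_lip (ltnW pk) okp1.
  rewrite /e (@eq_l2 _ _ s _ (fun l => (c p.+2 l - (cis (- (m l * tau) *+ 2) * c p l -
      'i%C * P2 l * be p.+1 l)) - 'i%C * P2 l * (be p.+1 l - g p.+1 l) +
      cis (- (m l * tau) *+ 2) * (c p l - z p l))) => [|l ls]; last first.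
    by rewrite zSE//; ring.
  apply: (le_trans (l2D _ _ _)); rewrite l2_cis.
  have := le_trans (l2B _ _ _) (lerD H1 (le_trans (l2_P _ tau20 P2_le) (ler_wpM2l tau20 H2))).
  move: (l2 _ _) (l2 _ _) (l2 _ _) => X Y Z; lra.
rewrite add0r /err_bound; apply: ler_pM.
- by rewrite mulr_ge0.
- by rewrite exprn_ge0// addr_ge0.
- by rewrite mulrA ler_wpM2r ?n_tau// addr_ge0 ?mulr_ge0.
- exact: growth_le.
Qed.

Let D0 := K + 3 * (L * M1).

Let mz0 : l2 s (fun l => (m l)%:C * z 0%N l) <= K.
Proof.
by apply: le_trans (mcK (leq0n k)); rewrite (@eq_l2 _ _ s _ (fun l => (m l)%:C * c 0%N l))// => l ls; rewrite z0E.
Qed.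

Let cisB_le l : normc (cis (- (m l * tau)) - 1) <= tau * m l.
Proof.
apply: (le_trans (normc_cisB1 _)); rewrite normrN normrM (ger0_norm (sqr_ge0 _)).
by rewrite (gtr0_norm tau_gt0) mulrC.
Qed.

Let l2_cisB (y : int -> R[i]) : l2 s (fun l => (cis (- (m l * tau)) - 1) * y l) <=
  tau * l2 s (fun l => (m l)%:C * y l).
Proof.
rewrite -[X in X * _](ger0_norm tau0) -normc_real -l2Z; apply: le_l2 => l _.
rewrite !normcM !normc_real mulrA ler_wpM2r ?normc_ge0//.
by rewrite (ger0_norm tau0) (ger0_norm (sqr_ge0 _)).
Qed.

(** Stability: consecutive differences obey the recursion of the error, with no
    source term. *)
Lemma increment_bound j : (j < k)%N -> (forall n, (n <= j)%N -> ok n) ->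
  forall n, (n <= j)%N -> l2 s (fun l => z n.+1 l - z n l) <= tau * D0 * growth.
Proof.
move=> jk okj n nj; have nk : (n <= k)%N by exact: leq_trans nj (ltnW jk).
pose e n := l2 s (fun l => z n.+1 l - z n l).
have LM0 : 0 <= L * M1 by rewrite mulr_ge0.
have A0 : 0 <= tau * D0 by rewrite mulr_ge0// addr_ge0// mulr_ge0.
have x0 : 0 <= 2 * tau * L by rewrite mulr_ge0.
have g0 := ler_wpM2l tau0 (g_le (okj 0%N (leq0n j))).
have e0 : e 0%N <= tau * D0.
  rewrite /e (@eq_l2 _ _ s _ (fun l => (cis (- (m l * tau)) - 1) * z 0%N l -
      'i%C * P1 l * g 0%N l)) => [|l ls]; last by rewrite z1E//; ring.
  apply: (le_trans (l2B _ _ _)).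
  have := lerD (le_trans (l2_cisB (z 0%N)) (ler_wpM2l tau0 mz0)) (l2_P (g 0%N) tau0 P1_le).
  have := mulr_ge0 tau0 LM0.
  by move: g0; rewrite /D0; move: (l2 _ _) (l2 _ _) (l2 _ _) => X Y Z; lra.
have := @two_step_gronwall e (tau * D0) (2 * tau * L) 0 j A0 x0 (lexx 0) e0 _ _ n nj.
rewrite mulr0 addr0 => /(_ _ _)/le_trans; apply => //.
- move=> j1; have g1 := ler_wpM2l tau20 (g_le (okj 1%N j1)).
  rewrite /e (@eq_l2 _ _ s _ (fun l => (cis (- (m l * tau)) * ((cis (- (m l * tau)) - 1) * z 0%N l) -
      'i%C * P2 l * g 1%N l) + 'i%C * P1 l * g 0%N l)) => [|l ls]; last first.
    by rewrite zSE// z1E// mulr2n cisD; ring.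
  apply: (le_trans (l2D _ _ _)); apply: (le_trans (lerD (l2B _ _ _) (l2_P (g 0%N) tau0 P1_le))).
  rewrite l2_cis.
  have := lerD (le_trans (l2_cisB (z 0%N)) (ler_wpM2l tau0 mz0)) (l2_P (g 1%N) tau20 P2_le).
  by move: g0 g1; rewrite /D0; move: (l2 _ _) (l2 _ _) (l2 _ _) (l2 _ _) => X Y Z W; lra.
- move=> p pj; rewrite addr0.
  rewrite /e (@eq_l2 _ _ s _ (fun l => cis (- (m l * tau) *+ 2) * (z p.+1 l - z p l) -
      'i%C * P2 l * (g p.+2 l - g p.+1 l))) => [|l ls]; last first.
    by rewrite (zSE p.+1)// (zSE p)//; ring.
  apply: (le_trans (l2B _ _ _)); rewrite l2_cis lerD2l.
  apply: (le_trans (l2_P _ tau20 P2_le)); rewrite -mulrA ler_wpM2l//.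
  by apply: g_lip; apply: okj => //; exact: ltnW.
rewrite ler_wpM2l//; exact: growth_le.
Qed.

Definition lap_bound := K + 2 * (L * M1) + T * (2 * L * D0 * growth).

(** In [w n l], the Laplacian plus the previous nonlinearity, the terms of size
    [1] produced at each step cancel up to an increment of the nonlinearity. *)
Lemma laplacian_bound j : (j < k)%N -> (forall n, (n <= j)%N -> ok n) ->
  forall n, (n <= j)%N -> l2 s (fun l => (m l)%:C * z n.+1 l) <= lap_bound.
Proof.
move=> jk okj n nj.
pose w n l := (m l)%:C * z n.+1 l + g n l.
have LM0 : 0 <= L * M1 by rewrite mulr_ge0.
have inc := increment_bound jk okj.
pose B := 2 * L * (tau * D0 * growth).
have D00 : 0 <= D0 by rewrite addr_ge0// mulr_ge0.
have gr0 : 0 <= growth by exact: expR_ge0.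
have B0 : 0 <= B by rewrite !mulr_ge0.
have w0E : {in s, forall l, w 0%N l = cis (- (m l * tau)) * ((m l)%:C * z 0%N l + g 0%N l)}.
  move=> l ls; rewrite /w z1E//.
  transitivity ((m l)%:C * (cis (- (m l * tau)) * z 0%N l) -
     ('i%C * (m l)%:C * P1 l) * g 0%N l + g 0%N l); first by ring.
  by rewrite mul_P1; ring.
have wSE p : {in s, forall l, w p.+1 l = cis (- (m l * tau) *+ 2) * ((m l)%:C * z p l + g p.+1 l)}.
  move=> l ls; rewrite /w zSE//.
  transitivity ((m l)%:C * (cis (- (m l * tau) *+ 2) * z p l) -
     ('i%C * (m l)%:C * P2 l) * g p.+1 l + g p.+1 l); first by ring.
  by rewrite mul_P2; ring.
have wle p : ((p <= j)%N -> l2 s (w p) <= K + L * M1 + p%:R * B) /\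
     ((p.+1 <= j)%N -> l2 s (w p.+1) <= K + L * M1 + p.+1%:R * B).
  elim: p => [|p [IH1 IH2]].
    split=> [_|j1].
      rewrite mul0r addr0 (eq_l2 w0E) l2_cis.
      exact: (le_trans (l2D _ _ _) (lerD mz0 (g_le (okj 0%N isT)))).
    rewrite (eq_l2 (wSE 0%N)) l2_cis mul1r.
    apply: (le_trans (l2D _ _ _)); apply: (le_trans (lerD mz0 (g_le (okj 1%N j1)))).
    by rewrite lerDl.
  split=> // pj; have pj1 := ltnW pj; have pj0 := ltnW pj1.
  rewrite (eq_l2 (wSE p.+1)) l2_cis.
  rewrite (@eq_l2 _ _ s _ (fun l => w p l + (g p.+2 l - g p l))); last first.
    by move=> l _; rewrite /w; ring.
  have H := g_lip (okj _ pj) (okj _ pj0).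
  have H' : l2 s (fun l => g p.+2 l - g p l) <= B.
    apply: (le_trans H); rewrite /B (_ : 2 * L * _ = L * (tau * D0 * growth + tau * D0 * growth)); last by ring.
    by rewrite ler_wpM2l//; apply: (le_trans (l2_triangle _ _ _ (z p.+1))); apply: lerD; exact: inc.
  apply: (le_trans (l2D _ _ _)); apply: (le_trans (lerD (IH1 pj0) H')).
  rewrite -addrA lerD2l -[X in _ + X]mul1r -mulrDl ler_wpM2r//.
  by rewrite natr1 ler_nat.
have [/(_ nj) wn _] := wle n.
rewrite (@eq_l2 _ _ s _ (fun l => w n l - g n l)); last by move=> l _; rewrite /w addrK.
apply: (le_trans (l2B _ _ _)); apply: (le_trans (lerD wn (g_le (okj n nj)))).
have nk : (n <= k)%N by exact: leq_trans nj (ltnW jk).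
have : n%:R * B <= T * (2 * L * D0 * growth).
  rewrite /B (_ : n%:R * _ = n%:R * tau * (2 * L * D0 * growth)); last by ring.
  by rewrite ler_wpM2r ?n_tau// !mulr_ge0.
by rewrite /lap_bound; lra.
Qed.

Let lap_bound_ge0 : 0 <= lap_bound.
Proof.
have D00 : 0 <= D0 by rewrite addr_ge0// !mulr_ge0.
by rewrite /lap_bound !addr_ge0// !mulr_ge0// expR_ge0.
Qed.

(** The sup bound at step [n] follows from the bounds in [L^2] and [H^2] at this
    step, which only need sup bounds at earlier steps. *)
Lemma bootstrap : K + 2 * (b - a) * K + 1 <= M1 ->
  err_bound + 2 * (b - a) * Num.sqrt (err_bound * (K + lap_bound)) <= 1 ->
  forall n, (n <= k)%N -> [/\ ok n,
    l2 s (fun l => c n l - z n l) <= err_bound &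
    l2 s (fun l => (m l)%:C * z n l) <= lap_bound].
Proof.
move=> KM small.
have ba0 : 0 <= 2 * (b - a) by rewrite mulr_ge0// subr_ge0 ltW.
have e0 : 0 <= err_bound.
  by rewrite /err_bound !mulr_ge0 ?expR_ge0// addr_ge0 ?mulr_ge0.
have c_le n : (n <= k)%N -> \sum_(l <- s) normc (c n l) <= K + 2 * (b - a) * K.
  move=> nk; apply: (le_trans (l1_le hab _ us)); apply: lerD; first exact: cK.
  rewrite ler_wpM2l// -ler_sqr ?nnegrE ?l2_ge0//; apply: (le_trans (l2_interpolation _ _ _ _)).
  by rewrite expr2 ler_pM ?l2_ge0// ?cK// mcK.
have step n : (n <= k)%N -> (forall p, (p < n)%N -> ok p) -> [/\ ok n,
    l2 s (fun l => c n l - z n l) <= err_bound &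
    l2 s (fun l => (m l)%:C * z n l) <= lap_bound].
  move=> nk okn; have En := error_bound nk okn (leqnn n).
  have Hn : l2 s (fun l => (m l)%:C * z n l) <= lap_bound.
    case: n nk okn {En} => [|n] nk okn.
      apply: (le_trans mz0); rewrite /lap_bound -addrA lerDl addr_ge0 ?mulr_ge0 ?expR_ge0//.
      by rewrite addr_ge0// !mulr_ge0.
    exact: (laplacian_bound nk (fun p pn => okn p pn) (leqnn n)).
  split=> //; rewrite /ok.
  apply: (@le_trans _ _ (\sum_(l <- s) (normc (c n l) + normc (c n l - z n l)))).
    by apply: ler_sum => l _; rewrite -{1}(subKr (c n l) (z n l)) (le_trans (le_normcB _ _)).
  rewrite big_split/=; apply: le_trans KM; apply: lerD; first exact: c_le.
  apply: (le_trans (l1_le hab _ us)); apply: le_trans small; apply: lerD => //.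
  rewrite ler_wpM2l// -ler_sqr ?nnegrE ?l2_ge0 ?sqrtr_ge0// [leRHS]sqr_sqrtr; last first.
    by rewrite mulr_ge0// addr_ge0.
  apply: (le_trans (l2_interpolation _ _ _ _)); rewrite ler_pM ?l2_ge0//.
  rewrite (@eq_l2 _ _ s _ (fun l => (m l)%:C * c n l - (m l)%:C * z n l)); last first.
    by move=> l _; rewrite mulrBr.
  by apply: (le_trans (l2B _ _ _)); rewrite lerD// mcK.
move=> n nk; apply: (step n nk); elim: n nk => [//|n IH] nk p; rewrite ltnS leq_eqVlt.
move=> /orP[/eqP->|pn]; last by apply: IH => //; exact: ltnW.
by have [] := step n (ltnW nk) (IH (ltnW nk)).
Qed.

End DiscreteFlow.

(** * The coefficients of the scheme *)

Section SchemeCoefficients.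
Variables (R : realType) (a b : R).
Hypothesis hab : a < b.
Implicit Types (u w : R -> R[i]) (l : int) (z : int -> R[i]) (m : R).
Import Normc.

Local Notation mu := (mu_ a b).
Local Notation coef := (fourier_coef a b).
Local Notation trig := (trig a b).

Lemma PN_trig N u : PN a b N u = trig (freqs N) (coef u).
Proof.
apply/funext => x.
exact: (esym (sum_freqs N (fun l => coef u l * fourier_basis a b l x))).
Qed.

Lemma mulr_trig (c : R[i]) s z x : c * trig s z x = trig s (fun l => c * z l) x.
Proof. by rewrite mulr_sumr; apply: eq_bigr => l _; rewrite mulrA. Qed.

Lemma multiplier_trig N (p : R -> R[i]) u :
  multiplier a b N p u = trig (freqs N) (fun l => p (- mu l ^+ 2) * coef u l).
Proof.
apply/funext => x; rewrite /multiplier.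
exact: (esym (sum_freqs N (fun l => p (- mu l ^+ 2) * coef u l * fourier_basis a b l x))).
Qed.

Lemma coef_trig_in s z : uniq s -> {in s, coef (trig s z) =1 z}.
Proof. by move=> us l ls; rewrite coef_trig// ls. Qed.

Lemma cexp_cis (x : R) : cexp ('i%C * x%:C) = cis x. Proof. exact: cexp_i. Qed.

Let im_neq0 m : m != 0 -> 'i%C * m%:C != 0 :> R[i].
Proof. by move=> m0; rewrite mulf_neq0// ?neq0Ci// fmorph_eq0. Qed.

(** Identifies the filter of the first step with an integral of the free
    evolution. *)
Lemma phi_1_int_cis m (tau : R) : tau != 0 ->
  tau%:C * phi_1 ('i%C * (tau * - m)%:C) = cis (- (m * tau)) * int_cis m tau.
Proof.
move=> tau0; rewrite /phi_1 /int_cis; have [->|m0] := eqVneq m 0.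
  have -> : 'i%C * (tau * - 0)%:C = 0 :> R[i] by rewrite oppr0 mulr0 mulr0.
  by rewrite eqxx mul0r oppr0 cis0 mulr1 mul1r.
have tm0 : tau * - m != 0 by rewrite mulf_neq0// oppr_eq0.
rewrite (negPf (im_neq0 tm0)) cexp_cis mulrN -mulNr mulrC.
have -> : cis (- (m * tau)) * ((cis (m * tau) - 1) / ('i%C * m%:C)) =
    (1 - cis (- (m * tau))) / ('i%C * m%:C).
  by rewrite mulrA mulrBr mulr1 -cisD addNr cis0.
rewrite mulNr (mulrC tau m).
rewrite (_ : 'i%C * (- (m * tau))%:C = - ('i%C * m%:C * tau%:C)); last by rewrite rmorphN rmorphM/=; ring.
have := im_neq0 m0; move: ('i%C * m%:C) (cis _) => I C I0.
have t0 : tau%:C != 0 :> R[i] by rewrite fmorph_eq0.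
by field; rewrite I0 t0.
Qed.

(** Identifies the filter of the symmetric steps with an integral of the free
    evolution over [[- tau, tau]]. *)
Lemma phi_s_int_cis m (tau : R) : tau != 0 ->
  2 * tau%:C * (phi_s (tau * - m))%:C = int_cis m tau - int_cis m (- tau).
Proof.
move=> tau0; rewrite /int_cis; have [->|m0] := eqVneq m 0.
  by rewrite oppr0 mulr0 phi_s_0 mulr1 rmorphN opprK mulr_natl mulr2n.
rewrite mulrN phi_sN -mulrBl opprB addrA subrK mulrN.
have -> : cis (m * tau) - cis (- (m * tau)) = 2 * 'i%C * (sin (m * tau))%:C.
  by apply: complex_eqP; rewrite !ReImE/= ?cosN ?sinN; ring.
apply: (mulIf (im_neq0 m0)); rewrite divfK ?im_neq0// -mul_phi_s (mulrC tau m) !rmorphM/=; ring.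
Qed.

Variables (V : R -> R) (beta sigma : R) (psi0 : R -> R[i]) (N : nat) (tau : R).
Hypothesis tau0 : tau != 0.

Local Notation psiN := (sEWI_FS a b V beta sigma psi0 N tau).
Local Notation opB := (opB V beta sigma).
Local Notation s := (freqs N).

Let m l := mu l ^+ 2.
Let y0 := coef psi0.
Let y1 l := cis (- (m l * tau)) * coef psi0 l -
  'i%C * (cis (- (m l * tau)) * int_cis (m l) tau) * coef (opB (psiN 0%N)) l.
Let y2 n l := cis (- (m l * tau) *+ 2) * coef (psiN n) l -
  'i%C * (cis (- (m l * tau)) * (int_cis (m l) tau - int_cis (m l) (- tau))) * coef (opB (psiN n.+1)) l.

Let us : uniq s. Proof. exact: freqs_uniq. Qed.

Let scheme0 : psiN 0%N = trig s y0. Proof. exact: PN_trig. Qed.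

Let scheme1 : psiN 1%N = trig s y1.
Proof.
apply/funext => x; rewrite /= /exp_iDelta /phi1_iDelta !multiplier_trig !PN_trig.
rewrite mulr_trig trigB; apply: eq_trig => l ls.
rewrite /y1 !coef_trig_in// cexp_cis -phi_1_int_cis// /m scheme0 /y0.
have -> : - (mu l ^+ 2 * tau) = tau * - mu l ^+ 2 by ring.
ring.
Qed.

Let scheme2 n : psiN n.+2 = trig s (y2 n).
Proof.
apply/funext => x.
transitivity (multiplier a b N (fun d => cexp ('i%C * (2 * tau * d)%:C)) (psiN n) x -
  2 * 'i%C * tau%:C * multiplier a b N (fun d => cexp ('i%C * (tau * d)%:C))
    (multiplier a b N (fun d => (phi_s (tau * d))%:C) (PN a b N (opB (psiN n.+1)))) x).
  by [].
rewrite !multiplier_trig !PN_trig mulr_trig trigB; apply: eq_trig => l ls.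
rewrite !coef_trig_in// !cexp_cis /y2 -phi_s_int_cis// /m.
have -> : 2 * tau * - mu l ^+ 2 = - (mu l ^+ 2 * tau) *+ 2 by rewrite mulr2n; ring.
have -> : - (mu l ^+ 2 * tau) = tau * - mu l ^+ 2 by ring.
ring.
Qed.

Lemma scheme_trig n : psiN n = trig s (coef (psiN n)).
Proof.
suff [y E] : exists y, psiN n = trig s y.
  by rewrite E; apply/funext => x; apply: eq_trig => l ls; rewrite coef_trig_in.
case: n => [|[|n]]; [exists y0; exact: scheme0|exists y1; exact: scheme1|exists (y2 n); exact: scheme2].
Qed.

Lemma coef_scheme0 : {in s, coef (psiN 0%N) =1 coef psi0}.
Proof. by move=> l ls; rewrite scheme0 coef_trig_in. Qed.

Lemma coef_scheme1 : {in s, forall l, coef (psiN 1%N) l =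
  cis (- (m l * tau)) * coef (psiN 0%N) l -
  'i%C * (cis (- (m l * tau)) * int_cis (m l) tau) * coef (opB (psiN 0%N)) l}.
Proof. by move=> l ls; rewrite scheme1 coef_trig_in// coef_scheme0. Qed.

Lemma coef_schemeS n : {in s, forall l, coef (psiN n.+2) l =
  cis (- (m l * tau) *+ 2) * coef (psiN n) l -
  'i%C * (cis (- (m l * tau)) * (int_cis (m l) tau - int_cis (m l) (- tau))) * coef (opB (psiN n.+1)) l}.
Proof. by move=> l ls; rewrite scheme2 coef_trig_in. Qed.

End SchemeCoefficients.

(** * Error estimates *)

Section ErrorEstimates.
Variables (R : realType) (a b : R).
Hypothesis hab : a < b.
Variables (V : R -> R) (VM beta sigma T : R) (psi0 : R -> R[i]) (psi dpsi : R -> R -> R[i]).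
Variables (K Kd : R).
Hypotheses (mV : mfun a b V) (VM_ge0 : 0 <= VM) (sigma_gt0 : 0 < sigma) (T_gt0 : 0 < T)
  (V_le : {ae lebesgue_measure, forall x : R, x \in `]a, b[ -> `|V x| <= VM})
  (psi0_L2 : L2 a b psi0)
  (psi_H2 : forall t, t \in `[0, T] -> Hper a b 2 (psi t))
  (psi_C1 : time_C1_L2 a b T psi dpsi)
  (psi_NLSE : solves_NLSE a b V beta sigma T psi0 psi dpsi).
Hypotheses
  (psi_K : forall t, t \in `[0, T] -> forall s, uniq s ->
    l2 s (fourier_coef a b (psi t)) <= K /\
    l2 s (fun l => (mu_ a b l ^+ 2)%:C * fourier_coef a b (psi t) l) <= K)
  (dpsi_K : forall t, t \in `[0, T] -> nrm a b (dpsi t) <= Kd).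
Implicit Types (s : seq int) (l : int) (t r : R) (n : nat).
Import Normc.

Local Notation mu := (mu_ a b).
Local Notation coef := (fourier_coef a b).
Local Notation trig := (trig a b).
Local Notation nrm := (nrm a b).
Local Notation opB := (opB V beta sigma).

(** A bound for the exact solution, derived from [K], with a margin of [1] for the
    error of the scheme. *)
Definition sup_bound := K + 2 * (b - a) * K + 1.
Local Notation L := (lip beta sigma VM sup_bound).
Let B := Num.sqrt (b - a).

Let ba_gt0 : 0 < b - a. Proof. by rewrite subr_gt0. Qed.
Let B_gt0 : 0 < B. Proof. by rewrite sqrtr_gt0. Qed.
Let T0 : 0 \in `[0, T]. Proof. by rewrite in_itv/= lexx ltW. Qed.
Let K_ge0 : 0 <= K.
Proof. by have [+ _] := psi_K T0 (s := [::]) isT; apply: le_trans; exact: l2_ge0. Qed.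
Let Kd_ge0 : 0 <= Kd.
Proof. by apply: le_trans (dpsi_K T0); exact: nrm_ge0. Qed.
Let L_ge0 : 0 <= L. Proof. exact: lip_ge0. Qed.
Let sup_ge0 : 0 <= sup_bound.
Proof. by rewrite /sup_bound !addr_ge0// !mulr_ge0// ltW. Qed.

Let psi_L2 t : t \in `[0, T] -> L2 a b (psi t). Proof. by case: psi_C1 => H _ _ /H[]. Qed.
Let dpsi_L2 t : t \in `[0, T] -> L2 a b (dpsi t). Proof. by case: psi_C1 => H _ _ /H[]. Qed.

Let bounded (u : R -> R[i]) :=
  {ae lebesgue_measure, forall x : R, x \in `]a, b[ -> normc (u x) <= sup_bound}.

Lemma psi_bounded t : t \in `[0, T] -> bounded (psi t).
Proof.
move=> tI; have [_ _ H] := Hper2_fourier hab (psi_H2 tI) (fun s us => (psi_K tI us).2).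
apply: H => s us; apply: (le_trans (l1_le hab _ us)).
have [H1 H2] := psi_K tI us.
have H3 : l2 s (fun l => (mu l)%:C * coef (psi t) l) <= K.
  rewrite -ler_sqr ?nnegrE ?l2_ge0//; apply: (le_trans (l2_interpolation _ _ _ _)).
  by rewrite expr2 ler_pM ?l2_ge0.
have := ler_wpM2l (mulr_ge0 (ler0n R 2) (ltW ba_gt0)) H3.
by rewrite /sup_bound; move: H1; move: (l2 _ _) (_ * l2 _ _) => X Y; lra.
Qed.

Lemma coef_opB_lipschitz s u v : uniq s -> L2 a b u -> L2 a b v -> bounded u -> bounded v ->
  l2 s (fun l => coef (opB u) l - coef (opB v) l) <= L * nrm (fun x => u x - v x) / B.
Proof.
move=> us Lu Lv bu bv; have LBu := L2_opB beta mV sigma_gt0 V_le Lu bu.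
have LBv := L2_opB beta mV sigma_gt0 V_le Lv bv.
have H := opB_lipschitz beta mV VM_ge0 sigma_gt0 V_le Lu Lv bu bv.
rewrite ler_pdivlMr// mulrC; apply: le_trans H; apply: le_trans (bessel hab (L2B LBu LBv) us).
apply: eq_ler; congr (_ * _).
by apply: eq_l2 => l _; rewrite coefB.
Qed.

Let subitv x y : 0 <= x -> y <= T -> {subset `]x, y[ <= `]0, T[}.
Proof.
move=> x0 yT r; rewrite !in_itv/= => /andP[xr ry].
by rewrite (le_lt_trans x0 xr) (lt_le_trans ry yT).
Qed.

Lemma ccont_coef x y l : 0 <= x -> y <= T -> ccont x y (fun t => coef (psi t) l).
Proof.
move=> x0 yT; have sub : `[x, y]%classic `<=` `[0, T]%classic.
  by move=> r /=; rewrite !in_itv/= => /andP[xr ry]; rewrite (le_trans x0 xr) (le_trans ry yT).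
have [c1 _] := ip_path hab psi_C1 (L2_basis a b l).
have [c2 _] := ip_path hab psi_C1 (L2Z 'i%C (L2_basis a b l)).
split.
  have -> : (fun t => complex.Re (coef (psi t) l)) =
      (fun t => (b - a)^-1 * ip a b (psi t) (fourier_basis a b l)).
    by apply/funext => t; rewrite Re_coef.
  by move=> r; apply: cvgMr; exact: (continuous_subspaceW sub c1).
have -> : (fun t => complex.Im (coef (psi t) l)) =
    (fun t => (b - a)^-1 * ip a b (psi t) (fun x => 'i%C * fourier_basis a b l x)).
  by apply/funext => t; rewrite Im_coef.
by move=> r; apply: cvgMr; exact: (continuous_subspaceW sub c2).
Qed.

Lemma cder_coef l t : t \in `]0, T[ -> cder (fun t => coef (psi t) l) t (coef (dpsi t) l).
Proof.
move=> tI.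
have [_ d1] := ip_path hab psi_C1 (L2_basis a b l).
have [_ d2] := ip_path hab psi_C1 (L2Z 'i%C (L2_basis a b l)).
split.
  have -> : (fun t => complex.Re (coef (psi t) l)) =
      (fun t => (b - a)^-1 * ip a b (psi t) (fourier_basis a b l)).
    by apply/funext => r; rewrite Re_coef.
  by rewrite Re_coef; have D := d1 t tI; exact: is_deriveZ.
have -> : (fun t => complex.Im (coef (psi t) l)) =
    (fun t => (b - a)^-1 * ip a b (psi t) (fun x => 'i%C * fourier_basis a b l x)).
  by apply/funext => r; rewrite Im_coef.
by rewrite Im_coef; have D := d2 t tI; exact: is_deriveZ.
Qed.

(** The equation holds almost everywhere for one jet, and [Hper2_coef] evaluates
    the coefficients of any jet. *)
Lemma coef_NLSE l t : 0 < t <= T ->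
  'i%C * coef (dpsi t) l = (mu l ^+ 2)%:C * coef (psi t) l + coef (opB (psi t)) l.
Proof.
move=> tI; have tI' : t \in `[0, T] by rewrite in_itv/=; case/andP: tI => /ltW -> ->.
have [_ /(_ t tI)[g jg E]] := psi_NLSE; have [_ Lg _] := jg.
have Lg2 := Lg 2%N isT; have Ld := dpsi_L2 tI'.
have LB := L2_opB beta mV sigma_gt0 V_le (psi_L2 tI') (psi_bounded tI').
rewrite -coefZ// (@coef_ae _ _ _ _ (fun x => opB (psi t) x - g 2%N x)).
- by rewrite coefB// (Hper2_coef hab l (psi_H2 tI') jg); ring.
- exact: L2Z.
- exact: L2B.
- apply: ae_impl E.
  by move=> x H xI; rewrite H// addrC.
Qed.

Let R0 := 2 * L * Kd / B.
Let R0_ge0 : 0 <= R0. Proof. by rewrite !mulr_ge0 ?invr_ge0 ?(ltW B_gt0). Qed.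

Let forcing_increment s t r (tau : R) : uniq s -> t \in `[0, T] -> r \in `[0, T] -> `|r - t| <= tau ->
  l2 s (fun l => coef (opB (psi r)) l - coef (opB (psi t)) l) <= L * Kd / B * tau.
Proof.
move=> us tI rI rt.
apply: (le_trans (coef_opB_lipschitz us (psi_L2 rI) (psi_L2 tI) (psi_bounded rI) (psi_bounded tI))).
rewrite [leRHS]mulrAC ler_pM2r ?invr_gt0// -mulrA ler_wpM2l//.
by apply: (le_trans (psi_lipschitz hab psi_C1 dpsi_K tI rI)); rewrite ler_wpM2l.
Qed.

(** A one-sided interval loses nothing: the forcing is only Lipschitz in time, so
    that symmetry would not gain a power of [tau]. *)
Lemma truncation1 s (tau : R) : uniq s -> 0 < tau -> tau <= T ->
  l2 s (fun l => coef (psi tau) l - (cis (- (mu l ^+ 2 * tau)) * coef (psi 0) l -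
    'i%C * (cis (- (mu l ^+ 2 * tau)) * int_cis (mu l ^+ 2) tau) * coef (opB (psi 0)) l))
  <= tau * (R0 * tau).
Proof.
move=> us t0 tT.
have LE := @local_error R s (fun l => mu l ^+ 2) (fun t => coef (psi t)) (fun t => coef (dpsi t))
  (fun t => coef (opB (psi t))) 0 tau 0 (L * Kd / B * tau) t0
  (fun l => ccont_coef l (lexx 0) tT) (fun l r rI => cder_coef l (subitv (lexx 0) tT rI)).
rewrite !subr0 in LE.
apply: le_trans (_ : L * Kd / B * tau * tau <= _); last first.
  rewrite /R0 (_ : tau * _ = 2 * (L * Kd / B * tau * tau)); last by ring.
  by rewrite ler_peMl ?ler1n// !mulr_ge0 ?invr_ge0// ltW.
apply: le_trans (LE _ _).
- apply: eq_ler.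
  rewrite -(l2_cis s (fun l => - (mu l ^+ 2 * tau)) (fun l => cis (mu l ^+ 2 * tau) * _ - _ + _)).
  apply: eq_l2 => l _; rewrite mulr0 cis0 mul1r.
  have -> : int_cis (mu l ^+ 2) 0 = 0.
    by rewrite /int_cis mulr0 cis0 subrr mul0r; case: ifP.
  by rewrite mulrDr mulrBr cisNK; ring.
- move=> l r rI; apply: coef_NLSE; move: rI; rewrite in_itv/= => /andP[-> rt].
  by rewrite (ltW (lt_le_trans rt tT)).
- move=> r rI; apply: forcing_increment => //.
    by apply: subset_itv_oo_cc; exact: subitv rI.
  by move: rI; rewrite in_itv/= subr0 => /andP[r0 /ltW]; rewrite gtr0_norm.
Qed.

Lemma truncationS s t (tau : R) : uniq s -> 0 < tau -> 0 <= t - tau -> t + tau <= T ->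
  l2 s (fun l => coef (psi (t + tau)) l - (cis (- (mu l ^+ 2 * tau) *+ 2) * coef (psi (t - tau)) l -
    'i%C * (cis (- (mu l ^+ 2 * tau)) * (int_cis (mu l ^+ 2) tau - int_cis (mu l ^+ 2) (- tau))) *
    coef (opB (psi t)) l))
  <= tau * (R0 * tau).
Proof.
move=> us t0 x0 yT.
have xy : t - tau < t + tau by rewrite ltrD2l; apply: (@lt_trans _ _ 0); rewrite ?oppr_lt0.
have tI : t \in `[0, T].
  by rewrite in_itv/=; apply/andP; split; move: x0 yT t0; lra.
have LE := @local_error R s (fun l => mu l ^+ 2) (fun t => coef (psi t)) (fun t => coef (dpsi t))
  (fun t => coef (opB (psi t))) (t - tau) (t + tau) t (L * Kd / B * tau) xy
  (fun l => ccont_coef l x0 yT) (fun l r rI => cder_coef l (subitv x0 yT rI)).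
have E1 : t + tau - t = tau by rewrite addrAC subrr add0r.
have E2 : t - tau - t = - tau by rewrite addrAC subrr add0r.
have E3 : t + tau - (t - tau) = 2 * tau by rewrite opprD opprK addrACA subrr add0r mulr_natl mulr2n.
rewrite E1 E2 E3 in LE.
apply: le_trans (_ : L * Kd / B * tau * (2 * tau) <= _); last first.
  by rewrite /R0; apply: eq_ler; ring.
apply: le_trans (LE _ _).
- apply: eq_ler.
  rewrite -(l2_cis s (fun l => - (mu l ^+ 2 * tau)) (fun l => cis (mu l ^+ 2 * tau) * _ - _ + _)).
  apply: eq_l2 => l _; rewrite mulrN mulr2n cisD.
  by rewrite -{1}[coef (psi (t + tau)) l](cisNK (mu l ^+ 2 * tau)); ring.
- move=> l r rI; apply: coef_NLSE; move: (subitv x0 yT rI); rewrite in_itv/= => /andP[-> rt].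
  by rewrite ltW.
- move=> r rI; apply: forcing_increment => //.
    by apply: subset_itv_oo_cc; exact: subitv rI.
  by move: rI; rewrite in_itv/= ler_norml => /andP[h1 h2]; apply/andP; split; move: h1 h2; lra.
Qed.

Definition err_const := T * (8 * L * K + R0) * expR (2 * L * T).
Definition lap_const := lap_bound T K L sup_bound.

Lemma err_const_ge0 : 0 <= err_const.
Proof. by rewrite /err_const !mulr_ge0 ?expR_ge0 ?(ltW T_gt0)// addr_ge0// !mulr_ge0. Qed.

Lemma lap_const_ge0 : 0 <= lap_const.
Proof.
by rewrite /lap_const /lap_bound !addr_ge0// !mulr_ge0 ?expR_ge0 ?(ltW T_gt0)// addr_ge0// !mulr_ge0.
Qed.

Section Scheme.
Variables (tau : R) (N n : nat).
Hypotheses (tau_gt0 : 0 < tau) (N_gt0 : (0 < N)%N) (N_even : ~~ odd N) (n_le : n%:R * tau <= T).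
Let h := (b - a) / N%:R.
Hypothesis small : err_const * (tau + h ^+ 2) +
  2 * (b - a) * Num.sqrt (err_const * (tau + h ^+ 2) * (K + lap_const)) <= 1.

Local Notation psiN := (sEWI_FS a b V beta sigma psi0 N tau).
Let s := freqs N.
Let z k l := coef (psiN k) l.
Let c k l := coef (psi (k%:R * tau)) l.

Let us : uniq s. Proof. exact: freqs_uniq. Qed.
Let tau_neq0 : tau != 0. Proof. by rewrite gt_eqF. Qed.
Let h_ge0 : 0 <= h. Proof. by rewrite divr_ge0// ltW. Qed.
Let psiN_trig k : psiN k = trig s (z k). Proof. exact: scheme_trig. Qed.
Let psiN_L2 k : L2 a b (psiN k). Proof. by rewrite psiN_trig; exact: L2_trig. Qed.

Let psiN_bounded k : \sum_(l <- s) normc (z k l) <= sup_bound -> bounded (psiN k).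
Proof.
move=> H; apply/aeW => x _; rewrite psiN_trig.
exact: le_trans (normc_trig_le _ _ _ _ _) H.
Qed.

Let time_in k : (k <= n)%N -> k%:R * tau \in `[0, T].
Proof.
move=> kn; rewrite in_itv/= mulr_ge0 ?(ltW tau_gt0)//=.
by apply: le_trans n_le; rewrite ler_wpM2r ?(ltW tau_gt0)// ler_nat.
Qed.

Let nrm_err k : (k <= n)%N -> nrm (fun x => psi (k%:R * tau) x - psiN k x) <=
  B * (4 * h ^+ 2 * K + l2 s (fun l => c k l - z k l)).
Proof.
move=> kn; have tI := time_in kn; have Lt := psi_L2 tI.
have [H _ _] := Hper2_fourier hab (psi_H2 tI) (fun s us => (psi_K tI us).2).
apply: (le_trans (nrm_triangle Lt (L2_trig a b s (c k)) (psiN_L2 k))).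
rewrite mulrDr; apply: lerD; first exact: H.
by rewrite psiN_trig nrm_trigB.
Qed.

Lemma scheme_bounds : [/\ l2 s (fun l => c n l - z n l) <= err_const * (tau + h ^+ 2),
  l2 s (z n) <= K + 1 & l2 s (fun l => (mu l ^+ 2)%:C * z n l) <= lap_const].
Proof.
have eta0 : 0 <= 4 * h ^+ 2 * K by rewrite mulr_ge0// mulr_ge0// sqr_ge0.
have E : err_bound T tau L (4 * h ^+ 2 * K) R0 <= err_const * (tau + h ^+ 2).
  rewrite /err_bound /err_const [leRHS]mulrAC ler_wpM2r ?expR_ge0// -[leRHS]mulrA ler_wpM2l ?(ltW T_gt0)//.
  have h1 : 0 <= 8 * L * K * tau by rewrite !mulr_ge0// ltW.
  have h2 : 0 <= R0 * h ^+ 2 by rewrite mulr_ge0 ?sqr_ge0.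
  rewrite -subr_ge0 (_ : _ - _ = 8 * L * K * tau + R0 * h ^+ 2) ?addr_ge0//; ring.
have E0 : 0 <= err_bound T tau L (4 * h ^+ 2 * K) R0.
  rewrite /err_bound mulr_ge0 ?expR_ge0// mulr_ge0 ?(ltW T_gt0)// addr_ge0//.
    by rewrite mulr_ge0// mulr_ge0.
  by rewrite mulr_ge0// ltW.
have smallE : err_bound T tau L (4 * h ^+ 2 * K) R0 + 2 * (b - a) *
    Num.sqrt (err_bound T tau L (4 * h ^+ 2 * K) R0 * (K + lap_const)) <= 1.
  apply: le_trans small; apply: lerD => //; rewrite ler_wpM2l ?mulr_ge0 ?(ltW ba_gt0)//.
  by rewrite ler_wsqrtr// ler_wpM2r// addr_ge0// lap_const_ge0.
have := @bootstrap R a b hab s T tau K L sup_bound (4 * h ^+ 2 * K) R0 n z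
  (fun k l => coef (opB (psiN k)) l) c (fun k l => coef (opB (psi (k%:R * tau))) l)
  us (ltW T_gt0) tau_gt0 K_ge0 L_ge0 sup_ge0 eta0 R0_ge0 n_le.
move=> /(_ _ _ _ _ _ _ _ _ _ _ (lexx _) smallE n (leqnn n)) [].
- move=> l ls; rewrite /z coef_scheme0// /c mul0r.
  have [ae0 _] := psi_NLSE; symmetry; apply: coef_ae ae0 => //; exact: psi_L2.
- by move=> l ls; exact: coef_scheme1.
- by move=> k l ls; exact: coef_schemeS.
- move=> n1; rewrite /c mul1r mul0r; apply: truncation1 => //.
  by have := time_in n1; rewrite mul1r in_itv/= => /andP[].
- move=> k kn; have := @truncationS s (k.+1%:R * tau) tau us tau_gt0.
  have -> : k.+1%:R * tau + tau = k.+2%:R * tau by rewrite -(natr1 k.+1) mulrDl mul1r.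
  have -> : k.+1%:R * tau - tau = k%:R * tau by rewrite -natr1 mulrDl mul1r addrK.
  apply.
    by have := time_in (ltnW (ltnW kn)); rewrite in_itv/= => /andP[].
  by have := time_in kn; rewrite in_itv/= => /andP[].
- by move=> k kn; have [] := psi_K (time_in kn) us.
- by move=> k kn; have [] := psi_K (time_in kn) us.
- move=> k kn ok; have tI := time_in kn.
  apply: (le_trans (coef_opB_lipschitz us (psi_L2 tI) (psiN_L2 k) (psi_bounded tI) (psiN_bounded ok))).
  rewrite ler_pdivrMr// -[leRHS]mulrA ler_wpM2l//; apply: (le_trans (nrm_err kn)).
  by rewrite mulrC addrC.
- move=> p q okp okq.
  apply: (le_trans (coef_opB_lipschitz us (psiN_L2 p) (psiN_L2 q) (psiN_bounded okp) (psiN_bounded okq))).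
  rewrite (psiN_trig p) (psiN_trig q) nrm_trigB// -/B ler_pdivrMr// -[leRHS]mulrA.
  by rewrite ler_wpM2l// mulrC.
- move=> k ok; have L0 := L2_cst a b (0 : R[i]).
  have b0 : bounded (fun=> 0) by apply/aeW => x _; rewrite normc0.
  have := coef_opB_lipschitz us (psiN_L2 k) L0 (psiN_bounded ok) b0.
  have e0 : opB (fun=> 0) = fun=> 0 by apply/funext => x; exact: opB0.
  rewrite e0 (eq_l2 (w := fun l => coef (opB (psiN k)) l)); last first.
    by move=> l _; rewrite coef_cst0 subr0.
  move/le_trans; apply; rewrite ler_pdivrMr// -[leRHS]mulrA ler_wpM2l//.
  have -> : (fun x => psiN k x - 0) = psiN k by apply/funext => x; rewrite subr0.
  apply: (nrm_le_sup hab (psiN_L2 k)) => x _; rewrite psiN_trig.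
  exact: le_trans (normc_trig_le _ _ _ _ _) ok.
move=> ok En Hn; split=> //; first exact: le_trans E.
have E1 : err_bound T tau L (4 * h ^+ 2 * K) R0 <= 1.
  by apply: le_trans smallE; rewrite lerDl !mulr_ge0 ?sqrtr_ge0// ltW.
rewrite (@eq_l2 _ _ s _ (fun l => c n l - (c n l - z n l))); last by move=> l _; rewrite subKr.
apply: (le_trans (l2B _ _ _)); apply: lerD; last exact: le_trans E1.
by have [] := psi_K (time_in (leqnn n)) us.
Qed.

Local Notation err := (psi (n%:R * tau) \- psiN n).

Lemma L2_error : nrm err <= B * (4 * K + err_const) * (tau + h ^+ 2).
Proof.
have [En _ _] := scheme_bounds; apply: (le_trans (nrm_err (leqnn n))).
rewrite -[leRHS]mulrA ler_wpM2l ?(ltW B_gt0)// [leRHS]mulrDl; apply: lerD => //.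
by rewrite mulrAC ler_wpM2l ?mulr_ge0// lerDr ltW.
Qed.

Lemma scheme_H2_bound : (Hnorm a b 2 (psiN n) <= (3 * (B * (K + 1 + lap_const)))%:E)%E.
Proof.
have [_ z0 z2] := scheme_bounds; have C0 := lap_const_ge0.
have p0 : 0 <= K + 1 + lap_const by rewrite addr_ge0// addr_ge0.
have z1 : l2 s (fun l => (mu l)%:C * z n l) <= K + 1 + lap_const.
  rewrite -ler_sqr ?nnegrE ?l2_ge0//; apply: (le_trans (l2_interpolation _ _ _ _)).
  rewrite expr2 ler_pM ?l2_ge0//; first by rewrite (le_trans z0)// lerDl.
  by rewrite (le_trans z2)// lerDr addr_ge0.
pose D (y : int -> R[i]) l := 'i%C * (mu l)%:C * y l.
(* The jet of a trigonometric sum is obtained by multiplying its coefficients. *)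
apply: (@Hnorm_le _ _ _ 2 _ (fun k => trig s (iter k D (z n)))).
- by rewrite mulr_ge0 ?(ltW B_gt0)// !addr_ge0.
- split; first by rewrite psiN_trig.
    by move=> k _; exact: L2_trig.
  by move=> k _; exact: weak_deriv_trig.
- move=> k k2; rewrite nrm_trig// ler_wpM2l ?sqrtr_ge0//.
  case: k k2 => [|[|[|//]]] _ /=.
  + by rewrite (le_trans z0)// lerDl.
  + apply: le_trans z1; apply: le_l2 => l _.
    by rewrite /D !normcM normc_i mul1r.
  + apply: le_trans (_ : lap_const <= _); last by rewrite lerDr addr_ge0.
    apply: le_trans z2; apply: le_l2 => l _.
    by rewrite /D !normcM normc_i !mul1r mulrA !normc_real normrX expr2.
Qed.

Lemma H1_error : tau <= 1 -> h <= 1 ->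
  (Hnorm a b 1 err <= (2 * (B * (4 * K + err_const + 2 * K +
     Num.sqrt (err_const * (K + lap_const))) * (Num.sqrt tau + h)))%:E)%E.
Proof.
move=> tau1 h1; have [En _ z2] := scheme_bounds; have C0 := lap_const_ge0.
have E0 := err_const_ge0; have tI := time_in (leqnn n).
have Lt := psi_L2 tI.
have [_ [g1 [Lg1 wg1 H]] _] := Hper2_fourier hab (psi_H2 tI) (fun s us => (psi_K tI us).2).
have q0 : 0 <= Num.sqrt tau by exact: sqrtr_ge0.
have th0 : 0 <= tau + h ^+ 2 by rewrite addr_ge0 ?sqr_ge0// ltW.
have qh : tau + h ^+ 2 <= Num.sqrt tau + h.
  apply: lerD; last by rewrite expr2 ler_piMl.
  by rewrite -{1}(sqr_sqrtr (ltW tau_gt0)) expr2 ler_piMl// -(sqrtr1 R) ler_wsqrtr.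
have qs : Num.sqrt (tau + h ^+ 2) <= Num.sqrt tau + h.
  rewrite -ler_sqr ?nnegrE ?sqrtr_ge0 ?addr_ge0// sqr_sqrtr//.
  have := mulr_ge0 q0 h_ge0; rewrite sqrrD (sqr_sqrtr (ltW tau_gt0)) mulr2n.
  by move: (_ * _) => X; lra.
have B0 := ltW B_gt0.
have CK0 : 0 <= K + lap_const by rewrite addr_ge0.
set C1 := Num.sqrt (err_const * (K + lap_const)).
have C10 : 0 <= C1 by exact: sqrtr_ge0.
pose g k := if k == 0%N then err else (fun x => g1 x - trig s (fun l => 'i%C * (mu l)%:C * z n l) x).
apply: (@Hnorm_le _ _ _ 1 _ g).
- by rewrite mulr_ge0 ?addr_ge0// mulr_ge0// !addr_ge0// mulr_ge0.
- split=> //.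
    by case=> [|k] _; rewrite /g/=; apply: L2B => //; exact: L2_trig.
  case=> [_|//]; rewrite /g/=; apply: weak_derivB => //; first exact: L2_trig.
  by rewrite psiN_trig; exact: weak_deriv_trig.
case=> [_|[_|//]]; rewrite /g/=.
  apply: (le_trans L2_error); apply: ler_pM => //.
    by rewrite mulr_ge0// addr_ge0// mulr_ge0.
  by rewrite ler_wpM2l// -addrA lerDl addr_ge0// mulr_ge0.
have Lc := L2_trig a b s (fun l => 'i%C * (mu l)%:C * c n l).
apply: (le_trans (nrm_triangle Lg1 Lc (L2_trig a b s _))).
rewrite nrm_trigB//; apply: (le_trans (lerD (H N N_gt0 N_even) (lexx _))).
rewrite -/h -/B -mulrDr -[leRHS]mulrA ler_wpM2l//.
have e1 : l2 s (fun l => 'i%C * (mu l)%:C * c n l - 'i%C * (mu l)%:C * z n l) <=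
    C1 * (Num.sqrt tau + h).
  apply: le_trans (_ : C1 * Num.sqrt (tau + h ^+ 2) <= _); last by rewrite ler_wpM2l.
  rewrite -sqrtrM; last exact: mulr_ge0.
  apply: (@le_trans _ _ (l2 s (fun l => (mu l)%:C * (c n l - z n l)))).
    by apply: le_l2 => l _; rewrite -mulrBr -mulrA normcM normc_i mul1r.
  rewrite -[leLHS]ger0_norm ?l2_ge0// -sqrtr_sqr ler_wsqrtr//.
  apply: (le_trans (l2_interpolation _ _ _ _)).
  rewrite mulrAC; apply: ler_pM; rewrite ?l2_ge0//.
  rewrite (@eq_l2 _ _ s _ (fun l => (mu l ^+ 2)%:C * c n l - (mu l ^+ 2)%:C * z n l)); last first.
    by move=> l _; rewrite mulrBr.
  apply: (le_trans (l2B _ _ _)); apply: lerD => //.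
  by have [] := psi_K tI us.
have e2 : 2 * h * K <= 2 * K * (Num.sqrt tau + h).
  by rewrite mulrAC ler_wpM2l ?mulr_ge0// lerDr.
have e3 : 0 <= (4 * K + err_const) * (Num.sqrt tau + h).
  by rewrite mulr_ge0 ?addr_ge0// mulr_ge0.
by move: e1 e2 e3; rewrite !mulrDl; move: (l2 _ _) => X; lra.
Qed.

End Scheme.
End ErrorEstimates.

(** * Choice of the constants *)

(** The condition under which [bootstrap] applies; the term with a square root is
    made smaller than [1 / 2] by bounding its square. *)
Lemma small_step (R : realType) (C c d : R) : 0 <= C -> 0 <= c -> 0 <= d ->
  exists2 e, 0 < e <= 1 & forall tau h, 0 < tau < e -> 0 <= h < e ->
    C * (tau + h ^+ 2) + c * Num.sqrt (C * (tau + h ^+ 2) * d) <= 1.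
Proof.
(* [q] dominates [2 C] and [4 c ^ 2 d C], for the two terms of the sum. *)
move=> C0 c0 d0; pose q := 2 * C + 4 * (c ^+ 2 * d * C) + 1.
have q0 : 0 < q by rewrite /q ltr_wpDl// addr_ge0// !mulr_ge0// sqr_ge0.
have cdC : 0 <= c ^+ 2 * d * C by rewrite !mulr_ge0 ?sqr_ge0.
have e0 : 0 < (4 * q)^-1 by rewrite invr_gt0 mulr_gt0.
exists (Num.min 1 (4 * q)^-1); first by rewrite lt_min ltr01 e0 ge_min lexx.
move=> tau h /andP[t0]; rewrite lt_min => /andP[t1 te] /andP[h0]; rewrite lt_min => /andP[h1 he].
set x := tau + h ^+ 2.
have x0 : 0 <= x by rewrite addr_ge0 ?sqr_ge0// ltW.
have xq : q * x <= 1 / 2.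
  have hh : h ^+ 2 <= h by rewrite expr2 ler_piMl// ltW.
  have : x <= 2 * (4 * q)^-1 by rewrite /x; move: hh te he; lra.
  move=> /(ler_wpM2l (ltW q0))/le_trans; apply.
  by apply: eq_ler; field; rewrite gt_eqF.
have h1' : C * x <= 1 / 2.
  apply: le_trans xq; rewrite ler_wpM2r// /q; move: cdC C0; lra.
have h2 : c * Num.sqrt (C * x * d) <= 1 / 2.
  rewrite -[c]ger0_norm// -sqrtr_sqr -sqrtrM ?sqr_ge0//.
  have -> : 1 / 2 = Num.sqrt ((1 / 2) ^+ 2) :> R by rewrite sqrtr_sqr ger0_norm// divr_ge0.
  apply: ler_wsqrtr; have -> : c ^+ 2 * (C * x * d) = c ^+ 2 * d * C * x by ring.
  have : 4 * (c ^+ 2 * d * C) * x <= q * x.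
    by rewrite ler_wpM2r// /q; move: C0; lra.
  by move: xq; rewrite expr2; move: (q * x) => X; rewrite -[4 * _ * x]mulrA; lra.
by move: h1' h2; lra.
Qed.

Theorem theorem4p2 (R : realType) (a b : R) (hab : a < b)
    (V : R -> R) (hV : Linfty a b V)
    (beta sigma : R) (hsigma : 0 < sigma)
    (T : R) (hT : 0 < T)
    (psi0 : R -> R[i]) (hpsi0 : L2 a b psi0)
    (psi dpsi : R -> R -> R[i])
    (hpsi_H2 : forall t : R, t \in `[0, T] -> Hper a b 2 (psi t))
    (hpsi_cont : time_continuous (Hnorm a b 2) T psi)
    (hpsi_C1 : time_C1_L2 a b T psi dpsi)
    (hpsi_NLSE : solves_NLSE a b V beta sigma T psi0 psi dpsi) :
  exists tau0 h0 C : R, [/\ 0 < tau0, 0 < h0, 0 < C &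
    forall (tau : R) (N n : nat), 0 < tau < tau0 ->
      (0 < N)%N -> ~~ odd N -> (b - a) / N%:R < h0 ->
      n%:R <= T / tau ->
      let h := (b - a) / N%:R in
      let psiN := sEWI_FS a b V beta sigma psi0 N tau n in
      let err := psi (n%:R * tau) \- psiN in
      [/\ (L2norm a b err <= (C * (tau + h ^+ 2))%:E)%E,
          (Hnorm a b 2 psiN <= C%:E)%E &
          (Hnorm a b 1 err <= (C * (Num.sqrt tau + h))%:E)%E]].
Proof.
have [mV [VM0 V_le0]] := hV.
have [K psi_K] := uniform_coef_bound hab hpsi_H2 hpsi_cont hpsi_C1.
have [Kd dpsi_K] := uniform_dpsi_bound hpsi_C1.
(* [VM0] itself may be negative. *)
pose VM := Num.max 0 VM0.
have VM_ge0 : 0 <= VM by rewrite le_max lexx.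
have V_le : {ae lebesgue_measure, forall x : R, x \in `]a, b[ -> `|V x| <= VM}.
  apply: ae_impl V_le0.
  by move=> x H /H; rewrite le_max => ->; rewrite orbT.
have T0 : 0 \in `[0, T] by rewrite in_itv/= lexx ltW.
have K_ge0 : 0 <= K.
  by have [+ _] := psi_K 0 T0 [::] isT; apply: le_trans; exact: l2_ge0.
pose E := err_const a b VM beta sigma T K Kd.
pose M := lap_const a b VM beta sigma T K.
have E0 : 0 <= E by exact: (err_const_ge0 hab beta VM_ge0 hsigma hT psi_K dpsi_K).
have M0 : 0 <= M by exact: (lap_const_ge0 hab beta VM_ge0 hsigma hT psi_K).
have B0 : 0 <= Num.sqrt (b - a) by exact: sqrtr_ge0.
have c0 : 0 <= 2 * (b - a) by rewrite mulr_ge0// subr_ge0 ltW.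
have [e /andP[e0 e1] small] := small_step E0 c0 (addr_ge0 K_ge0 M0).
pose C1 := Num.sqrt (b - a) * (4 * K + E).
pose C2 := 3 * (Num.sqrt (b - a) * (K + 1 + M)).
pose C3 := 2 * (Num.sqrt (b - a) * (4 * K + E + 2 * K + Num.sqrt (E * (K + M)))).
have C10 : 0 <= C1 by rewrite mulr_ge0// addr_ge0// mulr_ge0.
have C20 : 0 <= C2 by rewrite mulr_ge0// mulr_ge0// addr_ge0// addr_ge0.
have C30 : 0 <= C3.
  by rewrite mulr_ge0// mulr_ge0// addr_ge0 ?sqrtr_ge0// addr_ge0 ?addr_ge0// mulr_ge0.
exists e, e, (1 + C1 + C2 + C3); split=> //; first by move: C10 C20 C30; lra.
move=> tau N n /andP[tau_gt0 tau_e] N_gt0 N_even h_e n_le h psiN err.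
have h0 : 0 <= h by rewrite divr_ge0// subr_ge0 ltW.
have {}n_le : n%:R * tau <= T by rewrite -ler_pdivlMr.
have tI : n%:R * tau \in `[0, T] by rewrite in_itv/= mulr_ge0// ltW.
have sm : E * (tau + h ^+ 2) + 2 * (b - a) * Num.sqrt (E * (tau + h ^+ 2) * (K + M)) <= 1.
  by apply: small; rewrite ?tau_gt0 ?h0.
have th0 : 0 <= tau + h ^+ 2 by rewrite addr_ge0 ?sqr_ge0// ltW.
have qh0 : 0 <= Num.sqrt tau + h by rewrite addr_ge0 ?sqrtr_ge0.
have psiN_L2 : L2 a b psiN by rewrite /psiN scheme_trig ?gt_eqF//; exact: L2_trig.
have Lerr : L2 a b err by case: hpsi_C1 => H _ _; apply: L2B => //; have [] := H _ tI.
split.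
- rewrite L2normE// lee_fin; apply: le_trans (_ : C1 * (tau + h ^+ 2) <= _).
    exact: (L2_error hab mV VM_ge0 hsigma hT V_le hpsi0 hpsi_H2 hpsi_C1 hpsi_NLSE psi_K dpsi_K
      tau_gt0 N_gt0 N_even n_le sm).
  by rewrite ler_wpM2r//; move: C20 C30; lra.
- apply: le_trans (scheme_H2_bound hab mV VM_ge0 hsigma hT V_le hpsi0 hpsi_H2 hpsi_C1 hpsi_NLSE psi_K dpsi_K
      tau_gt0 N_gt0 N_even n_le sm) _.
  by rewrite lee_fin -/C2; move: C10 C30; lra.
- apply: le_trans (H1_error hab mV VM_ge0 hsigma hT V_le hpsi0 hpsi_H2 hpsi_C1 hpsi_NLSE psi_K dpsi_K
      tau_gt0 N_gt0 N_even n_le sm (ltW (lt_le_trans tau_e e1)) (ltW (lt_le_trans h_e e1))) _.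
  rewrite lee_fin !mulrA -!mulrA -/C3; apply: le_trans (_ : C3 * (Num.sqrt tau + h) <= _).
    by rewrite /C3 !mulrA.
  by rewrite ler_wpM2r//; move: C10 C20; lra.
Qed.
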